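(* Suppose $\mathbf{z}_t\in\mathbf{R}^d$, $t\in\mathbf{Z}$, satisfy the $(M,\alpha)$-short-range dependence with $M>8$ and $\alpha>8$, and that the dimension satisfies $d=d_1+d_2=O(T)$, where $T$ denotes the sample size. Then there exists a constant $C$, independent of $T$ and $d$, such that for any real vectors $\mathbf{a}_t\in\mathbf{R}^d$, $t=1,\dots,T$, and any integer $s\ge 0$, $$\left\Vert\sum_{t=1}^T\mathbf{a}_t^\top\mathbf{z}_t\right\Vert_M\le C\sqrt{\sum_{t=1}^T|\mathbf{a}_t|_2^2},\qquad \left\Vert\sum_{t=1}^T\mathbf{a}_t^\top\left(\mathbf{z}_t-\mathbf{E}[\mathbf{z}_t\mid\mathcal{F}_{t,s}]\right)\right\Vert_M\le\frac{C}{(1+s)^\alpha}\sqrt{\sum_{t=1}^T|\mathbf{a}_t|_2^2}.$$ Furthermore, assume that two integer bandwidths $1<\lambda_1<\lambda_2<T$ satisfy $\lambda_1\asymp T^{\kappa_1}$ and $\lambda_2\asymp T^{\kappa_2}$, where $1>\kappa_2>\kappa_1>\frac{5}{2(\alpha-2)}$. Then for any real symmetric matrices $\mathbf{A}_{t_1t_2}\in\mathbf{R}^{d\times d}$, $$\left\Vert\sum_{t_1=1+\lambda_1}^T\ \sum_{t_2=(t_1-\lambda_2)\vee1}^{t_1-\lambda_1}\left(\mathbf{z}_{t_1}^\top\mathbf{A}_{t_1t_2}\mathbf{z}_{t_2}-\mathbf{E}\left[\mathbf{z}_{t_1}^\top\mathbf{A}_{t_1t_2}\mathbf{z}_{t_2}\right]\right)\right\Vert_{M/2}=O\left(\sqrt{d\sum_{t_1=1+\lambda_1}^T\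 \sum_{t_2=(t_1-\lambda_2)\vee1}^{t_1-\lambda_1}|\mathbf{A}_{t_1t_2}|_2^2}\right).$$ Furthermore, there exists a constant $C>0$ such that for any integer $S>2\lambda_2$, $$\left\Vert\sum_{t_1=1+\lambda_1}^T\ \sum_{t_2=(t_1-\lambda_2)\vee1}^{t_1-\lambda_1}\left(\mathbf{z}_{t_1}^\top\mathbf{A}_{t_1t_2}\mathbf{z}_{t_2}-\mathbf{E}\left[\mathbf{z}_{t_1}^\top\mathbf{A}_{t_1t_2}\mathbf{z}_{t_2}\mid\mathcal{F}_{t_1,S}\right]\right)\right\Vert_{M/2}\le\frac{CT\sqrt{T}\,a^\dagger}{(S-\lambda_2)^{\alpha-2}},$$ where $a^\dagger=\max_{t_1=1+\lambda_1,\dots,T;\ t_2=(t_1-\lambda_2)\vee1,\dots,t_1-\lambda_1}|\mathbf{A}_{t_1t_2}|_2$.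
   Context: Notation. $a\wedge b=\min(a,b)$, $a\vee b=\max(a,b)$. For a real random variable $X$ and $m\ge1$, $\Vert X\Vert_m=\mathbf{E}[|X|^m]^{1/m}$. For a vector $|\mathbf{a}|_2$ is the Euclidean norm; for a matrix $|\mathbf{A}|_2$ is the largest singular value. $T$ is the sample size; the dimensions $d_1,d_2$ (with $d=d_1+d_2$), the process, the bandwidths and the matrices may all depend on $T$. $O(\cdot)$ means bounded by a constant multiple, with constants (and general constants $C$) not depending on $T$, $d$, or on the vectors and matrices $\mathbf{a}_t,\mathbf{A}_{t_1t_2}$; $a_T\asymp b_T$ means $a_T=O(b_T)$ and $b_T=O(a_T)$. Process. $\{e_t\}_{t\in\mathbf{Z}}$ are independent (not necessarily identically distributed) random elements of a measurable space $\mathbf{H}$, and $\mathbf{z}_t=g_{t,T}(\dots,e_{t-2},e_{t-1},e_t)\in\mathbf{R}^{d}$, where $g_{t,T}$ is a measurable function that may vary with $t$ and $T$. Let $\{e_t^\dagger\}_{t\in\mathbf{Z}}$ be an independent copy of $\{e_t\}_{t\in\mathbf{Z}}$ (independent of it, with $e_t^\dagger$ distributed as $e_t$ for every $t$, the $e_t^\dagger$ mutually independent). For $s\ge0$ let $\mathbf{z}_{t,s}=g_{t,T}(\dots,e_{t-s-2},e_{t-s-1},e^\dagger_{t-s},e_{t-s+1},\dots,e_t)$, and $\mathbf{z}_{t,s}=\mathbf{z}_t$ for $s<0$. Put $\delta_{t,s}=\sup_{|\mathbf{a}|_2=1}\Vert\mathbf{a}^\top(\mathbf{z}_t-\mathbf{z}_{t,s})\Vert_M$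 and $\delta_s=\sup_{t\in\mathbf{Z}}\delta_{t,s}$. $(M,\alpha)$-short-range dependence (for $M,\alpha>1$): $\mathbf{z}_t=g_{t,T}(\dots,e_{t-2},e_{t-1},e_t)$ for all $t\in\mathbf{Z}$, with $\{e_t\}_{t\in\mathbf{Z}}$ independent random elements of $\mathbf{H}$ and $g_{t,T}$ measurable, $\mathbf{E}[\mathbf{z}_t]=0$ for all $t$, $\sup_{t\in\mathbf{Z},\,|\mathbf{a}|_2=1}\Vert\mathbf{a}^\top\mathbf{z}_t\Vert_M=O(1)$, and $\sup_{s\ge0}(1+s)^\alpha\sum_{q=s}^\infty\delta_q=O(1)$. For $t\in\mathbf{Z}$ and $s\ge0$, $\mathcal{F}_{t,s}$ is the $\sigma$-field generated by $e_t,e_{t-1},\dots,e_{t-s}$. *)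

(* Defs.v *)
From HB Require Import structures.
From mathcomp Require Import all_boot all_order all_algebra finmap.
From mathcomp Require Import all_classical all_reals all_analysis.
Set Implicit Arguments.
Unset Strict Implicit.
Unset Printing Implicit Defensive.
Import Order.TTheory GRing.Theory Num.Theory.
Import numFieldNormedType.Exports.
Local Open Scope classical_set_scope.
Local Open Scope ring_scope.

(* Constants in [unif_bigO] are uniform over all sample sizes T >= T0, not merely
   eventual.  It is only used with nonnegative sequences; f may be
   extended-real so that "f = O(g)" includes the finiteness of f. *)
Definition unif_bigO (R : realType) (T0 : nat) (f : nat -> \bar R) (g : nat -> R)
    : Prop :=
  exists C : R, forall T : nat, (T0 <= T)%N -> (f T <= (C * g T)%:E)%E.

Definition unif_asymp (R : realType) (T0 : nat) (f g : nat -> R) : Prop :=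
  unif_bigO T0 (EFin \o f) g /\ unif_bigO T0 (EFin \o g) f.

Definition vnorm2 (R : realType) (d : nat) (a : 'cV[R]_d) : R :=
  Num.sqrt (\sum_i a i 0 ^+ 2).

Definition dotp (R : realType) (d : nat) (a x : 'cV[R]_d) : R :=
  (a^T *m x) 0 0.

Definition bilin (R : realType) (d : nat) (x : 'cV[R]_d) (A : 'M[R]_d)
    (y : 'cV[R]_d) : R :=
  (x^T *m A *m y) 0 0.

Definition singular_value (R : realType) (d : nat) (A : 'M[R]_d) (s : R)
    : Prop :=
  0 <= s /\ eigenvalue (A^T *m A) (s ^+ 2).

(* The supremum is a maximum: the set is finite, and nonempty when d > 0. *)
Definition mnorm2 (R : realType) (d : nat) (A : 'M[R]_d) : R :=
  sup [set s | singular_value A s].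

Definition seq_measurable (dH : measure_display) (H : measurableType dH)
    (R : realType) (d : nat) (g : (nat -> H) -> 'cV[R]_d) : Prop :=
  forall i : 'I_d,
    measurable_fun
      [set: g_sigma_algebraType (\bigcup_(k in [set: nat])
          preimage_set_system [set: nat -> H] (fun h => h k) measurable)]
      (fun h : nat -> H => g h i 0).

Definition rvnorm (dO : measure_display) (Omega : measurableType dO)
    (R : realType) (P : probability Omega R) (m : R) (X : Omega -> R) : \bar R :=
  ('N[P]_(m%:E)[EFin \o X])%E.

Section innovations.
Context (dO dH : measure_display) (Omega : measurableType dO)
  (H : measurableType dH) (R : realType) (P : probability Omega R).
Implicit Types e edag : int -> {RV P >-> H}.

Definition sigma_field e (J : set int) : set (set Omega) :=
  <<s \bigcup_(t in J) preimage_set_system [set: Omega] (e t) measurable >>.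

Definition F_ e (t : int) (s : nat) : set (set Omega) :=
  sigma_field e [set u | t - s%:Z <= u <= t].

Definition mutually_independent e : Prop :=
  forall (J : {fset int}) (B : int -> set H),
    (forall t, measurable (B t)) ->
    P (\bigcap_(t in [set` J]) (e t @^-1` B t)) =
    (\prod_(t <- J) P (e t @^-1` B t))%E.

Definition independent_copy e edag : Prop :=
  [/\ mutually_independent edag,
      forall t (B : set H), measurable B ->
        distribution P (edag t) B = distribution P (e t) B
    & forall A B : set Omega,
        sigma_field e setT A -> sigma_field edag setT B ->
        P (A `&` B) = (P A * P B)%E].

(* Y is a version of E[X | G]; for integrable X versions exist and are
   P-almost surely unique. *)
Definition cond_exp_version (G : set (set Omega)) (X Y : Omega -> R) : Prop :=
  [/\ forall B : set R, measurable B -> G (Y @^-1` B),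
      P.-integrable setT (EFin \o Y)
    & forall A : set Omega, G A ->
        (\int[P]_(w in A) (Y w)%:E = \int[P]_(w in A) (X w)%:E)%E].

Definition cond_exp_version_vec (d : nat) (G : set (set Omega))
    (X Y : Omega -> 'cV[R]_d) : Prop :=
  forall i : 'I_d,
    cond_exp_version G (fun w => X w i 0) (fun w => Y w i 0).

(* The infinite past (..., e_{t-1}, e_t) is encoded as the sequence whose
   k-th entry is e_{t-k}. *)
Definition process (d : nat) (g : int -> (nat -> H) -> 'cV[R]_d) e
    (t : int) (w : Omega) : 'cV[R]_d :=
  g t (fun k : nat => e (t - k%:Z) w).

Definition coupled_process (d : nat) (g : int -> (nat -> H) -> 'cV[R]_d) e edag
    (t : int) (s : nat) (w : Omega) : 'cV[R]_d :=
  g t (fun k : nat => if k == s then edag (t - k%:Z) w else e (t - k%:Z) w).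

Definition delta_ (d : nat) (g : int -> (nat -> H) -> 'cV[R]_d) e edag (M : R)
    (t : int) (s : nat) : \bar R :=
  ereal_sup
    [set rvnorm P M (fun w =>
        dotp a (process g e t w - coupled_process g e edag t s w))
     | a in [set a : 'cV[R]_d | vnorm2 a = 1]].

Definition delta (d : nat) (g : int -> (nat -> H) -> 'cV[R]_d) e edag (M : R)
    (s : nat) : \bar R :=
  ereal_sup [set delta_ g e edag M t s | t in [set: int]].

Definition short_range_dependent (T0 : nat) (d : nat -> nat)
    (g : forall T : nat, int -> (nat -> H) -> 'cV[R]_(d T)) e edag
    (M alpha : R) : Prop :=
  [/\ mutually_independent e,
      forall T t, (T0 <= T)%N -> seq_measurable (g T t),
      forall T t (i : 'I_(d T)), (T0 <= T)%N ->
        ('E_P[fun w => process (g T) e t w i 0%R] = 0)%E,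
      unif_bigO T0 (fun T => ereal_sup
        [set rvnorm P M (fun w => dotp ta.2 (process (g T) e ta.1 w))
         | ta in [set ta : int * 'cV[R]_(d T) | vnorm2 ta.2 = 1]]) (fun=> 1)
    & unif_bigO T0 (fun T => ereal_sup
        [set (((1 + s%:R) `^ alpha)%:E *
              \sum_(s <= q <oo) delta (g T) e edag M q)%E
         | s in [set: nat]]) (fun=> 1)].

End innovations.

(* Main.v *)
Require Import Defs.
From HB Require Import structures.
From mathcomp Require Import all_boot all_order all_algebra finmap.
From mathcomp Require Import all_classical all_reals all_analysis.
From mathcomp Require Import measurable_realfun.
From mathcomp Require complex spectral sesquilinear.
From mathcomp Require Import ring lra zify.
Set Implicit Arguments.
Unset Strict Implicit.
Unset Printing Implicit Defensive.
Import Order.TTheory GRing.Theory Num.Theory.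
Import numFieldNormedType.Exports.
Local Open Scope classical_set_scope.
Local Open Scope ring_scope.

(** Let [mu] be the law of the whole path (e_j), j in Z, on the space [traj H]
    of trajectories.  Independence of the innovations is used in one form only:
    exchanging any set of coordinates between two independent paths preserves
    [mu \x mu] ([path_law_swap]).  For a set J of times, the conditional
    expectation given (e_j), j in J, is then the explicit function [condE mu J f],
    the integral of f over a path that keeps its coordinates in J and has the
    others resampled; every version in the sense of sigma-fields agrees with it
    almost surely ([cond_exp_version_condE]).  Removing one time k from J changes
    it by [projD mu J k f].  This difference has p-norm at most the one of the
    effect on f of resampling e_k ([bnd_projD]), which is what the coefficients
    delta_s measure, and it is orthogonal to every function that does not involve
    coordinate k ([Rintegral_mul_projD]), which is how martingale differences arise.

    Martingale differences are summed by Burkholder's inequality for exponents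
    p > 2 ([burkholder]), by induction on the number of terms: in the Taylor bound
    |x + y|^p <= |x|^p + p sgn(x) |x|^(p-1) y + c (|x|^(p-2) y^2 + |y|^p)
    the linear term integrates to zero, and Hoelder's inequality controls the rest.

    Linear forms.  Let window t r be the r times up to t.  The difference
    between z_t and its conditional expectation given window t s is the sum over
    r >= s of the differences that remove time t - r from window t (r + 1).  With
    r fixed and t decreasing these are martingale differences of norm at most
    |a_t| delta_r, so their sum over t is at most a constant times
    delta_r sqrt(sum |a_t|^2), and summing delta_r over r >= s gives the rate
    (1 + s)^-alpha ([telescoping_bnd]).  For s = 0 the window is empty and the
    conditional expectation is the mean, zero: this is the first bound.  The last
    bound of the theorem is the same argument with exponent M / 2, applied to
    sum_{t2} z_{t1}' A_{t1 t2} z_{t2} as a function of the past of t1: resampling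
    time t1 - q acts on z_{t1} with lag q and on z_{t2} with lag q - (t1 - t2)
    ([bil_diff], [lagsum_window_bnd]).

    Centered quadratic form.  Replace z_{t1} by its conditional expectation given
    its last lambda_1 innovations.  Those are independent of the vector
    V = sum_{t2} A_{t1 t2} z_{t2}, since t2 <= t1 - lambda_1.  Splitting along the
    lag q, the term for t1 is the scalar product of V with a martingale difference
    vector D of lag q; with V frozen this is a linear form of D, whence a norm at
    most delta_q times the norm of |V|_2 ([bnd_independent_dot]), and these scalar
    products are martingale differences in t1, to which Burkholder's inequality
    applies ([main_term_bnd]).  Replacing z_{t1} costs a factor lambda_1^-alpha
    per coordinate, and the triangle inequality then loses at most a factor
    sqrt(d T), which is O(T); since kappa_1 alpha >= 1, T lambda_1^-alpha is
    bounded ([lag_growth]).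

    The factor d under the root comes from |A|_F^2 <= d |A|_2^2
    ([mnorm2_frobenius]): the squared Frobenius norm is the sum of the d
    eigenvalues of A' A, and each of them is the square of a singular value. *)

(** * Taylor bound for powers of the absolute value *)

Section scalar.
Context {R : realType}.
Implicit Types a b x y p q r : R.

(** Convexity of the q-th power: the tangent at b lies below the graph.  It is
    Young's inequality for a and b `^ (q - 1), and b = 0 is allowed. *)
Lemma powR_tangent a b q : 0 <= a -> 0 <= b -> 1 <= q ->
  q * (a * b `^ (q - 1)) <= a `^ q + (q - 1) * b `^ q.
Proof.
move=> a0 b0; rewrite le_eqVlt => /predU1P[<-|q1].
  by rewrite subrr powRr0 !mul1r mulr1 mul0r addr0 powRr1.
have q0 : 0 < q by rewrite (lt_trans ltr01).
have q10 : 0 < q - 1 by rewrite subr_gt0.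
have := @conjugate_powR R a (b `^ (q - 1)) q (q / (q - 1)) a0 (powR_ge0 _ _) q0
  (divr_gt0 q0 q10).
rewrite -powRrM (_ : (q - 1) * (q / (q - 1)) = q); last by field; rewrite gt_eqF.
move=> /(_ ltac:(by field; rewrite !gt_eqF)).
rewrite -(ler_pM2l q0) => /le_trans; apply.
rewrite le_eqVlt; apply/orP; left; apply/eqP; field.
by rewrite !gt_eqF.
Qed.

(** The signed power: p * spow (p - 1) is the derivative of |x| `^ p. *)
Definition spow q x := Num.sg x * `|x| `^ q.

Lemma norm_spow q x : 0 < q -> `|spow q x| = `|x| `^ q.
Proof.
move=> q0; rewrite /spow normrM normr_sg (ger0_norm (powR_ge0 _ _)).
by have [->|x0] := eqVneq x 0; rewrite ?normr0 ?powR0 ?gt_eqF ?mulr0 ?mul1r.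
Qed.

Lemma spow_mul q x : 0 < q -> spow q x * x = `|x| `^ (q + 1).
Proof.
move=> q0; rewrite /spow mulrAC.
have -> : Num.sg x * x = `|x| by rewrite normrEsg.
by rewrite -[in RHS](mulr_powRB1 (normr_ge0 _)) ?addr_gt0 // addrK.
Qed.

(** The tangent inequality on the whole line: the cross term only increases when
    x and z are replaced by their absolute values. *)
Lemma spow_tangent p x z : 1 < p ->
  `|z| `^ p <= `|x| `^ p + p * (spow (p - 1) z * (z - x)).
Proof.
move=> p1; have p10 : 0 < p - 1 by rewrite subr_gt0.
have := powR_tangent (normr_ge0 x) (normr_ge0 z) (ltW p1).
rewrite mulrBr spow_mul// subrK mulrBr => h.
suff : p * (spow (p - 1) z * x) <= p * (`|x| * `|z| `^ (p - 1)) by lra.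
rewrite ler_pM2l ?(lt_trans ltr01)// (le_trans (ler_norm _))// normrM norm_spow//.
by rewrite mulrC.
Qed.

(** A mean value bound, which follows from the tangent inequality for [0, +oo[
    after a discussion of signs. *)
Lemma spow_lip q x z : 1 <= q ->
  `|spow q z - spow q x| <= q * Num.max `|x| `|z| `^ (q - 1) * `|z - x|.
Proof.
move=> q1; have q0 : 0 < q by rewrite (lt_le_trans ltr01).
have q0' := ltW q0.
have key (u v : R) : 0 <= u -> u <= v -> v `^ q - u `^ q <= q * v `^ (q - 1) * (v - u).
  move=> u0 uv; have v0 := le_trans u0 uv.
  have := powR_tangent u0 v0 q1.
  by have := mulr_powRB1 v0 q0; nra.
have nn (u v : R) : 0 <= u -> u <= v -> 0 <= v `^ q - u `^ q.
  by move=> u0 uv; rewrite subr_ge0 ge0_ler_powR ?nnegrE ?(le_trans u0 uv)//.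
have opp (u v : R) : 0 <= u -> u <= v -> u `^ q + v `^ q <= q * v `^ (q - 1) * (u + v).
  move=> u0 uv; have v0 := le_trans u0 uv.
  have h1 : u `^ q <= v `^ (q - 1) * u.
    rewrite -(mulr_powRB1 u0 q0) mulrC ler_wpM2r// ge0_ler_powR ?nnegrE ?subr_ge0//.
  have h2 := mulr_powRB1 v0 q0.
  have h3 : 0 <= v `^ (q - 1) * (u + v) by rewrite mulr_ge0 ?powR_ge0 ?addr_ge0.
  by nra.
(* The claim is symmetric in x and z. *)
wlog xz : x z / `|x| <= `|z|.
  move=> wl; case: (leP `|x| `|z|) => [xz|/ltW xz].
    by have := wl _ _ xz; rewrite (max_idPr xz).
  by have := wl _ _ xz; rewrite (max_idPr xz) distrC (distrC x).
rewrite (max_idPr xz) /spow.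
have [z0|z0|z0] := ltgtP z 0.
- rewrite (ltr0_sg z0) (ltr0_norm z0) in xz *.
  have [x0|x0|->] := ltgtP x 0.
  + rewrite (ltr0_sg x0) (ltr0_norm x0) in xz *.
    have x0' : 0 <= - x by lra.
    rewrite (_ : -1 * _ - _ = - ((- z) `^ q - (- x) `^ q)); last by lra.
    rewrite normrN ger0_norm ?nn// (_ : z - x = - (- z - - x)); last by lra.
    by rewrite normrN (@ger0_norm _ (_ - _)) ?subr_ge0// key.
  + rewrite (gtr0_sg x0) (gtr0_norm x0) in xz *.
    have := opp _ _ (ltW x0) xz.
    rewrite (_ : -1 * _ - _ = - (x `^ q + (- z) `^ q)); last by lra.
    rewrite normrN ger0_norm ?addr_ge0 ?powR_ge0// => /le_trans; apply.
    rewrite ler_wpM2l ?mulr_ge0 ?powR_ge0//.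
    by rewrite distrC; exact: ler_norm.
  + rewrite normr0 sgr0 mul0r !subr0 mulN1r normrN ger0_norm ?powR_ge0//.
    rewrite (ltr0_norm z0) -mulrA (mulrC _ (- z)) mulr_powRB1; [|lra..].
    by rewrite ler_peMl ?powR_ge0.
- rewrite (gtr0_sg z0) (gtr0_norm z0) in xz *.
  have [x0|x0|->] := ltgtP x 0.
  + rewrite (ltr0_sg x0) (ltr0_norm x0) in xz *.
    have x0' : 0 <= - x by lra.
    have := opp _ _ x0' xz.
    rewrite (_ : 1 * _ - _ = ((- x) `^ q + z `^ q)); last by lra.
    rewrite ger0_norm ?addr_ge0 ?powR_ge0// => /le_trans; apply.
    rewrite ler_wpM2l ?mulr_ge0 ?powR_ge0//.
    by rewrite (le_trans _ (ler_norm _))//; lra.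
  + rewrite (gtr0_sg x0) (gtr0_norm x0) in xz *.
    rewrite !mul1r (@ger0_norm _ (z `^ q - _)) ?(@ger0_norm _ (z - _)) ?subr_ge0//.
      by rewrite key// ltW.
    by rewrite -subr_ge0 nn// ltW.
  + rewrite normr0 sgr0 mul0r !subr0 mul1r ger0_norm ?powR_ge0//.
    rewrite (gtr0_norm z0) -mulrA (mulrC _ z) mulr_powRB1; [|lra..].
    by rewrite ler_peMl ?powR_ge0.
- move: xz; rewrite z0 normr0 normr_le0 => /eqP ->.
  by rewrite sgr0 !mul0r subrr !normr0 mulr0.
Qed.

Lemma powRD_le a b r : 0 <= a -> 0 <= b -> 0 <= r ->
  (a + b) `^ r <= 2 `^ r * (a `^ r + b `^ r).
Proof.
move=> a0 b0 r0.
apply: (@le_trans _ _ ((2 * Num.max a b) `^ r)).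
  rewrite ge0_ler_powR ?nnegrE ?addr_ge0 ?mulr_ge0 ?le_max ?a0//.
  have : a <= Num.max a b by rewrite le_max lexx.
  have : b <= Num.max a b by rewrite le_max lexx orbT.
  by lra.
rewrite powRM ?le_max ?a0// ler_wpM2l ?powR_ge0//.
by case: (leP a b) => _; rewrite ?lerDl ?lerDr powR_ge0.
Qed.

Definition taylor_cst p := p * (p - 1) * 2 `^ (p - 2).

(** By convexity the increment of |x| `^ p is at most y times the slope at x + y; [spow_lip] bounds the error of taking the slope at x instead. *)
Lemma powR_taylor p x y : 2 <= p ->
  `|x + y| `^ p <= `|x| `^ p + p * (spow (p - 1) x * y) +
    taylor_cst p * (`|x| `^ (p - 2) * y ^+ 2 + `|y| `^ p).
Proof.
move=> p2; have p0 : 0 < p by lra.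
have p1 : 1 < p by lra.
have := spow_tangent x (x + y) p1; rewrite (addrC x) addrK (addrC y).
move=> /le_trans; apply; rewrite -addrA lerD2l -lerBlDl -mulrBr -mulrBl.
rewrite /taylor_cst -!mulrA ler_wpM2l //; first by lra.
apply: (le_trans (ler_norm _)); rewrite normrM.
have p11 : 1 <= p - 1 by lra.
have := spow_lip x (x + y) p11.
rewrite (_ : x + y - x = y); last by lra.
rewrite (_ : p - 1 - 1 = p - 2); last by lra.
move=> /(ler_wpM2r (normr_ge0 y)) /le_trans; apply.
rewrite -!mulrA ler_wpM2l//; first by lra.
have -> : `|y| * `|y| = y ^+ 2 by rewrite -expr2 real_normK ?num_real.
have h : Num.max `|x| `|x + y| `^ (p - 2) <=
    2 `^ (p - 2) * (`|x| `^ (p - 2) + `|y| `^ (p - 2)).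
  apply: (@le_trans _ _ ((`|x| + `|y|) `^ (p - 2))).
    have p20 : 0 <= p - 2 by lra.
    rewrite (ge0_ler_powR p20) ?nnegrE ?le_max ?normr_ge0 ?addr_ge0//.
    by rewrite ge_max lerDl normr_ge0 ler_normD.
  by apply: powRD_le => //; lra.
move: h => /(ler_wpM2r (sqr_ge0 y)) /le_trans; apply.
rewrite -mulrA ler_wpM2l ?powR_ge0// mulrDl lerD2l.
have -> : `|y| `^ p = `|y| `^ (p - 2) * y ^+ 2; last exact: lexx.
rewrite -(real_normK (num_real y)) -powR_mulrn// -powRD ?subrK//.
by rewrite gt_eqF.
Qed.

End scalar.

(** * Calculus of p-norm bounds *)

Section Lp_bounds.
Context d (T : measurableType d) (R : realType).
Implicit Types (mu : {measure set T -> \bar R}) (p q K L : R) (f g : T -> R).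

(** The p-norm of f is at most K.  Comparing p-th powers makes such bounds
    follow from integrated pointwise inequalities, and measurability is included
    because the sums and products formed below need it. *)
Definition bnd mu p f K : Prop :=
  [/\ measurable_fun [set: T] f, 0 <= K
    & (\int[mu]_x (`|f x| `^ p)%:E <= (K `^ p)%:E)%E].

Lemma measurable_normpow f p : measurable_fun [set: T] f ->
  measurable_fun [set: T] (fun x => `|f x| `^ p).
Proof.
move=> mf; apply: (@measurableT_comp _ _ _ _ _ _ (fun x => x `^ p)) => //.
exact: measurableT_comp.
Qed.

Lemma bnd_Lnorm mu p f K : 0 < p -> measurable_fun [set: T] f -> 0 <= K ->
  bnd mu p f K <-> ('N[mu]_(p%:E)[EFin \o f] <= K%:E)%E.
Proof.
move=> p0 mf K0; split=> [[_ _ h]|h].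
  rewrite unlock /=.
  apply: (@le_trans _ _ ((K `^ p)%:E `^ p^-1)%E).
    apply: gt0_ler_poweR => //; rewrite ?invr_ge0 ?ltW//.
    - by rewrite in_itv/= leey andbT integral_ge0// => x _; rewrite lee_fin powR_ge0.
    - by rewrite in_itv/= leey andbT lee_fin powR_ge0.
  by rewrite poweR_EFin -powRrM divff ?gt_eqF// powRr1.
split=> //.
have := poweR_Lnorm mu (EFin \o f) (lt0r_neq0 p0) => /= <-.
rewrite -poweR_EFin; apply: gt0_ler_poweR => //; rewrite ?ltW//.
  by rewrite in_itv/= leey andbT Lnorm_ge0.
by rewrite in_itv/= leey andbT lee_fin.
Qed.

Lemma bnd_le mu p f K L : 0 <= p -> K <= L -> bnd mu p f K -> bnd mu p f L.
Proof.
move=> p0 KL [mf K0 h]; split=> //; first exact: le_trans KL.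
by rewrite (le_trans h)// lee_fin ge0_ler_powR// nnegrE// (le_trans K0).
Qed.

Lemma bnd_add mu p f g K L : 1 <= p -> bnd mu p f K -> bnd mu p g L ->
  bnd mu p (fun x => f x + g x) (K + L).
Proof.
move=> p1 bf bg; have p0 : 0 < p by rewrite (lt_le_trans ltr01).
have [mf K0 _] := bf; have [mg L0 _] := bg.
apply/bnd_Lnorm => //; [exact: measurable_funD|exact: addr_ge0|].
rewrite EFinD (le_trans (minkowski_EFin mu mf mg p1))//.
by rewrite leeD//; [move/bnd_Lnorm: bf => ->|move/bnd_Lnorm: bg => ->].
Qed.

Lemma bnd_cst0 mu p : 0 < p -> bnd mu p (fun=> 0) 0.
Proof.
move=> p0; split=> //; rewrite normr0 powR0 ?gt_eqF//.
by rewrite integral0.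
Qed.

Lemma bnd_sum (I : eqType) (s : seq I) mu p (f : I -> T -> R) (K : I -> R) :
  1 <= p -> (forall i, i \in s -> bnd mu p (f i) (K i)) ->
  bnd mu p (fun x => \sum_(i <- s) f i x) (\sum_(i <- s) K i).
Proof.
move=> p1; elim: s => [_|i s IH h].
  under eq_fun do rewrite big_nil.
  by rewrite big_nil; apply: bnd_cst0; rewrite (lt_le_trans ltr01).
under eq_fun do rewrite big_cons.
rewrite big_cons; apply: bnd_add => //; first by apply: h; rewrite mem_head.
by apply: IH => j js; apply: h; rewrite inE js orbT.
Qed.

Lemma bnd_scale mu p c f K : 0 < p -> bnd mu p f K ->
  bnd mu p (fun x => c * f x) (`|c| * K).
Proof.
move=> p0 [mf K0 h]; split; [exact: measurable_funM|exact: mulr_ge0|].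
under eq_integral do rewrite normrM powRM// EFinM.
rewrite ge0_integralZl_EFin ?powR_ge0//; last first.
  by apply/measurable_EFinP; exact: measurable_normpow.
by rewrite powRM// EFinM lee_wpmul2l// lee_fin powR_ge0.
Qed.

Lemma bnd_opp mu p f K : 0 < p -> bnd mu p f K -> bnd mu p (fun x => - f x) K.
Proof.
move=> p0 /(@bnd_scale _ _ (-1) _ _ p0); rewrite normrN1 mul1r.
by under eq_fun do rewrite mulN1r.
Qed.

Lemma bnd_sub mu p f g K L : 1 <= p -> bnd mu p f K -> bnd mu p g L ->
  bnd mu p (fun x => f x - g x) (K + L).
Proof.
move=> p1 bf bg.
exact: (bnd_add p1 bf (bnd_opp (lt_le_trans ltr01 p1) bg)).
Qed.

Lemma bnd_mul mu p f g K L : 0 < p -> bnd mu p f K -> bnd mu p g L ->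
  bnd mu (p / 2) (fun x => f x * g x) (K * L).
Proof.
move=> p0 [mf K0 hf] [mg L0 hg]; split; [exact: measurable_funM|exact: mulr_ge0|].
have half_p : p / 2 * 2 = p by field.
pose F x := `|f x| `^ (p / 2); pose G x := `|g x| `^ (p / 2).
have mF : measurable_fun setT F by exact: measurable_normpow.
have mG : measurable_fun setT G by exact: measurable_normpow.
have := @hoelder _ _ _ mu F G 2 2 mF mG ltac:(lra) ltac:(lra) ltac:(lra).
rewrite Lnorm1 => h.
have bF (u : T -> R) (H : R) : measurable_fun setT u -> 0 <= H ->
    (\int[mu]_x (`|u x| `^ p)%:E <= (H `^ p)%:E)%E ->
    ('N[mu]_2%:E[EFin \o (fun x => `|u x| `^ (p / 2))%R] <= (H `^ (p / 2))%:E)%E.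
  move=> mu_ H0 hu; apply/bnd_Lnorm => //; rewrite ?powR_ge0//.
    exact: measurable_normpow.
  split; [exact: measurable_normpow|exact: powR_ge0|].
  rewrite -powRrM half_p; apply: le_trans hu.
  by under eq_integral do rewrite ger0_norm ?powR_ge0// -powRrM half_p.
have -> : (\int[mu]_x (`|(f x * g x)%R| `^ (p / 2))%:E =
    \int[mu]_x `|(EFin \o (F \* G)%R) x|)%E.
  apply: eq_integral => x _ /=.
  by rewrite normrM powRM// (@ger0_norm _ (F x * G x)) ?mulr_ge0 ?powR_ge0.
by rewrite (le_trans h)// powRM// EFinM lee_pmul ?Lnorm_ge0//; exact: bF.
Qed.

(** The exponent doubles because the p-th power of a square root is a power p / 2. *)
Lemma bnd_sqrt mu p f K : (forall x, 0 <= f x) -> bnd mu (p / 2) f K ->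
  bnd mu p (fun x => Num.sqrt (f x)) (Num.sqrt K).
Proof.
move=> f0 [mf K0 h]; split; last 2 first.
- exact: sqrtr_ge0.
- rewrite -powR12_sqrt// -powRrM mulrC; apply: le_trans h.
  under eq_integral => x _.
    rewrite ger0_norm ?sqrtr_ge0// -powR12_sqrt// -powRrM mulrC.
    over.
  by under [leRHS]eq_integral => x _ do rewrite ger0_norm//.
- under eq_fun => x do rewrite -powR12_sqrt//.
  exact: (@measurableT_comp _ _ _ _ _ _ (fun x => x `^ 2^-1)).
Qed.

(** The squares have exponent p / 2 >= 1, where the triangle inequality holds. *)
Lemma bnd_norm2 (I : eqType) (s : seq I) mu p (f : I -> T -> R) (K : I -> R) :
  2 <= p -> (forall i, i \in s -> bnd mu p (f i) (K i)) ->
  bnd mu p (fun x => Num.sqrt (\sum_(i <- s) f i x ^+ 2))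
    (Num.sqrt (\sum_(i <- s) K i ^+ 2)).
Proof.
move=> p2 h; apply: bnd_sqrt => [x|].
  by apply: sumr_ge0 => i _; exact: sqr_ge0.
apply: bnd_sum => [|i si]; first by lra.
by apply: bnd_mul; [lra|exact: h|exact: h].
Qed.

Lemma bnd_ae mu p f g K : measurable_fun [set: T] g ->
  (\forall x \ae mu, f x = g x) -> bnd mu p f K -> bnd mu p g K.
Proof.
move=> mg fg [mf K0 h]; split; [exact: mg|exact: K0|apply: le_trans h].
rewrite le_eqVlt; apply/orP; left; apply/eqP; apply: ae_eq_integral => //.
- by apply/measurable_EFinP; exact: measurable_normpow.
- by apply/measurable_EFinP; exact: measurable_normpow.
- by apply: filterS fg => x -> _.
Qed.

End Lp_bounds.

(** * Scalar inequalities for truncation and for the Burkholder constant *)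

Section scalar_constants.
Context {R : realType}.
Implicit Types a b c p q r s u : R.

(** The larger of a and b dominates both factors. *)
Lemma powR_mix_le a b p q : 0 <= a -> 0 <= b -> 0 < p -> 0 < q ->
  a `^ p * b `^ q <= a `^ (p + q) + b `^ (p + q).
Proof.
move=> a0 b0 p0 q0.
have pq : p + q != 0 by rewrite gt_eqF// addr_gt0.
have D t : t `^ (p + q) = t `^ p * t `^ q by rewrite powRD// (negbTE pq).
have [Da Db] : 0 <= a `^ (p + q) /\ 0 <= b `^ (p + q) by rewrite !powR_ge0.
case: (leP a b) => [ab|/ltW ab].
- apply: (@le_trans _ _ (b `^ (p + q))); last by rewrite lerDr.
  by rewrite D ler_wpM2r ?powR_ge0// ge0_ler_powR ?nnegrE// ltW.
- apply: (@le_trans _ _ (a `^ (p + q))); last by rewrite lerDl.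
  by rewrite D ler_wpM2l ?powR_ge0// ge0_ler_powR ?nnegrE// ltW.
Qed.

Lemma powR_le1D a q p : 0 <= a -> 0 <= q -> q <= p -> a `^ q <= 1 + a `^ p.
Proof.
move=> a0 q0 qp; have [a1|/ltW a1] := leP a 1.
  rewrite ler_wpDr ?powR_ge0//.
  have : a `^ q <= 1 `^ q by rewrite ge0_ler_powR ?nnegrE.
  by rewrite powR1.
by rewrite ler_wpDl// ler_powR.
Qed.

(** The p-th power truncated at level c is Lipschitz, so that an approximation
    in L1 controls its integral. *)
Lemma powR_trunc_lip a b c p : 1 <= p -> 0 <= a -> 0 <= b -> 0 <= c ->
  Num.min a c `^ p <= Num.min b c `^ p + p * c `^ (p - 1) * `|a - b|.
Proof.
move=> p1 a0 b0 c0.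
have p0 : 0 < p by lra.
set v := Num.min a c; set w := Num.min b c.
have v0 : 0 <= v by rewrite le_min a0.
have w0 : 0 <= w by rewrite le_min b0.
have vc : v <= c by rewrite ge_min lexx orbT.
have vw : v - w <= `|a - b|.
  rewrite /v /w; have := ler_norm (a - b).
  by case: (leP a c) => h1; case: (leP b c) => h2; have := normr_ge0 (a - b); lra.
have R0 : 0 <= p * c `^ (p - 1) * `|a - b| by rewrite !mulr_ge0 ?powR_ge0// ltW.
have [le_vw|/ltW wv] := leP v w.
  by rewrite (@le_trans _ _ (w `^ p)) ?lerDl// ge0_ler_powR ?nnegrE// ltW.
have := powR_tangent w0 v0 p1.
have := mulr_powRB1 v0 p0.
have : v `^ (p - 1) <= c `^ (p - 1) by rewrite ge0_ler_powR ?nnegrE// subr_ge0.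
move=> h1 h2 h3.
have : p * v `^ (p - 1) * (v - w) <= p * c `^ (p - 1) * `|a - b|.
  by rewrite ler_pM ?mulr_ge0 ?powR_ge0 ?subr_ge0 ?ler_pM2l// ltW.
by nra.
Qed.

(** What the induction in Burkholder's inequality gains when the variance grows
    from s to s + u: both remainder terms of the Taylor bound appear on the left. *)
Lemma powR_add_ge s u r : 1 <= r -> 0 <= s -> 0 <= u ->
  s `^ r + 2^-1 * (s `^ (r - 1) * u + u `^ r) <= (s + u) `^ r.
Proof.
move=> r1 s0 u0; have r0 : 0 < r by lra.
have su0 : 0 <= s + u by rewrite addr_ge0.
have h1 := powR_tangent su0 s0 r1.
have e1 := mulr_powRB1 s0 r0; have e2 := mulr_powRB1 u0 r0.
have e3 := mulr_powRB1 su0 r0.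
have h2 : s `^ (r - 1) <= (s + u) `^ (r - 1).
  by rewrite ge0_ler_powR ?nnegrE ?subr_ge0// lerDl.
have h3 : u `^ (r - 1) <= (s + u) `^ (r - 1).
  by rewrite ge0_ler_powR ?nnegrE ?subr_ge0// lerDr.
have h4 : 0 <= s `^ (r - 1) * u by rewrite mulr_ge0 ?powR_ge0.
have h5 : s `^ r + u `^ r <= (s + u) `^ r by nra.
have h6 : s `^ r + s `^ (r - 1) * u <= (s + u) `^ r by nra.
by lra.
Qed.

(** The square of this constant exceeds 2 * taylor_cst p, which absorbs the Taylor
    remainder at each step of the induction, and it is at least 1. *)
Definition burkholder_cst p := Num.sqrt (2 * taylor_cst p + 1).

Lemma taylor_cst_ge0 p : 2 <= p -> 0 <= taylor_cst p.
Proof. by move=> p2; rewrite /taylor_cst !mulr_ge0 ?powR_ge0//; lra. Qed.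

Lemma burkholder_cst_ge0 p : 0 <= burkholder_cst p. Proof. exact: sqrtr_ge0. Qed.

(** The bound on the p-th power after a step, for s the sum of squares so far and
    u the square of the norm of the new term. *)
Lemma burkholder_cst_step p s u : 2 <= p -> 0 <= s -> 0 <= u ->
  (burkholder_cst p * Num.sqrt s) `^ p +
    taylor_cst p * ((burkholder_cst p * Num.sqrt s) `^ (p - 2) * u + Num.sqrt u `^ p) <=
  (burkholder_cst p * Num.sqrt (s + u)) `^ p.
Proof.
move=> p2 s0 u0.
have C0 := taylor_cst_ge0 p2; set C := taylor_cst p in C0 *.
have k1 : 1 <= 2 * C + 1 by lra.
have C20 : 0 <= 2 * C by lra.
have k0 : 0 <= 2 * C + 1 by lra.
have P (a q : R) : 0 <= a -> Num.sqrt a `^ q = a `^ (2^-1 * q).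
  by move=> a0; rewrite -powR12_sqrt// -powRrM.
rewrite /burkholder_cst -/C -!sqrtrM// !P ?mulr_ge0 ?addr_ge0//.
set r := 2^-1 * p.
have -> : 2^-1 * (p - 2) = r - 1 by rewrite /r; field.
have r1 : 1 <= r by rewrite /r; lra.
set k := 2 * C + 1 in k0 k1 *.
rewrite !powRM ?addr_ge0//.
have h := powR_add_ge r1 s0 u0.
have kr0 := powR_ge0 k r.
have k2 := powR_ge0 k (r - 1).
have e : k * k `^ (r - 1) = k `^ r by apply: mulr_powRB1 => //; lra.
have k3 : 1 <= k `^ r.
  have : 1 `^ r <= k `^ r by rewrite ge0_ler_powR ?nnegrE//; lra.
  by rewrite powR1.
have k4 : 2 * C * k `^ (r - 1) <= k `^ r by rewrite -e /k; nra.
have k5 : 2 * C <= k `^ r.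
  have : k <= k `^ r by rewrite le1r_powR.
  by rewrite /k; lra.
have x0 : 0 <= s `^ (r - 1) * u by rewrite mulr_ge0 ?powR_ge0.
have y0 := powR_ge0 u r.
have -> : k `^ (r - 1) * s `^ (r - 1) * u = k `^ (r - 1) * (s `^ (r - 1) * u).
  by rewrite mulrA.
move: (ler_wpM2l kr0 h); rewrite !mulrDr.
by clear h e; nra.
Qed.

End scalar_constants.

(** * p-norm bounds under a probability measure *)

Section probability_bounds.
Context d (T : measurableType d) (R : realType) (P : probability T R).
Implicit Types (p q r K L : R) (f g : T -> R).

Lemma bnd_integrable_pow p f K : bnd P p f K ->
  P.-integrable [set: T] (fun x => (`|f x| `^ p)%:E).
Proof.
move=> [mf K0 h]; apply/integrableP; split.
  by apply/measurable_EFinP; exact: measurable_normpow.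
under eq_integral do rewrite gee0_abs ?lee_fin ?powR_ge0//.
by rewrite (le_lt_trans h)// ltry.
Qed.

Lemma integrable_le_real f g : measurable_fun [set: T] f ->
  (forall x, `|f x| <= g x) -> P.-integrable [set: T] (EFin \o g) ->
  P.-integrable [set: T] (EFin \o f).
Proof.
move=> mf fg; apply: le_integrable => //; first exact/measurable_EFinP.
by move=> x _ /=; rewrite lee_fin (le_trans (fg x))// ler_norm.
Qed.

Lemma integrable_cst_real c : P.-integrable [set: T] (fun=> c%:E).
Proof. exact: (finite_measure_integrable_cst P c measurableT). Qed.

Lemma integrableD_real f g : P.-integrable [set: T] (EFin \o f) ->
  P.-integrable [set: T] (EFin \o g) ->
  P.-integrable [set: T] (EFin \o (fun x => f x + g x)).
Proof. exact: integrableD. Qed.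

Lemma integrableB_real f g : P.-integrable [set: T] (EFin \o f) ->
  P.-integrable [set: T] (EFin \o g) ->
  P.-integrable [set: T] (EFin \o (fun x => f x - g x)).
Proof. exact: integrableB. Qed.

Lemma integrableZ_real c f : P.-integrable [set: T] (EFin \o f) ->
  P.-integrable [set: T] (EFin \o (fun x => c * f x)).
Proof. exact: integrableZl. Qed.

Lemma bnd_integrable_lepow p q f K : 0 <= q -> q <= p -> bnd P p f K ->
  P.-integrable [set: T] (fun x => (`|f x| `^ q)%:E).
Proof.
move=> q0 qp bf; have [mf _ _] := bf.
apply: (@integrable_le_real _ (fun x => 1 + `|f x| `^ p)).
- exact: measurable_normpow.
- by move=> x; rewrite ger0_norm ?powR_ge0// powR_le1D.
- apply: integrableD_real; first exact: integrable_cst_real.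
  exact: bnd_integrable_pow bf.
Qed.

Lemma bnd_integrable p f K : 1 <= p -> bnd P p f K ->
  P.-integrable [set: T] (EFin \o f).
Proof.
move=> p1 bf; have [mf _ _] := bf.
apply: (integrable_le_real mf _ (bnd_integrable_lepow ler01 p1 bf)) => x.
by rewrite powRr1.
Qed.

(** Integrate the tangent inequality at the mean.  When the right-hand side is
    infinite there is nothing to prove, otherwise g is integrable. *)
Lemma jensen_norm p g : 1 < p -> measurable_fun [set: T] g ->
  ((`|\int[P]_x g x| `^ p)%:E <= \int[P]_x (`|g x| `^ p)%:E)%E.
Proof.
move=> p1 mg; set m := (\int[P]_x g x)%R.
have [fin|] := ltP (\int[P]_x (`|g x| `^ p)%:E)%E +oo%E; last first.
  by rewrite leye_eq => /eqP ->; rewrite leey.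
have ip : P.-integrable setT (EFin \o (fun x => `|g x| `^ p)).
  apply/integrableP; split; first by apply/measurable_EFinP/measurable_normpow.
  by under eq_integral do rewrite /= ger0_norm ?powR_ge0//.
have ig : P.-integrable setT (EFin \o g).
  apply: (integrable_le_real mg _
    (integrableD_real (integrable_cst_real 1) ip)) => x.
  by have := @powR_le1D _ `|g x| 1 p (normr_ge0 _) ler01 (ltW p1); rewrite powRr1.
(* c is the slope of the tangent at the mean m. *)
pose c := p * spow (p - 1) m.
have iZ : P.-integrable setT (EFin \o (fun x => c * g x)).
  exact: integrableZ_real.
have im : P.-integrable setT (EFin \o (fun x => c * m - c * g x)).
  by apply: integrableB_real => //; exact: integrable_cst_real.
have iS : P.-integrable setT (EFin \o (fun x => `|g x| `^ p + (c * m - c * g x))).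
  exact: integrableD_real.
have h : `|m| `^ p <= \int[P]_x (`|g x| `^ p + (c * m - c * g x)).
  have -> : `|m| `^ p = \int[P]_x (`|m| `^ p).
    by rewrite Rintegral_cst//= probability_setT mulr1.
  apply: le_Rintegral => //; first exact: integrable_cst_real.
  by move=> x _; rewrite /c -mulrBr -mulrA spow_tangent.
move: h; rewrite RintegralD// RintegralB//; last exact: integrable_cst_real.
rewrite Rintegral_cst//= probability_setT mulr1 RintegralZl//.
rewrite subrr addr0 => h.
rewrite -[leRHS]fineK ?lee_fin// ge0_fin_numE//.
by apply: integral_ge0 => x _; rewrite lee_fin powR_ge0.
Qed.

Lemma bnd_mono p q f K : 0 < q -> q <= p -> bnd P p f K -> bnd P q f K.
Proof.
move=> q0 qp bf; have [mf K0 h] := bf; split=> //.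
move: qp; rewrite le_eqVlt => /predU1P[->//|qp].
have p0 : 0 < p by exact: lt_trans qp.
have ig := bnd_integrable_lepow (ltW q0) (ltW qp) bf.
have r1 : 1 < p / q by rewrite ltr_pdivlMr// mul1r.
have J := jensen_norm r1 (measurable_normpow q mf).
have : ((`|\int[P]_x (`|f x| `^ q)| `^ (p / q))%:E <= (K `^ p)%:E)%E.
  apply: (le_trans J); apply: le_trans h.
  rewrite le_eqVlt; apply/orP; left; apply/eqP; apply: eq_integral => x _.
  by rewrite (@ger0_norm _ (_ `^ _)) ?powR_ge0// -powRrM mulrC divfK ?gt_eqF.
rewrite lee_fin ger0_norm ?Rintegral_ge0//.
have I0 : 0 <= \int[P]_x (`|f x| `^ q).
  by apply: Rintegral_ge0 => x _; exact: powR_ge0.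
have qp0 : 0 <= q / p by rewrite divr_ge0// ltW.
move=> /(ge0_ler_powR qp0); rewrite !nnegrE !powR_ge0 => /(_ isT isT).
rewrite -!powRrM.
rewrite (_ : p / q * (q / p) = 1); last by field; rewrite !gt_eqF.
rewrite powRr1// (_ : p * (q / p) = q); last by field; rewrite gt_eqF.
rewrite -lee_fin; apply: le_trans.
by rewrite /Rintegral fineK//; exact: integrable_fin_num.
Qed.

Lemma Rintegral_le_bnd p f K : 1 < p -> bnd P p f K -> `|\int[P]_x f x| <= K.
Proof.
move=> p1 [mf K0 h]; have p0 : 0 < p by exact: lt_trans p1.
have := le_trans (jensen_norm p1 mf) h; rewrite lee_fin.
have pi0 : 0 <= p^-1 by rewrite invr_ge0 ltW.
move=> /(ge0_ler_powR pi0); rewrite !nnegrE !powR_ge0 => /(_ isT isT).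
by rewrite -!powRrM divff ?gt_eqF// !powRr1.
Qed.

Lemma bnd_center p f K : 1 < p -> bnd P p f K ->
  bnd P p (fun x => f x - \int[P]_y f y) (K + K).
Proof.
move=> p1 bf; apply: (bnd_sub (ltW p1) bf).
have [_ K0 _] := bf; split=> //.
rewrite (_ : (\int[P]_x _)%E = ((`|\int[P]_y f y| `^ p)%:E * P setT)%E); last first.
  exact: integral_cst.
rewrite probability_setT mule1 lee_fin ge0_ler_powR ?nnegrE//.
  by rewrite ltW// (lt_trans _ p1).
exact: Rintegral_le_bnd bf.
Qed.

(** Truncate |f| at level n: the truncated power is Lipschitz, hence is controlled
    by that of an approximation in L1; then let n tend to infinity by monotone
    convergence. *)
Lemma bnd_L1_limit p f K : 1 < p -> measurable_fun [set: T] f -> 0 <= K ->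
  (forall e : R, 0 < e -> exists2 g, bnd P p g K &
     (\int[P]_x `|f x - g x|%:E <= e%:E)%E) ->
  bnd P p f K.
Proof.
move=> p1 mf K0 app; split=> //; have p0 : 0 < p by exact: lt_trans p1.
pose F (n : nat) x := (Num.min `|f x| n%:R `^ p).
have mF n : measurable_fun setT (F n).
  apply: (@measurableT_comp _ _ _ _ _ _ (fun x => x `^ p)) => //.
  by apply: measurable_minr => //; exact: measurableT_comp.
have HF n : (\int[P]_x (F n x)%:E <= (K `^ p)%:E)%E.
  apply/lee_addgt0Pr => e e0.
  (* c is the Lipschitz constant of the power truncated at n; the approximation is
     taken within e / (c + 1) because c may vanish. *)
  pose c := p * n%:R `^ (p - 1).
  have c0 : 0 <= c by rewrite mulr_ge0 ?powR_ge0// ltW.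
  have e'0 : 0 < e / (c + 1) by rewrite divr_gt0// ltr_wpDl.
  have [g [mg _ hg] he] := app _ e'0.
  have md : measurable_fun setT (fun x => `|f x - g x|).
    by apply: measurableT_comp => //; exact: measurable_funB.
  have mc : measurable_fun setT (fun x => c * `|f x - g x|) by exact: measurable_funM.
  have mgp := measurable_normpow p mg.
  apply: (@le_trans _ _ (\int[P]_x ((`|g x| `^ p)%:E + (c * `|f x - g x|)%:E))%E).
    apply: ge0_le_integral => //.
    - by move=> x _; rewrite lee_fin powR_ge0.
    - exact/measurable_EFinP.
    - by apply: emeasurable_funD; exact/measurable_EFinP.
    - move=> x _; rewrite -EFinD lee_fin.
      have := @powR_trunc_lip _ `|f x| `|g x| n%:R p (ltW p1) (normr_ge0 _)
        (normr_ge0 _) (ler0n _ _).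
      move=> /le_trans; apply; apply: lerD.
        rewrite ge0_ler_powR ?nnegrE ?le_min ?normr_ge0 ?ler0n//; first exact: ltW.
        by rewrite ge_min lexx.
      by rewrite ler_wpM2l// ler_dist_dist.
  rewrite ge0_integralD//; last 3 first.
  - exact/measurable_EFinP.
  - by move=> x _; rewrite lee_fin mulr_ge0.
  - exact/measurable_EFinP.
  apply: leeD => //; under eq_integral do rewrite EFinM.
  rewrite ge0_integralZl_EFin//; last exact/measurable_EFinP.
  apply: (@le_trans _ _ (c%:E * (e / (c + 1))%:E)%E).
    by rewrite lee_wpmul2l// lee_fin.
  rewrite -EFinM lee_fin mulrCA ler_piMr ?(ltW e0)//.
  by rewrite ler_pdivrMr ?ltr_wpDl// mul1r lerDl.
have Fnn n x : (0 <= (F n x)%:E)%E by rewrite lee_fin powR_ge0.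
have Fnd x : nondecreasing_seq (fun n => (F n x)%:E).
  move=> m n mn; rewrite lee_fin ge0_ler_powR ?nnegrE ?le_min ?normr_ge0 ?ler0n//.
    exact: ltW.
  by rewrite !ge_min lexx/= ler_nat mn orbT.
have limF x : limn (fun n => (F n x)%:E) = (`|f x| `^ p)%:E.
  apply: lim_near_cst => //; near=> n.
  rewrite /F (min_idPl _)//.
  near: n; exact: nbhs_infty_ger.
have cvg := @cvg_monotone_convergence _ _ _ P setT measurableT
  (fun n x => (F n x)%:E) (fun n => ltac:(exact/measurable_EFinP))
  (fun n x _ => Fnn n x) (fun x _ => Fnd x).
under eq_integral do rewrite -limF.
rewrite -(cvg_lim _ cvg)//; apply: lime_le; first by apply/cvg_ex; eexists; exact: cvg.
by apply: nearW => n; exact: HF.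
Unshelve. all: by end_near. Qed.

End probability_bounds.

(** * Burkholder's inequality *)

Section burkholder.
Context d (T : measurableType d) (R : realType) (P : probability T R).
Implicit Types (p q r K L : R) (f g : T -> R).

Lemma measurable_spow q : measurable_fun [set: R] (spow q).
Proof.
apply: measurable_funM; last first.
  by apply: (@measurableT_comp _ _ _ _ _ _ (fun x => x `^ q)).
rewrite (_ : Num.sg = fun x : R => if x == 0 then 0 else if x < 0 then -1 else 1).
  apply: measurable_fun_ifT => //; first exact: measurable_fun_eqr.
  by apply: measurable_fun_ifT => //; exact: measurable_fun_ltr.
by apply/funext => x; case: sgrP.
Qed.

Lemma bnd_spow_mul_integrable p f g K L : 1 < p -> bnd P p f K -> bnd P p g L ->
  P.-integrable [set: T] (EFin \o (fun x => spow (p - 1) (f x) * g x)).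
Proof.
move=> p1 bf bg; have [mf _ _] := bf; have [mg _ _] := bg.
have p10 : 0 < p - 1 by rewrite subr_gt0.
apply: (@integrable_le_real _ _ _ _ _ (fun x => `|f x| `^ p + `|g x| `^ p)).
- apply: measurable_funM => //; apply: measurableT_comp mf; exact: measurable_spow.
- move=> x; rewrite normrM norm_spow//.
  have := @powR_mix_le _ `|f x| `|g x| (p - 1) 1 (normr_ge0 _) (normr_ge0 _) p10 ltr01.
  by rewrite powRr1// subrK.
- by apply: integrableD_real; [exact: bnd_integrable_pow bf|exact: bnd_integrable_pow bg].
Qed.

(** Hoelder's inequality with the exponents p / (p - 2) and p / 2. *)
Lemma hoelder_pow p f g K L : 2 < p -> bnd P p f K -> bnd P p g L ->
  \int[P]_x (`|f x| `^ (p - 2) * g x ^+ 2) <= K `^ (p - 2) * L ^+ 2.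
Proof.
move=> p2 bf bg; have [mf K0 hf] := bf; have [mg L0 hg] := bg.
have p0 : 0 < p by lra.
have p20 : 0 < p - 2 by lra.
have prod_ge0 x : 0 <= `|f x| `^ (p - 2) * g x ^+ 2.
  by apply: mulr_ge0; [exact: powR_ge0|exact: sqr_ge0].
have pw (u : T -> R) (H r : R) : bnd P p u H -> 0 < r ->
    ('N[P]_((p / r)%:E)[EFin \o (fun x => `|u x| `^ r)%R] <= (H `^ r)%:E)%E.
  move=> [mu H0 hu] r0.
  apply/bnd_Lnorm; rewrite ?powR_ge0 ?divr_gt0//; first exact: measurable_normpow.
  split; [exact: measurable_normpow|exact: powR_ge0|].
  have e : r * (p / r) = p by rewrite mulrC divfK ?gt_eqF.
  rewrite -powRrM e; apply: le_trans hu.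
  rewrite le_eqVlt; apply/orP; left; apply/eqP; apply: eq_integral => x _.
  by rewrite (@ger0_norm _ (_ `^ _)) ?powR_ge0// -powRrM e.
have Ef : EFin \o (fun x => `|f x| `^ (p - 2) * g x ^+ 2) =
   EFin \o ((fun x => `|f x| `^ (p - 2)) \* (fun x => `|g x| `^ 2)).
  by apply/funext => x /=; rewrite powR_mulrn// real_normK// num_real.
have := @hoelder _ _ _ P (fun x => `|f x| `^ (p - 2)) (fun x => `|g x| `^ 2)
  (p / (p - 2)) (p / 2) (measurable_normpow _ mf) (measurable_normpow _ mg)
  ltac:(by rewrite divr_gt0) ltac:(by rewrite divr_gt0)
  ltac:(by field; rewrite !gt_eqF).
rewrite Lnorm1 -Ef.
have two0 : 0 < 2 :> R by [].
move=> /le_trans /(_ (lee_pmul (Lnorm_ge0 _ _ _) (Lnorm_ge0 _ _ _)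
   (pw f K _ bf p20) (pw g L _ bg two0))).
rewrite -EFinM powR_mulrn// => h.
rewrite -lee_fin; apply: le_trans h.
have -> : (\int[P]_x `|(EFin \o (fun x => `|f x| `^ (p - 2) * g x ^+ 2)%R) x| =
    \int[P]_x ((`|f x| `^ (p - 2) * g x ^+ 2)%R)%:E)%E.
  by apply: eq_integral => x _ /=; rewrite (ger0_norm (prod_ge0 _)).
rewrite /Rintegral fineK//.
apply: integrable_fin_num => //.
apply: (@integrable_le_real _ _ _ _ _ (fun x => `|f x| `^ p + `|g x| `^ p)).
- apply: measurable_funM; [exact: measurable_normpow|exact: measurable_funX].
- move=> x; rewrite (ger0_norm (prod_ge0 _)).
  have := @powR_mix_le _ `|f x| `|g x| (p - 2) 2 (normr_ge0 _) (normr_ge0 _) p20 two0.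
  by rewrite powR_mulrn// real_normK ?num_real// subrK.
- by apply: integrableD_real; [exact: bnd_integrable_pow bf|exact: bnd_integrable_pow bg].
Qed.

Lemma Rint_bnd p f K : bnd P p f K -> \int[P]_x (`|f x| `^ p) <= K `^ p.
Proof.
move=> bf; have [_ _ h] := bf; rewrite -lee_fin /Rintegral fineK//.
by apply: integrable_fin_num => //; exact: bnd_integrable_pow bf.
Qed.

Lemma bnd_Rint p f K : measurable_fun [set: T] f -> 0 <= K ->
  P.-integrable [set: T] (fun x => (`|f x| `^ p)%:E) ->
  \int[P]_x (`|f x| `^ p) <= K `^ p -> bnd P p f K.
Proof.
move=> mf K0 ig h; split=> //; rewrite -[leLHS]fineK ?lee_fin//.
exact: integrable_fin_num.
Qed.

(** Integrate the Taylor bound: the linear term vanishes by orthogonality and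
    Hoelder's inequality bounds the mixed remainder. *)
Lemma bnd_martingale_step p f g (s u : R) : 2 < p -> 0 <= s -> 0 <= u ->
  bnd P p f (burkholder_cst p * Num.sqrt s) -> bnd P p g (Num.sqrt u) ->
  \int[P]_x (spow (p - 1) (f x) * g x) = 0 ->
  bnd P p (fun x => f x + g x) (burkholder_cst p * Num.sqrt (s + u)).
Proof.
move=> p2 s0 u0 bf bg orth; have [mf _ _] := bf; have [mg _ _] := bg.
have p1 : 1 < p by lra.
have bfg := bnd_add (ltW p1) bf bg; have [mfg _ _] := bfg.
have ifg := bnd_integrable_pow bfg.
have iff := bnd_integrable_pow bf; have igg := bnd_integrable_pow bg.
have isp := bnd_spow_mul_integrable p1 bf bg.
have p20 : 0 < p - 2 by lra.
have prod_ge0 x : 0 <= `|f x| `^ (p - 2) * g x ^+ 2.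
  by apply: mulr_ge0; [exact: powR_ge0|exact: sqr_ge0].
have ifg2 : P.-integrable setT (EFin \o (fun x => `|f x| `^ (p - 2) * g x ^+ 2)).
  apply: (@integrable_le_real _ _ _ _ _ (fun x => `|f x| `^ p + `|g x| `^ p)).
  - apply: measurable_funM; [exact: measurable_normpow|exact: measurable_funX].
  - move=> x; rewrite (ger0_norm (prod_ge0 _)).
    have := @powR_mix_le _ `|f x| `|g x| (p - 2) 2 (normr_ge0 _) (normr_ge0 _) p20
      ltac:(by []).
    by rewrite powR_mulrn// real_normK ?num_real// subrK.
  - by apply: integrableD_real.
apply: bnd_Rint => //; first by rewrite mulr_ge0 ?burkholder_cst_ge0 ?sqrtr_ge0.
apply: le_trans (burkholder_cst_step (ltW p2) s0 u0).
have i1 := integrableZ_real p isp.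
have i2 := integrableD_real iff i1.
have i3 := integrableD_real ifg2 igg.
have i4 := integrableZ_real (taylor_cst p) i3.
have := @le_Rintegral _ _ _ P setT _ _ measurableT ifg (integrableD_real i2 i4)
  (fun x _ => powR_taylor (f x) (g x) (ltW p2)).
move=> /le_trans; apply.
rewrite RintegralD// RintegralD// RintegralZl// RintegralZl// RintegralD//.
rewrite orth mulr0 addr0; apply: lerD; first exact: Rint_bnd.
apply: ler_wpM2l; first by rewrite taylor_cst_ge0 ?ltW.
apply: lerD; last exact: Rint_bnd.
by have := hoelder_pow p2 bf bg; rewrite sqr_sqrtr.
Qed.

(** Terms enter from the right end of the list, so the hypothesis is the
    martingale difference property of the reversed list, reduced to the single
    relation that the Taylor bound needs: each term is orthogonal to the signed
    power of the sum of those that follow it. *)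
Lemma burkholder (I : eqType) (s : seq I) p (D : I -> T -> R) (c : I -> R) :
  2 < p -> (forall i, i \in s -> bnd P p (D i) (c i)) ->
  (forall s1 i s2, s = s1 ++ i :: s2 ->
    \int[P]_x (spow (p - 1) (\sum_(j <- s2) D j x) * D i x) = 0) ->
  bnd P p (fun x => \sum_(i <- s) D i x)
    (burkholder_cst p * Num.sqrt (\sum_(i <- s) c i ^+ 2)).
Proof.
move=> p2; elim: s => [_ _|i s IH h orth].
  under eq_fun do rewrite big_nil.
  by rewrite big_nil sqrtr0 mulr0; apply: bnd_cst0; lra.
under eq_fun do rewrite big_cons addrC.
rewrite big_cons addrC.
apply: bnd_martingale_step => //.
- by apply: sumr_ge0 => j _; exact: sqr_ge0.
- exact: sqr_ge0.
- apply: IH => [j js|s1 j s2 ss]; first by apply: h; rewrite inE js orbT.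
  by apply: (orth (i :: s1)); rewrite ss.
- have bi := h _ (mem_head i s); have [_ ci _] := bi.
  by rewrite sqrtr_sqr ger0_norm.
- by apply: (orth [::]).
Qed.

End burkholder.

(** * Trajectories and product integrals *)

Definition coord_system (dH : measure_display) (H : measurableType dH)
    : set (set (int -> H)) :=
  \bigcup_(k in [set: int])
    preimage_set_system [set: int -> H] (fun h => h k) measurable.

Arguments coord_system {dH} H.

(** Paths indexed by Z, with the sigma-algebra generated by the coordinates. *)
Definition traj (dH : measure_display) (H : measurableType dH)
    : measurableType (coord_system H).-sigma :=
  g_sigma_algebraType (coord_system H).

Lemma integral_cst_prob d (T : measurableType d) (R : realType)
  (P : probability T R) (c : \bar R) : (\int[P]_x c = c)%E.
Proof.
transitivity (c * P setT)%E; first exact: integral_cst.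
by rewrite probability_setT mule1.
Qed.

Lemma Rintegral_cst_prob d (T : measurableType d) (R : realType)
  (P : probability T R) (c : R) : \int[P]_x c = c.
Proof. by rewrite /Rintegral integral_cst_prob. Qed.

Lemma ae_imply d (T : measurableType d) (R : realType) (P : probability T R)
  (A B : T -> Prop) : (\forall x \ae P, A x) -> (forall x, A x -> B x) ->
  \forall x \ae P, B x.
Proof. by move=> a ab; apply: filterS a. Qed.

Lemma ae_imply2 d (T : measurableType d) (R : realType) (P : probability T R)
  (A B C : T -> Prop) : (\forall x \ae P, A x) -> (\forall x \ae P, B x) ->
  (forall x, A x -> B x -> C x) -> \forall x \ae P, C x.
Proof. by move=> a b abc; apply: (filterS2 _ _ a b). Qed.

Lemma ae_all_seq d (T : measurableType d) (R : realType) (P : probability T R)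
  (I : eqType) (s : seq I) (A : I -> T -> Prop) :
  (forall i, i \in s -> \forall x \ae P, A i x) ->
  \forall x \ae P, forall i, i \in s -> A i x.
Proof.
elim: s => [_|i s IH h]; first exact: aeW.
apply: (ae_imply2 (h i (mem_head _ _)) (IH _)) => [j js|x ix sx j].
  by apply: h; rewrite inE js orbT.
by rewrite inE => /predU1P[->//|/sx].
Qed.

Lemma measurable_sum_in d (T : measurableType d) (R : realType) (I : eqType)
  (s : seq I) (f : I -> T -> R) :
  (forall i, i \in s -> measurable_fun setT (f i)) ->
  measurable_fun setT (fun x => \sum_(i <- s) f i x).
Proof.
elim: s => [_|i s IH mf].
  by under eq_fun do rewrite big_nil; exact: measurable_cst.
under eq_fun do rewrite big_cons.
apply: measurable_funD; first by apply: mf; rewrite mem_head.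
by apply: IH => j js; apply: mf; rewrite inE js orbT.
Qed.

Section partial_integral.
Context d1 d2 (T1 : measurableType d1) (T2 : measurableType d2) (R : realType).
Context (P1 : probability T1 R) (P2 : probability T2 R).
Let P12 : probability _ R := (P1 \x P2)%E.

(** Jensen's inequality in the second variable: integrating out a variable does
    not increase the p-norm. *)
Lemma bnd_partial_Rintegral p (G : T1 * T2 -> R) K : 1 < p -> bnd P12 p G K ->
  bnd P1 p (fun x => \int[P2]_y G (x, y)) K.
Proof.
move=> p1 bG; have [mG K0 hG] := bG.
have iG : P12.-integrable setT (EFin \o G) := bnd_integrable (ltW p1) bG.
split=> //.
  apply: (@measurableT_comp _ _ _ _ _ _ fine); first exact: fine_measurable.
  exact: (measurable_fubini_F iG).
have mGp := measurable_normpow p mG.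
apply: le_trans hG.
rewrite (fubini_tonelli1 (fun z => (`|G z| `^ p)%:E))//; last exact/measurable_EFinP.
apply: ge0_le_integral => //.
- apply/measurable_EFinP; apply: measurable_normpow.
  apply: (@measurableT_comp _ _ _ _ _ _ fine); first exact: fine_measurable.
  exact: (measurable_fubini_F iG).
- apply: measurable_fun_fubini_tonelli_F => //; exact/measurable_EFinP.
- move=> x _; apply: (jensen_norm P2 p1).
  by apply: measurableT_comp => //; exact: measurable_pair1.
Qed.

Lemma ae_integrable_section (G : T1 * T2 -> R) :
  P12.-integrable setT (EFin \o G) ->
  \forall x \ae P1, P2.-integrable setT (EFin \o (fun y => G (x, y))).
Proof. exact: ae_integrable1. Qed.

Lemma Rintegral_prod (G : T1 * T2 -> R) : P12.-integrable setT (EFin \o G) ->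
  \int[P12]_z G z = \int[P1]_x \int[P2]_y G (x, y).
Proof.
move=> iG; rewrite /Rintegral; congr fine.
rewrite -(integral12_prod_meas1 iG).
have iF := integrable_fubini_F iG.
apply: ae_eq_integral => //; [exact: measurable_int iF| |].
  apply/measurable_EFinP; apply: (@measurableT_comp _ _ _ _ _ _ fine) => //.
  exact: measurable_int iF.
apply: filterS (ae_integrable1 iG) => x ix _ /=.
by rewrite fineK//; exact: integrable_fin_num.
Qed.

Lemma integrable_prod_fst (f : T1 -> R) : P1.-integrable setT (EFin \o f) ->
  P12.-integrable setT (EFin \o (fun z => f z.1)).
Proof.
move=> jf; have mf : measurable_fun setT f.
  by apply/measurable_EFinP; exact: measurable_int jf.
apply/integrable12ltyP.
  by apply/measurable_EFinP; apply: measurableT_comp.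
have -> : (\int[P1]_x \int[P2]_y `|(EFin \o (fun z => f z.1)) (x, y)| =
    \int[P1]_x `|(EFin \o f) x|)%E.
  apply: eq_integral => x _ /=.
  exact: integral_cst_prob.
by move/integrableP : jf => [].
Qed.

Lemma integral_prod_fst (f : T1 -> \bar R) : measurable_fun setT f ->
  (forall x, 0 <= f x)%E -> (\int[P12]_z f z.1 = \int[P1]_x f x)%E.
Proof.
move=> mf f0; rewrite (fubini_tonelli1 (fun z => f z.1))//; last first.
  exact: measurableT_comp.
apply: eq_integral => x _.
exact: (integral_cst_prob P2 (f x)).
Qed.

Lemma Rintegral_prod_fst (f : T1 -> R) : P1.-integrable setT (EFin \o f) ->
  \int[P12]_z f z.1 = \int[P1]_x f x.
Proof.
move=> jf; rewrite Rintegral_prod ?integrable_prod_fst//.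
by apply: eq_Rintegral => x _; exact: (Rintegral_cst_prob P2 (f x)).
Qed.

Lemma bnd_prod_fst p (f : T1 -> R) K : bnd P1 p f K ->
  bnd P12 p (fun z => f z.1) K.
Proof.
move=> [mf K0 h]; split => //; first exact: measurableT_comp.
rewrite (integral_prod_fst (f := fun x => (`|f x| `^ p)%:E))//.
by apply/measurable_EFinP; exact: measurable_normpow.
Qed.

Lemma bnd_of_prod_fst p (f : T1 -> R) K : measurable_fun setT f ->
  bnd P12 p (fun z => f z.1) K -> bnd P1 p f K.
Proof.
move=> mf [_ K0]; rewrite (integral_prod_fst (f := fun x => (`|f x| `^ p)%:E))//.
by apply/measurable_EFinP; exact: measurable_normpow.
Qed.

End partial_integral.

(** * Resampling coordinates and conditional expectation *)

Section trajectories.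
Context (dH : measure_display) (H : measurableType dH).
Implicit Types (J : set int) (h : int -> H).

Lemma measurable_coord k : measurable_fun [set: traj H] (fun h : traj H => h k).
Proof.
move=> _ A mA; apply: sub_sigma_algebra; exists k => //.
by exists A.
Qed.

Lemma measurable_traj d (T : measurableType d) (F : T -> traj H) :
  (forall k, measurable_fun setT (fun x => F x k)) -> measurable_fun setT F.
Proof.
move=> mF; apply: (@measurability _ _ T (traj H) setT F (coord_system H)) => //.
move=> _ [_ [k _ [B mB <-]] <-]; rewrite setTI.
by have := mF k measurableT B mB; rewrite !setTI.
Qed.

(** The path h with its coordinates outside J replaced by those of h'. *)
Definition merge J (h h' : int -> H) : int -> H :=
  fun j => if `[< J j >] then h j else h' j.

Definition swap J (z : traj H * traj H) : traj H * traj H :=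
  (merge J z.1 z.2, merge J z.2 z.1).

(** A function of the coordinates in J; with values in Prop, an event. *)
Definition depends_on (U : Type) J (f : (int -> H) -> U) :=
  forall h h', (forall j, J j -> h j = h' j) -> f h = f h'.

Lemma measurable_merge J :
  measurable_fun [set: traj H * traj H] (fun z => merge J z.1 z.2 : traj H).
Proof.
apply: measurable_traj => k; rewrite /merge; case: asboolP => _.
  by apply: (measurableT_comp (measurable_coord k)); exact: measurable_fst.
by apply: (measurableT_comp (measurable_coord k)); exact: measurable_snd.
Qed.

Lemma measurable_swap J : measurable_fun [set: traj H * traj H] (swap J).
Proof.
apply: measurable_fun_pair; first exact: measurable_merge.
apply: measurable_traj => k; rewrite /merge; case: asboolP => _.
  by apply: (measurableT_comp (measurable_coord k)); exact: measurable_snd.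
by apply: (measurableT_comp (measurable_coord k)); exact: measurable_fst.
Qed.

Lemma merge_swap J J' z :
  merge J (swap J' z).1 (swap J' z).2 =
  merge [set j | J j <-> J' j] z.1 z.2.
Proof.
apply/funext => j; rewrite /swap /merge /=.
case: (asboolP (J j)) => a; case: (asboolP (J' j)) => b;
  by case: asboolP => //= ab; exfalso; tauto.
Qed.

Lemma depends_on_merge U J (f : (int -> H) -> U) h h' :
  depends_on J f -> f (merge J h h') = f h.
Proof. by move=> Jf; apply: Jf => j Jj; rewrite /merge asboolT. Qed.

End trajectories.

Section conditional_expectation.
Context (dH : measure_display) (H : measurableType dH) (R : realType).
Variable mu : probability (traj H) R.
Let mu2 : probability (traj H * traj H)%type R := (mu \x mu)%E.
(* Invariance under exchange is how the independence of the coordinates enters. *)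
Hypothesis swap_mu : forall J (A : set (traj H * traj H)), measurable A ->
  mu2 (swap J @^-1` A) = mu2 A.
Implicit Types (J : set int) (f g u : traj H -> R) (p K : R).

Lemma integral_swap J (F : traj H * traj H -> \bar R) :
  measurable_fun setT F -> (forall z, 0 <= F z)%E ->
  (\int[mu2]_z F (swap J z) = \int[mu2]_z F z)%E.
Proof.
move=> mF F0.
have := @ge0_integral_pushforward _ _ _ _ R (swap J) (measurable_swap J) mu2 setT F
  measurableT mF (fun z _ => F0 z).
rewrite preimage_setT /= => <-.
apply: eq_measure_integral => [|? A mA _]; [exact: measurable_swap|exact: swap_mu].
Qed.

Lemma integrable_swap J (F : traj H * traj H -> R) :
  mu2.-integrable setT (EFin \o F) ->
  mu2.-integrable setT (EFin \o (fun z => F (swap J z))).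
Proof.
move=> /integrableP[mF iF]; apply/integrableP; split.
  exact: (measurableT_comp mF (measurable_swap J)).
rewrite (integral_swap J (F := fun z => `|(F z)%:E|%E))//.
exact: measurableT_comp.
Qed.

Lemma Rintegral_swap J (F : traj H * traj H -> R) :
  mu2.-integrable setT (EFin \o F) ->
  \int[mu2]_z F (swap J z) = \int[mu2]_z F z.
Proof.
move=> iF; rewrite /Rintegral; congr fine.
have mF := measurable_int _ iF.
have := @integral_pushforward _ _ _ _ R (swap J) (measurable_swap J) mu2 setT
  (EFin \o F) mF.
rewrite preimage_setT => <-; [|exact: (integrable_swap J iF)|exact: measurableT].
apply: eq_measure_integral => [|? A mA _]; [exact: measurable_swap|exact: swap_mu].
Qed.

Lemma bnd_swap J p (F : traj H * traj H -> R) K : bnd mu2 p F K ->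
  bnd mu2 p (fun z => F (swap J z)) K.
Proof.
move=> [mF K0 h]; split; [exact: measurableT_comp (measurable_swap J)|exact: K0|].
rewrite (integral_swap J (F := fun z => (`|F z| `^ p)%:E))//.
by apply/measurable_EFinP; exact: measurable_normpow.
Qed.

Lemma bnd_merge J p f K : bnd mu p f K ->
  bnd mu2 p (fun z => f (merge J z.1 z.2)) K.
Proof. by move=> /(bnd_prod_fst mu)/(bnd_swap J). Qed.

Lemma integrable_merge J f : mu.-integrable setT (EFin \o f) ->
  mu2.-integrable setT (EFin \o (fun z => f (merge J z.1 z.2))).
Proof. by move=> /(integrable_prod_fst mu)/(integrable_swap J). Qed.

Lemma ae_integrable_merge J f : mu.-integrable setT (EFin \o f) ->
  \forall h \ae mu, mu.-integrable setT (EFin \o (fun h' => f (merge J h h'))).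
Proof. by move=> /(integrable_merge J)/ae_integrable_section. Qed.

(** The conditional expectation given the coordinates in J.  It is defined
    pointwise, so that its dependence on J alone holds everywhere, not only almost
    surely. *)
Definition condE J f : traj H -> R := fun h => \int[mu]_h' f (merge J h h').

Lemma condE_depends J f : depends_on J (condE J f).
Proof.
move=> h h' hh; congr Rintegral; apply/funext => k; congr f.
by apply/funext => j; rewrite /merge; case: asboolP => // /hh.
Qed.

Lemma eq_condE J J' f h :
  (forall h h', f (merge J h h') = f (merge J' h h')) -> condE J f h = condE J' f h.
Proof. by move=> JJ; congr Rintegral; apply/funext => k. Qed.

Lemma condE_set0 f h : condE set0 f h = \int[mu]_h f h.
Proof.
congr Rintegral; apply/funext => k; congr f.
by apply/funext => j; rewrite /merge asboolF.
Qed.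

Lemma measurable_condE J f : mu.-integrable setT (EFin \o f) ->
  measurable_fun setT (condE J f).
Proof.
move=> /(integrable_merge J) jf.
apply: (@measurableT_comp _ _ _ _ _ _ fine); first exact: fine_measurable.
exact: (measurable_fubini_F jf).
Qed.

(** The loss of information when k is removed from the conditioning set J. *)
Definition projD J k f : traj H -> R :=
  fun h => condE J f h - condE (J `\ k) f h.

Lemma projD_depends J k f : depends_on J (projD J k f).
Proof.
move=> h h' hh; rewrite /projD (@condE_depends _ _ h h')// (@condE_depends _ _ h h')//.
by move=> j [/hh].
Qed.

(** Both conditional expectations are integrals over the same h', so their
    difference integrates f (merge J h h') - f (merge (J minus k) h h').  After
    exchanging the coordinates outside J between h and h' this is f h minus f h
    with coordinate k resampled, and integrating out h' is a contraction. *)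
Lemma bnd_projD J k p f K L : 1 < p -> J k -> bnd mu p f L ->
  bnd mu2 p (fun z => f z.1 - f (merge [set~ k] z.1 z.2)) K ->
  bnd mu p (projD J k f) K.
Proof.
move=> p1 Jk bf bd.
have jf := bnd_integrable (ltW p1) bf.
have := bnd_partial_Rintegral p1 (bnd_swap J bd); apply: bnd_ae.
  by apply: measurable_funB; exact: measurable_condE.
apply: (ae_imply2 (ae_integrable_merge J jf)
  (ae_integrable_merge (J `\ k) jf)) => h i1 i2.
rewrite /projD /condE -RintegralB//; apply: eq_Rintegral => h' _ /=.
congr (_ - f _).
rewrite (merge_swap _ _ (h, h')); congr merge => /=; apply/seteqP; split=> j /=.
  by move=> jJ; split; [apply/jJ|] => jk; subst; tauto.
by tauto.
Qed.

(** Linearity may fail where some f i is not integrable over the resampled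
    coordinates, a null set by Fubini's theorem. *)
Lemma condE_linear (I : eqType) (s : seq I) J (c : I -> R) (f : I -> traj H -> R) :
  (forall i, i \in s -> mu.-integrable setT (EFin \o f i)) ->
  \forall h \ae mu,
    condE J (fun h => \sum_(i <- s) c i * f i h) h =
    \sum_(i <- s) c i * condE J (f i) h.
Proof.
move=> jf.
suff : \forall h \ae mu,
    mu.-integrable setT (EFin \o (fun h' => \sum_(i <- s) c i * f i (merge J h h'))) /\
    condE J (fun h => \sum_(i <- s) c i * f i h) h =
    \sum_(i <- s) c i * condE J (f i) h.
  by move=> /ae_imply; apply=> h [].
elim: s jf => [_|i s IH jf].
  apply: aeW => h; rewrite big_nil; split.
    rewrite [X in _.-integrable _ X](_ : _ = fun=> 0%:E).
      exact: integrable_cst_real.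
    by apply/funext => k /=; rewrite big_nil.
  by rewrite /condE; under eq_Rintegral do rewrite big_nil; rewrite Rintegral_cst_prob.
apply: (ae_imply2 (ae_integrable_merge J (jf i (mem_head _ _)))
  (IH (fun j js => jf j ltac:(by rewrite inE js orbT)))) => h ji [js e].
have jci := integrableZ_real (c i) ji.
split.
  under eq_fun do rewrite big_cons.
  exact: integrableD_real.
rewrite big_cons -e /condE; under eq_Rintegral do rewrite big_cons.
by rewrite RintegralD// RintegralZl.
Qed.

(** Fubini's theorem.  The integrability of the product is assumed on the product
    space, where it can be checked by Hoelder's inequality. *)
Lemma Rintegral_mul_condE J f u : mu.-integrable setT (EFin \o f) ->
  measurable_fun setT u ->
  mu2.-integrable setT (EFin \o (fun z => u z.1 * f (merge J z.1 z.2))) ->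
  \int[mu]_h (u h * condE J f h) =
  \int[mu2]_z (u z.1 * f (merge J z.1 z.2)) /\
  mu.-integrable setT (EFin \o (fun h => u h * condE J f h)).
Proof.
move=> jf mu_ ji; rewrite Rintegral_prod// /Rintegral.
have mP : measurable_fun setT (fun h => u h * condE J f h).
  by apply: measurable_funM => //; exact: measurable_condE.
have iF := integrable_fubini_F ji.
have ae_eq_uE : \forall h \ae mu, (u h * condE J f h)%:E =
    fubini_F mu (EFin \o (fun z => u z.1 * f (merge J z.1 z.2))) h.
  apply: (ae_imply2 (ae_integrable_section ji) (ae_integrable_merge J jf))
    => h i1 i2.
  rewrite -RintegralZl// /Rintegral fineK//.
  exact: integrable_fin_num.
have mF := measurable_int _ iF.
split.
  congr fine; apply: ae_eq_integral => //; first exact/measurable_EFinP.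
    by apply/measurable_EFinP; apply: (@measurableT_comp _ _ _ _ _ _ fine).
  apply: (ae_imply ae_eq_uE) => h e _; move: (e); rewrite /fubini_F => <-.
  by rewrite /= e /fubini_F.
apply/integrableP; split; first exact/measurable_EFinP.
case/integrableP : iF => _; congr (_ < _)%E; apply: ae_eq_integral => //.
- exact: measurableT_comp.
- by apply: measurableT_comp => //; exact/measurable_EFinP.
- by apply: (ae_imply ae_eq_uE) => h e _ /=; rewrite -e.
Qed.

(** Exchanging coordinate k between the two paths leaves u unchanged and turns
    f (merge J h h') into f (merge (J minus k) h h'). *)
Lemma Rintegral_mul_projD J k f u : J k -> mu.-integrable setT (EFin \o f) ->
  measurable_fun setT u -> depends_on [set~ k] u ->
  mu2.-integrable setT (EFin \o (fun z => u z.1 * f (merge J z.1 z.2))) ->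
  \int[mu]_h (u h * projD J k f h) = 0 /\
  mu.-integrable setT (EFin \o (fun h => u h * projD J k f h)).
Proof.
move=> Jk jf mu_ uk ji.
(* Removing k from the kept coordinates is exchanging coordinate k. *)
have sw : (fun z : traj H * traj H => u z.1 * f (merge (J `\ k) z.1 z.2)) =
    (fun z => let z' := swap [set~ k] z in u z'.1 * f (merge J z'.1 z'.2)).
  apply/funext => z /=; rewrite merge_swap (depends_on_merge _ _ uk); congr (_ * f _).
  congr merge; apply/seteqP; split=> j /=; last first.
    by move=> jJ; split; [apply/jJ|] => jk; subst; tauto.
  by tauto.
have ji' : mu2.-integrable setT
    (EFin \o (fun z => u z.1 * f (merge (J `\ k) z.1 z.2))).
  by rewrite sw; exact: (integrable_swap _ ji).
have [e1 i1] := Rintegral_mul_condE jf mu_ ji.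
have [e2 i2] := Rintegral_mul_condE jf mu_ ji'.
have -> : (fun h => u h * projD J k f h) =
    (fun h => u h * condE J f h - u h * condE (J `\ k) f h).
  by apply/funext => h; rewrite /projD mulrBr.
split; last exact: integrableB_real.
by rewrite RintegralB// e1 e2 sw (Rintegral_swap [set~ k] ji) subrr.
Qed.

End conditional_expectation.

(** * Conditional expectations given growing sets of coordinates *)

Section L1_approximation.
Import HBSimple.
Context (dH : measure_display) (H : measurableType dH) (R : realType).
Variable mu : probability (traj H) R.
Let mu2 : probability (traj H * traj H)%type R := (mu \x mu)%E.
Hypothesis swap_mu : forall J (A : set (traj H * traj H)), measurable A ->
  mu2 (swap J @^-1` A) = mu2 A.
Variable J : nat -> set int.
Hypothesis J_mono : forall m n, (m <= n)%N -> J m `<=` J n.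
Hypothesis J_exhaust : forall k, exists n, J n k.
Implicit Types (f g : traj H -> R).

(** This dominates the L1 distance between f and [condE mu (J n) f] and, unlike
    it, involves no partial integral. *)
Definition resample_dist n f : \bar R :=
  (\int[mu2]_z `|f z.1 - f (merge (J n) z.1 z.2)|%:E)%E.

Definition resample_stable f := forall e : R, 0 < e ->
  exists N, forall n, (N <= n)%N -> (resample_dist n f <= e%:E)%E.

Lemma measurable_resample n f : measurable_fun setT f ->
  measurable_fun setT (fun z : traj H * traj H => f z.1 - f (merge (J n) z.1 z.2)).
Proof.
move=> mf; apply: measurable_funB; first exact: measurableT_comp.
by apply: (measurableT_comp mf); exact: measurable_merge.
Qed.

Lemma resample_dist_cover (n : nat) f g (G : traj H * traj H -> R) :
  measurable_fun setT f -> measurable_fun setT g ->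
  measurable_fun setT G -> (forall z, 0 <= G z) ->
  (forall z, `|f z.1 - f (merge (J n) z.1 z.2)| <=
     `|g z.1 - g (merge (J n) z.1 z.2)| + G z) ->
  (resample_dist n f <= resample_dist n g + \int[mu2]_z (G z)%:E)%E.
Proof.
move=> mf mg mG G0 h.
have mrf := measurable_resample n mf; have mrg := measurable_resample n mg.
rewrite /resample_dist -ge0_integralD//; last 3 first.
- by apply/measurable_EFinP; exact: measurableT_comp.
- by move=> z _; rewrite lee_fin.
- exact/measurable_EFinP.
apply: ge0_le_integral => //.
- by apply/measurable_EFinP; exact: measurableT_comp.
- apply: emeasurable_funD; apply/measurable_EFinP => //.
  exact: measurableT_comp.
- by move=> z _; rewrite -EFinD lee_fin.
Qed.

Lemma resample_stableD f g : measurable_fun setT f -> measurable_fun setT g ->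
  resample_stable f -> resample_stable g ->
  resample_stable (fun h => f h + g h).
Proof.
move=> mf mg sf sg e e0.
have [N1 h1] := sf _ (divr_gt0 e0 (ltr0n R 2)).
have [N2 h2] := sg _ (divr_gt0 e0 (ltr0n R 2)).
exists (maxn N1 N2) => n; rewrite geq_max => /andP[n1 n2].
have mfg : measurable_fun setT (fun h => f h + g h) by exact: measurable_funD.
apply: (le_trans (@resample_dist_cover n _ f
  (fun z => `|g z.1 - g (merge (J n) z.1 z.2)|) mfg mf _ _ _)) => //.
- by apply: measurableT_comp => //; exact: measurable_resample.
- move=> z; apply: le_trans (ler_normD _ _).
  by rewrite le_eqVlt; apply/orP; left; apply/eqP; congr `| _ |; ring.
- by rewrite [e]splitr EFinD leeD// ?h1// h2.
Qed.

Lemma resample_stableZ c f : measurable_fun setT f ->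
  resample_stable f -> resample_stable (fun h => c * f h).
Proof.
move=> mf sf e e0.
have c0 : 0 < `|c| + 1 by rewrite ltr_wpDl.
have [N h] := sf _ (divr_gt0 e0 c0).
exists N => n /h {}h.
have mrf := measurable_resample n mf.
rewrite /resample_dist; under eq_integral do rewrite -mulrBr normrM EFinM.
rewrite ge0_integralZl_EFin//; last first.
  by apply/measurable_EFinP; exact: measurableT_comp.
apply: (@le_trans _ _ (`|c|%:E * (e / (`|c| + 1))%:E)%E).
  by rewrite lee_wpmul2l.
rewrite -EFinM lee_fin mulrCA ler_piMr ?(ltW e0)//.
by rewrite ler_pdivrMr// mul1r lerDl.
Qed.

Lemma resample_stable_sum (I : Type) (s : seq I) (f : I -> traj H -> R) :
  (forall i, measurable_fun setT (f i)) -> (forall i, resample_stable (f i)) ->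
  resample_stable (fun h => \sum_(i <- s) f i h).
Proof.
move=> mf sf; elim: s => [|i s IH].
  move=> e e0; exists 0%N => n _; rewrite /resample_dist.
  under eq_integral do rewrite !big_nil subrr normr0.
  by rewrite integral0 lee_fin ltW.
under eq_fun do rewrite big_cons.
by apply: resample_stableD => //; exact: measurable_sum.
Qed.

(** Resampling preserves the law, so an L1 approximation of f by g is also one
    between their resampled copies. *)
Lemma resample_stable_closed f : measurable_fun setT f ->
  (forall e : R, 0 < e -> exists g, [/\ measurable_fun setT g, resample_stable g &
     (\int[mu]_h `|f h - g h|%:E <= e%:E)%E]) ->
  resample_stable f.
Proof.
move=> mf app e e0.
have e3 : 0 < e / 3 by rewrite divr_gt0.
have [g [mg sg fg]] := app _ e3.
have [N h] := sg _ e3.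
exists N => n /h {}h.
have md : measurable_fun setT (fun h => `|f h - g h|).
  by apply: measurableT_comp => //; exact: measurable_funB.
have md1 : measurable_fun setT (fun z : traj H * traj H => `|f z.1 - g z.1|).
  exact: (measurableT_comp md).
have md2 : measurable_fun setT (fun z : traj H * traj H =>
    `|f (merge (J n) z.1 z.2) - g (merge (J n) z.1 z.2)|).
  by apply: (measurableT_comp md); exact: measurable_merge.
apply: (le_trans (@resample_dist_cover n f g (fun z => `|f z.1 - g z.1| +
    `|f (merge (J n) z.1 z.2) - g (merge (J n) z.1 z.2)|) mf mg _ _ _)) => //.
- exact: measurable_funD.
- move=> z; rewrite addrA.
  set a := f z.1; set b := f (merge _ _ _); set a' := g z.1; set b' := g (merge _ _ _).
  have -> : a - b = (a' - b') + (a - a') - (b - b') by ring.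
  by rewrite (le_trans (ler_normB _ _))// lerD2r ler_normD.
- have i1 : (\int[mu2]_z `|f z.1 - g z.1|%:E <= (e / 3)%:E)%E.
    rewrite (@integral_prod_fst _ _ _ _ _ mu mu (fun h => `|f h - g h|%:E))//.
    exact/measurable_EFinP.
  have i2 : (\int[mu2]_z `|f (merge (J n) z.1 z.2) - g (merge (J n) z.1 z.2)|%:E
      <= (e / 3)%:E)%E.
    rewrite (integral_swap swap_mu (J n) (F := fun z => `|f z.1 - g z.1|%:E))//.
    exact/measurable_EFinP.
  under eq_integral do rewrite EFinD.
  rewrite ge0_integralD//; [|exact/measurable_EFinP|exact/measurable_EFinP].
  have -> : e = e / 3 + (e / 3 + e / 3) by field.
  by rewrite !EFinD leeD// leeD.
Qed.

(** Dynkin's theorem, from the sets that depend on the coordinates in some J n,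
    for which the distance is eventually zero. *)
Lemma resample_stable_indic (A : set (traj H)) : measurable A ->
  resample_stable (\1_A : traj H -> R).
Proof.
pose G : set (set (traj H)) :=
  [set A : set (traj H) | measurable A /\ exists n, depends_on (J n) (A : (int -> H) -> Prop)].
(* G generates: each coordinate belongs to some J n. *)
have GE : (coord_system H).-sigma.-measurable = <<s G >>.
  apply/seteqP; split; last first.
    apply: smallest_sub; first exact: sigma_algebra_measurable.
    by move=> B [].
  apply: sub_smallest2r; first exact: smallest_sigma_algebra.
  move=> _ [k _ [B mB <-]]; split.
    have := measurable_coord k measurableT mB; exact.
  have [n Jk] := J_exhaust k; exists n => h h' hh /=.
  by rewrite /= hh.
have GI : setI_closed G.
  move=> B C [mB [n Bn]] [mC [m Cm]]; split; first exact: measurableI.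
  exists (maxn n m) => h h' hh.
  rewrite /setI /= (Bn h h') ?(Cm h h')// => j jJ; apply: hh.
    by apply: J_mono jJ; exact: leq_maxr.
  by apply: J_mono jJ; exact: leq_maxl.
move=> mA.
have m1 (B : set (traj H)) : measurable B -> measurable_fun setT (\1_B : traj H -> R).
  by move=> mB; exact: measurable_indic.
apply: (@dynkin_induction _ _ G (fun B => resample_stable (\1_B : traj H -> R))) => //.
- move=> e e0; exists 0%N => n _; rewrite /resample_dist indicT.
  under eq_integral do rewrite subrr normr0.
  by rewrite integral0 lee_fin ltW.
- move=> B [mB [N BN]] e e0; exists N => n Nn; rewrite /resample_dist.
  have dB : depends_on (J n) (\1_B : traj H -> R).
    move=> h h' hh; rewrite !indicE; congr (_%:R); congr nat_of_bool.
    have eB : B h = B h' by apply: BN => j /(J_mono Nn)/hh.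
    by apply/idP/idP => /set_mem x; apply/mem_set; [rewrite -eB|rewrite eB].
  under eq_integral do rewrite (depends_on_merge _ _ dB) subrr normr0.
  by rewrite integral0 lee_fin ltW.
- move=> B mB sB e /sB[N h]; exists N => n /h; rewrite /resample_dist.
  congr (_ <= _)%E; apply: eq_integral => z _; rewrite !indicE !in_setC.
  by congr (_%:E); case: (_ \in _); case: (_ \in _) => /=;
    rewrite ?subrr ?subr0 ?sub0r ?normrN.
- move=> F mF tF sF; apply: resample_stable_closed.
    by apply: m1; exact: bigcup_measurable.
  move=> e e0.
  (* Tails of a disjoint union decrease to the empty set, so their measure vanishes
     and finite partial unions approximate the union in L1. *)
  pose D K := \bigcup_(i in [set i | (K <= i)%N]) F i.
  have mD K : measurable (D K) by apply: bigcup_measurable.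
  have uniq_i h i j : F i h -> F j h -> i = j.
    by move=> Fi Fj; apply: tF => //; exists h.
  have capD : \bigcap_K D K = set0.
    apply/seteqP; split => // h hD.
    have [i _ Fi] := hD 0%N I; have [j /= ij Fj] := hD i.+1 I.
    by move: ij; rewrite (uniq_i _ _ _ Fi Fj) ltnn.
  have : mu (D K) @[K --> \oo] --> mu (\bigcap_K D K).
    apply: nonincreasing_cvg_mu => //.
    - by rewrite (le_lt_trans (probability_le1 mu (mD 0%N)))// ltry.
    - by rewrite capD.
    - move=> m n mn; apply/subsetPset => h [i /= ni Fi]; exists i => //=.
      exact: leq_trans mn ni.
  rewrite capD measure0 => /fine_cvgP[_] /cvgrPdist_le /(_ e e0)[K _ /(_ K (leqnn _))].
  rewrite sub0r normrN /= => hK.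
  exists (fun h => \sum_(i <- iota 0 K) \1_(F i) h); split.
  - by apply: measurable_sum => i; exact: m1.
  - by apply: resample_stable_sum => i //; exact: m1.
  - have -> : (\int[mu]_h `|\1_(\bigcup_k F k) h - \sum_(i <- iota 0 K) \1_(F i) h|%:E =
        \int[mu]_h (\1_(D K) h)%:E)%E.
      apply: eq_integral => h _; congr (_%:E); rewrite !indicE.
      have [[i _ Fi]|nF] := pselect ((\bigcup_k F k) h); last first.
        rewrite (_ : (h \in \bigcup_k F k) = false); last exact/memNset.
        rewrite (_ : (h \in D K) = false); last first.
          by apply/memNset => -[j _ Fj]; apply: nF; exists j.
        rewrite big1 ?subrr ?normr0// => j _; rewrite indicE.
        by rewrite (_ : (h \in F j) = false)//; apply/memNset => Fj; apply: nF; exists j.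
      rewrite (_ : (h \in \bigcup_k F k) = true); last by apply/mem_set; exists i.
      have Fj j : (h \in F j) = (j == i).
        apply/idP/eqP => [/set_mem Fj|->]; last exact/mem_set.
        exact: uniq_i Fj Fi.
      under eq_bigr do rewrite indicE Fj.
      have -> : (h \in D K) = (K <= i)%N.
        apply/idP/idP => [/set_mem[j /= Kj /(uniq_i _ _ _ Fi) ->//]|Ki].
        by apply/mem_set; exists i.
      rewrite -natr_sum (_ : (\sum_(j <- iota 0 K) (j == i) = (i < K))%N).
        by case: leqP => _ /=; rewrite ?subrr ?subr0 ?normr0 ?normr1.
      have := count_uniq_mem i (iota_uniq 0 K); rewrite mem_iota add0n /= => <-.
      rewrite -sum1_count [RHS]big_mkcond; apply: eq_bigr => j _ /=.
      by case: (j == i).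
    rewrite integral_indic// setIT -[leLHS]fineK ?fin_num_measure// lee_fin.
    by rewrite (le_trans (ler_norm _)).
- by rewrite -GE.
Qed.

Lemma resample_stable_integrable f : mu.-integrable setT (EFin \o f) ->
  resample_stable f.
Proof.
move=> jf; have mf : measurable_fun setT f.
  by apply/measurable_EFinP; exact: measurable_int jf.
apply: resample_stable_closed => // e e0.
have [g [ig _ gf]] := approximation_sfun_integrable measurableT jf.
move: gf => /fine_cvgP[_] /cvgrPdist_le /(_ e e0)[N _ /(_ N (leqnn _))].
rewrite /= sub0r normrN => hN.
have mg : measurable_fun setT (g N : traj H -> R) by exact: measurable_funP.
exists (g N); split=> //.
- rewrite (_ : (g N : traj H -> R) = fun h => \sum_(y <- fset_set (range (g N)))
      y * \1_(g N @^-1` [set y]) h); last first.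
    by apply/funext => h; rewrite [LHS]fimfunE fsbig_finite.
  apply: resample_stable_sum => y.
    apply: measurable_funM => //; apply: measurable_indic.
  apply: resample_stableZ; first exact: measurable_indic.
  apply: resample_stable_indic.
  by rewrite -[X in measurable X]setTI; exact: mg.
- move: hN => /(le_trans (ler_norm _)); rewrite -lee_fin fineK//.
  apply: integrable_fin_num => //.
  have := integrableB_real jf (ig N); exact: integrable_abse.
Qed.

(** f h - condE mu (J n) f h is the integral over h' of f h - f (merge (J n) h h'),
    hence its L1 norm is at most the resampling distance. *)
Lemma condE_L1_approx f (e : R) : mu.-integrable setT (EFin \o f) -> 0 < e ->
  exists N, forall n, (N <= n)%N ->
    (\int[mu]_h `|f h - condE mu (J n) f h|%:E <= e%:E)%E.
Proof.
move=> jf e0; have [N h] := resample_stable_integrable jf e0.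
have mf : measurable_fun setT f.
  by apply/measurable_EFinP; exact: measurable_int jf.
exists N => n /h; apply: le_trans; rewrite /resample_dist.
have mr := measurable_resample n mf.
rewrite (fubini_tonelli1 (fun z : traj H * traj H =>
  `|f z.1 - f (merge (J n) z.1 z.2)|%:E))//; last first.
  by apply/measurable_EFinP; exact: measurableT_comp.
apply: ae_ge0_le_integral => //.
- apply/measurable_EFinP; apply: measurableT_comp => //.
  by apply: measurable_funB => //; exact: measurable_condE.
- by move=> x _; apply: integral_ge0 => y _.
- apply: measurable_fun_fubini_tonelli_F => //.
  by apply/measurable_EFinP; exact: measurableT_comp.
- apply: (ae_imply (ae_integrable_merge swap_mu (J n) jf)) => x i1 _.
  have i2 : mu.-integrable setT (EFin \o (fun h' => f x - f (merge (J n) x h'))).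
    by apply: integrableB_real => //; exact: integrable_cst_real.
  have -> : f x - condE mu (J n) f x = \int[mu]_h' (f x - f (merge (J n) x h')).
    by rewrite RintegralB//; [rewrite Rintegral_cst_prob|exact: integrable_cst_real].
  rewrite EFin_normr_Rintegral//; apply: le_trans (le_abse_integral _ _ _) _ => //.
  exact: measurable_int i2.
Qed.

End L1_approximation.

(** * Telescoping over windows of past times *)

Section telescoping.
Context (dH : measure_display) (H : measurableType dH) (R : realType).
Variable mu : probability (traj H) R.
Let mu2 : probability (traj H * traj H)%type R := (mu \x mu)%E.
Hypothesis swap_mu : forall J (A : set (traj H * traj H)), measurable A ->
  mu2 (swap J @^-1` A) = mu2 A.
Implicit Types (f g : traj H -> R) (p : R).

(** The last r times up to t. *)
Definition window (t : int) (r : nat) : set int :=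
  [set u | (t - r%:Z < u) && (u <= t)].

Lemma window0 t : window t 0 = set0.
Proof. by apply/seteqP; split=> u //= /andP[]; lia. Qed.

Lemma windowS t r : window t r.+1 `\ (t - r%:Z) = window t r.
Proof.
by apply/seteqP; split=> u; rewrite /window /=; [move=> [h1 h2]|move=> h1; split];
  lia.
Qed.

Lemma window_last t r : window t r.+1 (t - r%:Z).
Proof. by rewrite /window /=; lia. Qed.

Lemma condE_window_telescope t (s n : nat) f h : (s <= n)%N ->
  condE mu (window t n) f h - condE mu (window t s) f h =
  \sum_(s <= r < n) projD mu (window t r.+1) (t - r%:Z) f h.
Proof.
move=> sn; rewrite -(telescope_sumr (fun r => condE mu (window t r) f h))//.
by apply: eq_bigr => r _; rewrite /projD windowS.
Qed.

(** As f ignores the times after t, windows may be replaced by the sets of all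
    times after t - n, which exhaust Z. *)
Lemma condE_window_L1 (t : int) f (e : R) : depends_on [set j | j <= t] f ->
  mu.-integrable setT (EFin \o f) -> 0 < e ->
  exists N, forall n, (N <= n)%N ->
    (\int[mu]_h `|f h - condE mu (window t n) f h|%:E <= e%:E)%E.
Proof.
move=> ft jf e0.
have [||N hN] := @condE_L1_approx _ _ _ mu swap_mu
  (fun n => [set j : int | t - n%:Z < j]) _ _ _ _ jf e0.
- by move=> m n mn j /=; lia.
- by move=> k; exists (absz (t - k)).+1 => /=; lia.
exists N => n /hN; apply: le_trans.
rewrite le_eqVlt; apply/orP; left; apply/eqP; apply: eq_integral => h _.
congr (`| _ - _ |%:E); apply: eq_condE => {}h h'.
by apply: ft => j /= jt; rewrite /merge /window /= jt andbT.
Qed.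

Lemma condE_window_sum_L1 (s : seq nat) (f : nat -> traj H -> R) (e : R) :
  (forall t, t \in s -> depends_on [set j : int | j <= t%:Z] (f t)) ->
  (forall t, t \in s -> mu.-integrable setT (EFin \o f t)) -> 0 < e ->
  exists N, forall n, (N <= n)%N ->
    (\int[mu]_h `|\sum_(t <- s) (f t h - condE mu (window t%:Z n) (f t) h)|%:E
      <= e%:E)%E.
Proof.
elim: s e => [|t s IH] e dep jf e0.
  exists 0%N => n _; under eq_integral do rewrite big_nil normr0.
  by rewrite integral0 lee_fin ltW.
have e2 : 0 < e / 2 by rewrite divr_gt0.
have sub i : i \in s -> i \in t :: s by rewrite inE => ->; rewrite orbT.
have [N1 h1] := IH _ (fun i si => dep i (sub i si)) (fun i si => jf i (sub i si)) e2.
have [N2 h2] := condE_window_L1 (dep t (mem_head _ _)) (jf t (mem_head _ _)) e2.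
have md i n : i \in t :: s ->
    measurable_fun setT (fun h => f i h - condE mu (window i%:Z n) (f i) h).
  move=> si; apply: measurable_funB; last exact: measurable_condE (jf i si).
  by apply/measurable_EFinP; exact: measurable_int (jf i si).
have ms n : measurable_fun setT
    (fun h => \sum_(i <- s) (f i h - condE mu (window i%:Z n) (f i) h)).
  apply: measurable_sum_in => i si.
  by apply: md; rewrite inE si orbT.
exists (maxn N1 N2) => n; rewrite geq_max => /andP[/h1 {}h1 /h2 {}h2].
apply: (@le_trans _ _ (\int[mu]_h (`|f t h - condE mu (window t%:Z n) (f t) h|%:E +
  `|\sum_(i <- s) (f i h - condE mu (window i%:Z n) (f i) h)|%:E))%E).
  apply: ge0_le_integral => //.
  - apply/measurable_EFinP; apply: measurableT_comp => //.
    under eq_fun do rewrite big_cons.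
    by apply: measurable_funD => //; apply: md; rewrite mem_head.
  - apply: emeasurable_funD; apply/measurable_EFinP; apply: measurableT_comp => //.
    by apply: md; rewrite mem_head.
  - by move=> h _; rewrite big_cons -EFinD lee_fin ler_normD.
rewrite ge0_integralD//; last 2 first.
- apply/measurable_EFinP; apply: measurableT_comp => //.
  by apply: md; rewrite mem_head.
- by apply/measurable_EFinP; apply: measurableT_comp.
by rewrite [e]splitr EFinD leeD.
Qed.

(** For a fixed lag r the time t - r removed from the term of t lies before every
    time that the terms of t' > t involve: these are martingale differences in
    decreasing t. *)
Lemma projD_sum_bnd (p : R) (a b r : nat) (f : nat -> traj H -> R) (L c : nat -> R) :
  2 < p ->
  (forall t, (a <= t < b)%N -> bnd mu p (f t) (L t)) ->
  (forall t, (a <= t < b)%N ->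
    bnd mu2 p (fun z => f t z.1 - f t (merge [set~ t%:Z - r%:Z] z.1 z.2)) (c t)) ->
  bnd mu p (fun h => \sum_(a <= t < b)
      projD mu (window t%:Z r.+1) (t%:Z - r%:Z) (f t) h)
    (burkholder_cst p * Num.sqrt (\sum_(a <= t < b) c t ^+ 2)).
Proof.
move=> p2 bf bd; have p1 : 1 < p by lra.
have bp t : (a <= t < b)%N ->
    bnd mu p (projD mu (window t%:Z r.+1) (t%:Z - r%:Z) (f t)) (c t).
  move=> tab; apply: (bnd_projD swap_mu p1 (window_last _ _) (bf t tab)).
  exact: bd.
apply: burkholder => // [t|s1 t s2 abE].
  by rewrite mem_index_iota => /bp.
have srt : sorted ltn (index_iota a b) by exact: iota_ltn_sorted.
have s2P t' : t' \in s2 -> (t < t')%N /\ (a <= t' < b)%N.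
  move=> ts2; split.
    move: srt; rewrite abE => /(subseq_sorted ltn_trans (suffix_subseq _ _)) /=.
    by rewrite (path_sortedE ltn_trans) => /andP[/allP + _]; exact.
  by rewrite -mem_index_iota abE mem_cat inE ts2 !orbT.
have tab : (a <= t < b)%N by rewrite -mem_index_iota abE mem_cat mem_head orbT.
pose S h := \sum_(t' <- s2) projD mu (window t'%:Z r.+1) (t'%:Z - r%:Z) (f t') h.
have bS : bnd mu p S (\sum_(t' <- s2) c t').
  by apply: bnd_sum => [|t' /s2P[_ /bp]//]; exact: ltW.
have dS : depends_on [set~ t%:Z - r%:Z] (fun h => spow (p - 1) (S h)).
  move=> h h' hh; congr spow; apply: eq_big_seq => t' /s2P[tt' _].
  apply: projD_depends => j /andP[/= j1 j2]; apply: hh => /= jE; lia.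
have mS : measurable_fun setT (fun h => spow (p - 1) (S h)).
  by case: bS => mS _ _; apply: measurableT_comp => //; exact: measurable_spow.
have ji := bnd_spow_mul_integrable p1 (bnd_prod_fst mu bS)
  (bnd_merge swap_mu (window t%:Z r.+1) (bf t tab)).
have [e _] := Rintegral_mul_projD swap_mu (window_last t%:Z r)
  (bnd_integrable (ltW p1) (bf t tab)) mS dS ji.
exact: e.
Qed.

(** Telescope from window s to a large window n, bound the sum over t for each
    lag by Burkholder's inequality, add up the lags by the triangle inequality, and
    let n tend to infinity in L1. *)
Lemma telescoping_bnd (p B : R) (a b s : nat) (f : nat -> traj H -> R)
    (L c eps : nat -> R) : 2 < p ->
  (forall t, (a <= t < b)%N -> depends_on [set j : int | j <= t%:Z] (f t)) ->
  (forall t, (a <= t < b)%N -> bnd mu p (f t) (L t)) ->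
  (forall t q, (a <= t < b)%N -> (s <= q)%N ->
    bnd mu2 p (fun z => f t z.1 - f t (merge [set~ t%:Z - q%:Z] z.1 z.2))
      (c t * eps q)) ->
  (forall q, 0 <= eps q) ->
  (forall n, \sum_(s <= q < n) eps q <= B) ->
  bnd mu p (fun h => \sum_(a <= t < b) (f t h - condE mu (window t%:Z s) (f t) h))
    (burkholder_cst p * (B * Num.sqrt (\sum_(a <= t < b) c t ^+ 2))).
Proof.
move=> p2 dep bf bd eps0 hB; have p1 : 1 < p by lra.
have B0 : 0 <= B by apply: le_trans (hB s); rewrite big_geq.
have jf t : t \in index_iota a b -> mu.-integrable setT (EFin \o f t).
  by rewrite mem_index_iota => /bf; apply: bnd_integrable; exact: ltW.
have mf (J : nat -> set int) : measurable_fun setT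
    (fun h => \sum_(a <= t < b) (f t h - condE mu (J t) (f t) h)).
  apply: measurable_sum_in => i si.
  apply: measurable_funB; last exact: measurable_condE (jf i si).
  by apply/measurable_EFinP; exact: measurable_int (jf i si).
apply: bnd_L1_limit => //.
  by rewrite !mulr_ge0 ?burkholder_cst_ge0 ?sqrtr_ge0.
move=> e e0.
have [|N hN] := condE_window_sum_L1 _ jf e0.
  by move=> t; rewrite mem_index_iota => /dep.
(* The large window must contain the window of length s. *)
pose n := maxn N s.
exists (fun h => \sum_(a <= t < b)
   (condE mu (window t%:Z n) (f t) h - condE mu (window t%:Z s) (f t) h)).
  have -> : (fun h => \sum_(a <= t < b)
      (condE mu (window t%:Z n) (f t) h - condE mu (window t%:Z s) (f t) h)) =
    (fun h => \sum_(s <= r < n) \sum_(a <= t < b)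
       projD mu (window t%:Z r.+1) (t%:Z - r%:Z) (f t) h).
    apply/funext => h; rewrite exchange_big; apply: eq_bigr => t _.
    by rewrite condE_window_telescope// leq_maxr.
  apply: (@bnd_le _ _ _ _ _ _ (\sum_(s <= r < n)
      (burkholder_cst p * Num.sqrt (\sum_(a <= t < b) (c t * eps r) ^+ 2)))); first by lra.
    rewrite -mulr_sumr ler_wpM2l ?burkholder_cst_ge0//.
    apply: (@le_trans _ _ (\sum_(s <= r < n)
        (eps r * Num.sqrt (\sum_(a <= t < b) c t ^+ 2)))).
      apply: ler_sum => r _.
      under eq_bigr do rewrite exprMn.
      by rewrite -mulr_suml mulrC sqrtrM ?sqr_ge0// sqrtr_sqr ger0_norm.
    by rewrite -mulr_suml ler_wpM2r ?sqrtr_ge0.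
  apply: bnd_sum => [|r]; first exact: ltW.
  rewrite mem_index_iota => /andP[sr _].
  by apply: (projD_sum_bnd p2 bf) => t tab; exact: bd.
apply: le_trans (hN n (leq_maxl _ _)).
rewrite le_eqVlt; apply/orP; left; apply/eqP; apply: eq_integral => h _.
congr (`| _ |%:E); rewrite -sumrB; apply: eq_bigr => t _; ring.
Qed.

End telescoping.

(** * Linear forms with independent coefficients *)

Lemma sqrt_sum_cauchy (R : realType) (I : eqType) (s : seq I) (x : I -> R) :
  \sum_(i <- s) x i <= Num.sqrt (size s)%:R * Num.sqrt (\sum_(i <- s) x i ^+ 2).
Proof.
rewrite -sqrtrM ?ler0n//; apply: le_trans (ler_norm _) _.
rewrite -sqrtr_sqr ler_wsqrtr//.
elim: s => [|i s IH]; first by rewrite !big_nil expr0n mulr0.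
rewrite !big_cons /= -natr1.
set S := \sum_(j <- s) _ in IH *; set Q := \sum_(j <- s) _ in IH *.
set n : R := (size s)%:R in IH *.
have n0 : 0 <= n by rewrite ler0n.
have Q0 : 0 <= Q by apply: sumr_ge0 => j _; exact: sqr_ge0.
have : 2 * x i * S <= n * x i ^+ 2 + Q.
  have [n00|n_neq0] := eqVneq n 0.
    have S0 : S = 0.
      by apply/eqP; rewrite -sqrf_eq0 eq_le sqr_ge0 andbT; rewrite n00 mul0r in IH.
    by rewrite S0 mulr0 n00 mul0r add0r.
  have n1 : 0 < n by rewrite lt_neqAle eq_sym n_neq0.
  rewrite -(ler_pM2l n1).
  have := sqr_ge0 (n * x i - S); nra.
by nra.
Qed.

Section independence_bound.
Context (dH : measure_display) (H : measurableType dH) (R : realType).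
Variable mu : probability (traj H) R.
Let mu2 : probability (traj H * traj H)%type R := (mu \x mu)%E.
Hypothesis swap_mu : forall J (A : set (traj H * traj H)), measurable A ->
  mu2 (swap J @^-1` A) = mu2 A.

(** D and V are independent, as they involve complementary sets of coordinates;
    exchanging coordinates realizes this independence by two distinct paths.  With
    V frozen the integral is the p-th power of a linear form of D. *)
Lemma bnd_independent_dot (d : nat) (p K L : R) (J : set int)
    (D V : 'I_d -> traj H -> R) : 0 < p -> 0 <= K ->
  (forall i, depends_on J (D i)) -> (forall i, depends_on (~` J) (V i)) ->
  (forall i, measurable_fun setT (D i)) -> (forall i, measurable_fun setT (V i)) ->
  (forall v : 'cV[R]_d, bnd mu p (fun h => \sum_i v i 0 * D i h) (K * vnorm2 v)) ->
  bnd mu p (fun h => Num.sqrt (\sum_i V i h ^+ 2)) L ->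
  bnd mu p (fun h => \sum_i V i h * D i h) (K * L).
Proof.
move=> p0 K0 dD dV mD mV bD bV.
pose F (z : traj H * traj H) : R := \sum_i V i z.2 * D i z.1.
have mF : measurable_fun setT F.
  apply: measurable_sum => i; apply: measurable_funM.
    by apply: (measurableT_comp (mV i)); exact: measurable_snd.
  by apply: (measurableT_comp (mD i)); exact: measurable_fst.
have mVD : measurable_fun setT (fun h : traj H => \sum_i V i h * D i h).
  by apply: measurable_sum => i; apply: measurable_funM.
have [mN L0 hV] := bV.
apply: (bnd_of_prod_fst mVD (P2 := mu)).
have -> : (fun z : traj H * traj H => \sum_i V i z.1 * D i z.1) =
    (fun z => F (swap J z)).
  apply/funext => z; apply: eq_bigr => i _ /=.
  rewrite (depends_on_merge _ _ (dD i)); congr (_ * _).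
  by apply: dV => j Jj; rewrite /merge asboolF.
apply: (bnd_swap swap_mu).
split=> //; first exact: mulr_ge0.
have mFp : measurable_fun setT (fun z => (`|F z| `^ p)%:E).
  by apply/measurable_EFinP; exact: measurable_normpow.
rewrite (fubini_tonelli2 (fun z => (`|F z| `^ p)%:E))//.
apply: (@le_trans _ _ (\int[mu]_h ((K `^ p)%:E *
    (`|Num.sqrt (\sum_i V i h ^+ 2)| `^ p)%:E))%E).
  apply: ge0_le_integral => //.
  - by move=> h _; apply: integral_ge0 => h' _; rewrite lee_fin powR_ge0.
  - exact: measurable_fun_fubini_tonelli_G.
  - apply: measurable_funeM; apply/measurable_EFinP; exact: measurable_normpow.
  - move=> h _; rewrite /fubini_G /=.
    have [_ _] := bD (\col_i V i h).
    under eq_integral => x _.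
      under eq_bigr do rewrite mxE.
      over.
    move=> /le_trans; apply.
    rewrite -EFinM lee_fin powRM ?sqrtr_ge0// ger0_norm ?sqrtr_ge0//.
    rewrite /vnorm2 le_eqVlt; apply/orP; left; apply/eqP.
    by congr (_ * Num.sqrt _ `^ _); apply: eq_bigr => i _; rewrite mxE.
rewrite ge0_integralZl_EFin ?powR_ge0//; last first.
  by apply/measurable_EFinP; exact: measurable_normpow.
by rewrite powRM// EFinM lee_wpmul2l// lee_fin powR_ge0.
Qed.

End independence_bound.

(** * Linear and quadratic forms of a causal process *)

Lemma ler_sum_uniq_sub (R : realType) (I : eqType) (s1 s2 : seq I) (F : I -> R) :
  uniq s1 -> {subset s1 <= s2} -> (forall i, 0 <= F i) ->
  \sum_(i <- s1) F i <= \sum_(i <- s2) F i.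
Proof.
move=> + + F0; elim: s1 s2 => [|i s1 IH] s2 /=.
  by rewrite big_nil sumr_ge0.
move=> /andP[is1 us1] s12; have is2 := s12 i (mem_head _ _).
rewrite big_cons (perm_big _ (perm_to_rem is2)) big_cons lerD2l.
apply: IH => // j js1; have js2 : j \in s2 by apply: s12; rewrite inE js1 orbT.
have := perm_mem (perm_to_rem is2) j; rewrite js2 inE => /esym/orP[/eqP ji|//].
by rewrite ji in js1; rewrite js1 in is1.
Qed.

Lemma ler_sum_lag (R : realType) (t m n l : nat) (F : nat -> R) :
  (n <= t.+1)%N -> (t - m <= l)%N -> (forall j, 0 <= F j) ->
  \sum_(m <= i < n) F (t - i)%N <= \sum_(j < l.+1) F j.
Proof.
move=> nt ml F0; rewrite -(big_mkord predT F) -(big_map (subn t) predT F).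
apply: ler_sum_uniq_sub => //.
- rewrite map_inj_in_uniq ?iota_uniq// => i j.
  by rewrite !mem_index_iota; lia.
- by move=> j /mapP[i]; rewrite !mem_index_iota => ? ->; lia.
Qed.

Lemma lag_shift (t1 t2 q : nat) : (t2 <= t1)%N -> (t1 - t2 <= q)%N ->
  t1%:Z - q%:Z = t2%:Z - (q - (t1 - t2))%:Z.
Proof. by lia. Qed.

Lemma lag_range (l1 l2 t t2 : nat) :
  t2 \in index_iota (maxn (t - l2) 1) (t - l1).+1 ->
  [/\ (0 < t2)%N, (t2 <= t - l1)%N & (t - t2 <= l2)%N].
Proof. by rewrite mem_index_iota => h; split; lia. Qed.

Lemma lag_max (l2 t : nat) : (t - maxn (t - l2) 1 <= l2)%N.
Proof. by lia. Qed.

Lemma lag_le (j l S : nat) : (j < l.+1)%N -> (l < S)%N ->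
  (j <= S.+1)%N /\ (S - l <= (S.+1 - j).+1)%N.
Proof. by move=> *; split; lia. Qed.

(** The times of window t l that are at most t - q.  Removing the most recent time
    first yields martingale differences in increasing t, the order that suits
    coefficients taken from the far past. *)
Definition fwindow (t : int) (l q : nat) : set int :=
  [set u | (t - l%:Z < u) && (u <= t - q%:Z)].

Lemma fwindow0 t l : fwindow t l 0 = window t l.
Proof. by apply/seteqP; split=> u; rewrite /fwindow /window /=; lia. Qed.

Lemma fwindow_end t l : fwindow t l l = set0.
Proof. by apply/seteqP; split=> u //; rewrite /fwindow /=; lia. Qed.

Lemma fwindow_last t l q : (q < l)%N -> fwindow t l q (t - q%:Z).
Proof. by rewrite /fwindow /=; lia. Qed.

Lemma fwindowS t l q : fwindow t l q `\ (t - q%:Z) = fwindow t l q.+1.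
Proof.
apply/seteqP; split=> u; rewrite /fwindow /=.
  by move=> [h1 h2]; lia.
by move=> h1; split; lia.
Qed.

Lemma past_fwindow (t l q t2 : nat) (j : int) : (l <= t)%N -> (t2 <= t - l)%N ->
  j <= t2%:Z -> (~` fwindow t%:Z l q) j.
Proof. by rewrite /fwindow /=; lia. Qed.

Lemma past_neq (t t' l q t2 : nat) (j : int) : (t' <= t)%N -> (l <= t')%N ->
  (q < l)%N -> (t2 <= t' - l)%N -> j <= t2%:Z -> j <> t%:Z - q%:Z.
Proof. by lia. Qed.

Lemma fwindow_neq (t t' l q : nat) (j : int) : (t' < t)%N ->
  fwindow t'%:Z l q j -> j <> t%:Z - q%:Z.
Proof. by rewrite /fwindow /=; lia. Qed.

Lemma Rintegral_sum0 d (T : measurableType d) (R : realType) (P : probability T R)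
  (I : eqType) (s : seq I) (f : I -> T -> R) :
  (forall i, \int[P]_x f i x = 0 /\ P.-integrable setT (EFin \o f i)) ->
  \int[P]_x (\sum_(i <- s) f i x) = 0 /\
  P.-integrable setT (EFin \o (fun x => \sum_(i <- s) f i x)).
Proof.
move=> h; elim: s => [|i s [e ji]].
  under eq_Rintegral do rewrite big_nil.
  under [X in _ /\ _.-integrable _ (_ \o X)]eq_fun do rewrite big_nil.
  by rewrite Rintegral_cst_prob; split=> //; exact: integrable_cst_real.
have [e' ji'] := h i.
under eq_Rintegral do rewrite big_cons.
under [X in _ /\ _.-integrable _ (_ \o X)]eq_fun do rewrite big_cons.
by rewrite RintegralD// e e' addr0; split=> //; exact: integrableD_real.
Qed.

(** In decreasing order, the times listed after t are those before t. *)
Lemma rev_iota_split (a b : nat) s1 t s2 :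
  rev (index_iota a b) = s1 ++ t :: s2 ->
  (a <= t < b)%N /\ (forall t', t' \in s2 -> (a <= t')%N /\ (t' < t)%N).
Proof.
move=> e; have := congr1 rev e; rewrite revK rev_cat rev_cons cat_rcons => e'.
split; first by rewrite -mem_index_iota e' mem_cat mem_head orbT.
move=> t' ts2; split.
  have : t' \in index_iota a b by rewrite e' mem_cat mem_rev ts2.
  by rewrite mem_index_iota => /andP[].
have := iota_ltn_sorted a (b - a); rewrite -[iota _ _]/(index_iota a b) e'.
rewrite (sorted_pairwise ltn_trans) pairwise_cat => /and3P[/allrelP + _ _].
by apply; rewrite ?mem_rev ?mem_head.
Qed.

Section row_norms.
Context (R : realType) (d : nat).
Implicit Types (A : 'M[R]_d).

Lemma vnorm2_ge0 (a : 'cV[R]_d) : 0 <= vnorm2 a.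
Proof. exact: sqrtr_ge0. Qed.

Lemma vnorm2_sqr (a : 'cV[R]_d) : vnorm2 a ^+ 2 = \sum_i a i 0 ^+ 2.
Proof. by rewrite sqr_sqrtr//; apply: sumr_ge0 => i _; exact: sqr_ge0. Qed.

Lemma vnorm2_delta (i : 'I_d) : vnorm2 (delta_mx i 0 : 'cV[R]_d) = 1.
Proof.
rewrite /vnorm2 (bigD1 i)//= big1 ?addr0 => [|j /negbTE ji]; rewrite mxE ?ji ?eqxx/=.
  by rewrite expr1n sqrtr1.
by rewrite expr0n.
Qed.

Definition rowv A (i : 'I_d) : 'cV[R]_d := (row i A)^T.

Lemma rowvE A i j : rowv A i j 0 = A i j.
Proof. by rewrite !mxE. Qed.

Lemma sum_rowv_le A (n : R) : 0 <= n ->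
  \sum_i vnorm2 (rowv A i) ^+ 2 <= d%:R * n ^+ 2 ->
  \sum_i vnorm2 (rowv A i) <= d%:R * n.
Proof.
move=> n0 h; have := sqrt_sum_cauchy (index_enum 'I_d) (fun i => vnorm2 (rowv A i)).
have -> : size (index_enum 'I_d) = d.
  by rewrite [index_enum _]unlock -enumT size_enum_ord.
move=> /le_trans; apply.
apply: (@le_trans _ _ (Num.sqrt d%:R * Num.sqrt (d%:R * n ^+ 2))).
  by rewrite ler_wpM2l ?sqrtr_ge0// ler_wsqrtr.
by rewrite sqrtrM ?ler0n// mulrA -expr2 sqr_sqrtr ?ler0n// sqrtr_sqr ger0_norm.
Qed.

End row_norms.

Section process.
Context (dH : measure_display) (H : measurableType dH) (R : realType).
Variable mu : probability (traj H) R.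
Let mu2 : probability (traj H * traj H)%type R := (mu \x mu)%E.
Hypothesis swap_mu : forall J (A : set (traj H * traj H)), measurable A ->
  mu2 (swap J @^-1` A) = mu2 A.
Variables (d : nat) (G : int -> 'I_d -> traj H -> R).

(** G t i stands for the i-th coordinate of the process at time t. *)
Definition lin (t : int) (a : 'cV[R]_d) (h : traj H) : R :=
  \sum_i a i 0 * G t i h.

Variables (M alpha C0 C1 : R) (dlt : nat -> R).
Hypothesis M_gt : 8 < M.
Hypothesis C0_ge0 : 0 <= C0.
Hypothesis C1_ge0 : 0 <= C1.
Hypothesis alpha_ge0 : 0 <= alpha.
Hypothesis dlt_ge0 : forall q, 0 <= dlt q.
Hypothesis G_dep : forall (t : int) i, depends_on [set j | j <= t] (G t i).
Hypothesis lin_bnd : forall t a, bnd mu M (lin t a) (C0 * vnorm2 a).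
Hypothesis lin_diff : forall t a q,
  bnd mu2 M (fun z => lin t a z.1 - lin t a (merge [set~ t - q%:Z] z.1 z.2))
    (vnorm2 a * dlt q).
Hypothesis G_mean : forall t i, \int[mu]_h G t i h = 0.
Hypothesis dlt_sum : forall s n, \sum_(s <= q < n) dlt q <= C1 / (1 + s%:R) `^ alpha.

Let M1 : 1 < M. Proof. by move: M_gt; lra. Qed.
Let M0 : 0 < M. Proof. by move: M_gt; lra. Qed.
Let M2 : 2 < M. Proof. by move: M_gt; lra. Qed.
Let hM2 : 2 < M / 2. Proof. by move: M_gt; lra. Qed.
Let hM1 : 1 <= M / 2. Proof. by move: M_gt; lra. Qed.
Let hM0 : 0 <= M / 2. Proof. by move: M_gt; lra. Qed.

Lemma lin_delta t i : lin t (delta_mx i 0) = G t i.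
Proof.
apply/funext => h; rewrite /lin (bigD1 i)//= big1 ?addr0 => [|j /negbTE ji].
  by rewrite mxE !eqxx mul1r.
by rewrite mxE ji mul0r.
Qed.

Lemma G_bnd t i : bnd mu M (G t i) C0.
Proof. by have := lin_bnd t (delta_mx i 0); rewrite lin_delta vnorm2_delta mulr1. Qed.

Lemma G_int t i : mu.-integrable setT (EFin \o G t i).
Proof. exact: bnd_integrable (ltW M1) (G_bnd t i). Qed.

Lemma lin_dep (t : int) a : depends_on [set j | j <= t] (lin t a).
Proof. by move=> h h' hh; apply: eq_bigr => i _; rewrite (G_dep i hh). Qed.

Lemma lin_mean t a : \int[mu]_h lin t a h = 0.
Proof.
rewrite /lin; elim: (index_enum _) => [|i s IH].
  by under eq_Rintegral do rewrite big_nil; rewrite Rintegral_cst_prob.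
under eq_Rintegral do rewrite big_cons.
have iG := integrableZ_real (a i 0) (G_int t i).
rewrite RintegralD// ?IH ?addr0 ?RintegralZl ?G_mean ?mulr0//; try exact: G_int.
have -> : EFin \o (fun h => \sum_(j <- s) a j 0 * G t j h) =
    (fun h => \sum_(j <- s) (a j 0 * G t j h)%:E)%E.
  by apply/funext => h /=; rewrite sumEFin.
by apply: integrable_sum => // j _; apply: integrableZ_real; exact: G_int.
Qed.

Lemma lin_window_bnd (a b s : nat) (v : nat -> 'cV[R]_d) :
  bnd mu M
    (fun h => \sum_(a <= t < b)
      (lin t%:Z (v t) h - condE mu (window t%:Z s) (lin t%:Z (v t)) h))
    (burkholder_cst M * (C1 / (1 + s%:R) `^ alpha *
       Num.sqrt (\sum_(a <= t < b) vnorm2 (v t) ^+ 2))).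
Proof.
apply: (telescoping_bnd swap_mu (eps := dlt) (L := fun t => C0 * vnorm2 (v t))) => //.
- by move=> t _; exact: lin_dep.
- by move=> t q _ _; exact: lin_diff.
Qed.

(** The window of length zero is empty, and conditioning on nothing gives the mean. *)
Lemma lin_sum_bnd (a b : nat) (v : nat -> 'cV[R]_d) :
  bnd mu M (fun h => \sum_(a <= t < b) lin t%:Z (v t) h)
    (burkholder_cst M * C1 * Num.sqrt (\sum_(a <= t < b) vnorm2 (v t) ^+ 2)).
Proof.
have := lin_window_bnd a b 0 v; rewrite addr0 powR1 divr1 mulrA.
congr bnd; apply/funext => h; apply: eq_bigr => t _.
by rewrite window0 condE_set0 lin_mean subr0.
Qed.

Definition bil (t1 t2 : int) (A : 'M[R]_d) (h : traj H) : R :=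
  \sum_i G t1 i h * lin t2 (rowv A i) h.

Lemma bil_bnd t1 t2 A n : 0 <= n ->
  \sum_i vnorm2 (rowv A i) ^+ 2 <= d%:R * n ^+ 2 ->
  bnd mu (M / 2) (bil t1 t2 A) (C0 ^+ 2 * (d%:R * n)).
Proof.
move=> n0 /(sum_rowv_le n0) hA.
apply: (@bnd_le _ _ _ _ _ _ (\sum_i C0 * (C0 * vnorm2 (rowv A i)))) => //.
  by rewrite -!mulr_sumr mulrA -expr2 ler_wpM2l ?sqr_ge0.
by apply: bnd_sum => // i _; apply: bnd_mul => //; exact: G_bnd.
Qed.

Lemma bil_dep (t1 t2 : int) A : t2 <= t1 ->
  depends_on [set j | j <= t1] (bil t1 t2 A).
Proof.
move=> t21 h h' hh; apply: eq_bigr => i _; rewrite (G_dep i hh); congr (_ * _).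
by apply: lin_dep => j /= jt; apply: hh; rewrite /= (le_trans jt).
Qed.

(** The product rule for differences.  Time t1 - q has lag q - (t1 - t2) when it is
    counted from t2. *)
Lemma bil_diff (t1 t2 q : nat) A n : 0 <= n ->
  \sum_i vnorm2 (rowv A i) ^+ 2 <= d%:R * n ^+ 2 ->
  (t2 <= t1)%N -> (t1 - t2 <= q)%N ->
  bnd mu2 (M / 2) (fun z => bil t1%:Z t2%:Z A z.1 -
      bil t1%:Z t2%:Z A (merge [set~ t1%:Z - q%:Z] z.1 z.2))
    (C0 * (d%:R * n) * (dlt q + dlt (q - (t1 - t2)))).
Proof.
move=> n0 /(sum_rowv_le n0) hA t21 tq.
set J := [set~ _].
have JE : J = [set~ t2%:Z - (q - (t1 - t2))%:Z].
  by rewrite /J (lag_shift t21 tq).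
have Gd i : bnd mu2 M (fun z => G t1%:Z i z.1 - G t1%:Z i (merge J z.1 z.2)) (dlt q).
  by have := lin_diff t1%:Z (delta_mx i 0) q; rewrite !lin_delta vnorm2_delta mul1r.
have Ld a : bnd mu2 M (fun z => lin t2%:Z a z.1 - lin t2%:Z a (merge J z.1 z.2))
    (vnorm2 a * dlt (q - (t1 - t2))).
  by rewrite JE; exact: lin_diff.
rewrite (_ : (fun z => _) = (fun z => \sum_i
    ((G t1%:Z i z.1 - G t1%:Z i (merge J z.1 z.2)) * lin t2%:Z (rowv A i) z.1 +
     G t1%:Z i (merge J z.1 z.2) *
       (lin t2%:Z (rowv A i) z.1 - lin t2%:Z (rowv A i) (merge J z.1 z.2))))); last first.
  by apply/funext => z; rewrite /bil -sumrB; apply: eq_bigr => i _; ring.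
apply: (@bnd_le _ _ _ _ _ _ (\sum_i (dlt q * (C0 * vnorm2 (rowv A i)) +
   C0 * (vnorm2 (rowv A i) * dlt (q - (t1 - t2)))))) => //.
  rewrite [leLHS](_ : _ = C0 * (dlt q + dlt (q - (t1 - t2))) *
      \sum_i vnorm2 (rowv A i)); last first.
    by rewrite mulr_sumr; apply: eq_bigr => i _; ring.
  by rewrite mulrAC ler_wpM2r ?ler_wpM2l// addr_ge0.
apply: bnd_sum => // i _; apply: bnd_add => //; apply: bnd_mul => //.
- exact: bnd_prod_fst.
- by apply: (bnd_merge swap_mu); exact: G_bnd.
Qed.

Section quadratic.
Variables (A : nat -> nat -> 'M[R]_d) (nA : nat -> nat -> R) (l1 l2 N : nat).
Hypothesis nA_ge0 : forall t1 t2, 0 <= nA t1 t2.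
Hypothesis nA_frob : forall t1 t2,
  \sum_i vnorm2 (rowv (A t1 t2) i) ^+ 2 <= d%:R * nA t1 t2 ^+ 2.

Definition lagsum (t : nat) (h : traj H) : R :=
  \sum_(maxn (t - l2) 1 <= t2 < (t - l1).+1) bil t%:Z t2%:Z (A t t2) h.

(** Telescoping for [lagsum] as a function of the past of t.  Each of the l2 + 1
    lags j contributes delta_q + delta_(q - j), and q > Sg keeps both indices at
    least Sg - l2. *)
Lemma lagsum_window_bnd (Sg : nat) (amax : R) : (l2 < Sg)%N ->
  (forall t t2, (1 + l1 <= t < N.+1)%N ->
    (maxn (t - l2) 1 <= t2 < (t - l1).+1)%N -> nA t t2 <= amax) -> 0 <= amax ->
  bnd mu (M / 2)
    (fun h => \sum_(1 + l1 <= t < N.+1)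
      \sum_(maxn (t - l2) 1 <= t2 < (t - l1).+1)
        (bil t%:Z t2%:Z (A t t2) h -
         condE mu (window t%:Z Sg.+1) (bil t%:Z t2%:Z (A t t2)) h))
    (burkholder_cst (M / 2) * (l2.+1%:R * (2 * C1 / (Sg - l2)%:R `^ alpha) *
       Num.sqrt (\sum_(1 + l1 <= t < N.+1) (C0 * (d%:R * amax)) ^+ 2))).
Proof.
move=> lS hmax amax0.
(* The effect on [lagsum] of resampling lag q, up to the factor C0 d amax. *)
pose eps q := \sum_(j < l2.+1) (dlt q + dlt (q - j)).
have bl t : bnd mu (M / 2) (lagsum t)
    (\sum_(maxn (t - l2) 1 <= t2 < (t - l1).+1) C0 ^+ 2 * (d%:R * nA t t2)).
  by apply: bnd_sum => // t2 _; exact: bil_bnd.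
have jbil t t2 : mu.-integrable setT (EFin \o bil t%:Z t2%:Z (A t t2)).
  exact: bnd_integrable hM1 (bil_bnd _ _ (nA_ge0 t t2) (nA_frob t t2)).
have T : bnd mu (M / 2) (fun h => \sum_(1 + l1 <= t < N.+1)
    (lagsum t h - condE mu (window t%:Z Sg.+1) (lagsum t) h))
    (burkholder_cst (M / 2) * (l2.+1%:R * (2 * C1 / (Sg - l2)%:R `^ alpha) *
       Num.sqrt (\sum_(1 + l1 <= t < N.+1) (C0 * (d%:R * amax)) ^+ 2))).
  apply: (telescoping_bnd swap_mu (c := fun=> C0 * (d%:R * amax)) (eps := eps) hM2 _
    (fun t _ => bl t)).
  - move=> t tN h h' hh; apply: eq_big_seq => t2 /lag_range[_ t2t _].
    by apply: bil_dep hh; rewrite lez_nat (leq_trans t2t)// leq_subr.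
  - move=> t q tN Sq.
    rewrite (_ : (fun z => _) = (fun z => \sum_(maxn (t - l2) 1 <= t2 < (t - l1).+1)
        (bil t%:Z t2%:Z (A t t2) z.1 -
         bil t%:Z t2%:Z (A t t2) (merge [set~ t%:Z - q%:Z] z.1 z.2)))); last first.
      by apply/funext => z; rewrite sumrB.
    apply: (@bnd_le _ _ _ _ _ _ (\sum_(maxn (t - l2) 1 <= t2 < (t - l1).+1)
        (C0 * (d%:R * nA t t2) * (dlt q + dlt (q - (t - t2)))))) => //.
      apply: (@le_trans _ _ (\sum_(maxn (t - l2) 1 <= t2 < (t - l1).+1)
          (C0 * (d%:R * amax) * (dlt q + dlt (q - (t - t2)))))).
        rewrite big_seq [leRHS]big_seq; apply: ler_sum => t2.
        rewrite mem_index_iota => t2r.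
        rewrite ler_wpM2r ?addr_ge0// ler_wpM2l// ler_wpM2l ?ler0n//.
        exact: hmax.
      rewrite -mulr_sumr ler_wpM2l ?mulr_ge0 ?ler0n//.
      apply: (ler_sum_lag (F := fun j => dlt q + dlt (q - j)));
        [exact: leq_subr|exact: lag_max|].
      by move=> j; rewrite addr_ge0.
    apply: bnd_sum => // t2 /lag_range[_ t2t tl].
    apply: bil_diff => //; first by rewrite (leq_trans t2t)// leq_subr.
    by rewrite (leq_trans tl)// (leq_trans (ltnW lS))// ltnW.
  - by move=> q; apply: sumr_ge0 => j _; rewrite addr_ge0.
  - move=> n; rewrite exchange_big /=.
    apply: (@le_trans _ _ (\sum_(j < l2.+1) (2 * C1 / (Sg - l2)%:R `^ alpha))).
      apply: ler_sum => j _; rewrite big_split /=.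
      have mono (s : nat) : (Sg - l2 <= s.+1)%N ->
          C1 / (1 + s%:R) `^ alpha <= C1 / (Sg - l2)%:R `^ alpha.
        move=> hs; rewrite ler_wpM2l// nat1r lef_pV2 ?posrE ?powR_gt0 ?ltr0n ?subn_gt0//.
        by rewrite ge0_ler_powR ?nnegrE ?ler0n ?ler_nat.
      have h1 := le_trans (dlt_sum Sg.+1 n) (mono Sg.+1
        (leq_trans (leq_subr _ _) (leqW (leqnSn _)))).
      have h2 : \sum_(Sg.+1 <= q < n) dlt (q - j) <= C1 / (Sg - l2)%:R `^ alpha.
        have jl := ltn_ord j.
        have [jS Sj] := lag_le jl lS; rewrite -[X in \sum_(X <= _ < _) _](subnK jS).
        rewrite big_addn; under eq_bigr do rewrite addnK.
        exact: le_trans (dlt_sum _ _) (mono _ Sj).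
      by rewrite -mulrA mulrDl mul1r lerD.
    by rewrite sumr_const card_ord -[leLHS]mulr_natl.
apply: bnd_ae T.
  apply: measurable_sum_in => t _; apply: measurable_sum_in => t2 _.
  apply: measurable_funB; last exact: measurable_condE.
  by apply/measurable_EFinP; exact: measurable_int (jbil t t2).
have aeL t : \forall h \ae mu, condE mu (window t%:Z Sg.+1) (lagsum t) h =
    \sum_(maxn (t - l2) 1 <= t2 < (t - l1).+1)
       condE mu (window t%:Z Sg.+1) (bil t%:Z t2%:Z (A t t2)) h.
  apply: (ae_imply (condE_linear swap_mu
    (s := index_iota (maxn (t - l2) 1) (t - l1).+1) (window t%:Z Sg.+1) (fun=> 1)
    (f := fun t2 => bil t%:Z t2%:Z (A t t2)) (fun t2 _ => jbil t t2))) => h.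
  under eq_fun do under eq_bigr do rewrite mul1r.
  by under eq_bigr do rewrite mul1r.
apply: (ae_imply (ae_all_seq (s := index_iota (1 + l1) N.+1) (fun t _ => aeL t))).
move=> h hh; apply: eq_big_seq => t /hh ->.
by rewrite /lagsum -sumrB.
Qed.

(** The factor of the i-th coordinate of the process at time t in [lagsum]. *)
Definition lagfield (t : nat) (i : 'I_d) (h : traj H) : R :=
  \sum_(maxn (t - l2) 1 <= t2 < (t - l1).+1) lin t2%:Z (rowv (A t t2) i) h.

Let sqn t : R := \sum_(maxn (t - l2) 1 <= t2 < (t - l1).+1) nA t t2 ^+ 2.

Let sqn_ge0 t : 0 <= sqn t.
Proof. by apply: sumr_ge0 => *; exact: sqr_ge0. Qed.

Let KC := burkholder_cst M * C1.

Let KC_ge0 : 0 <= KC. Proof. by rewrite mulr_ge0 ?burkholder_cst_ge0. Qed.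

Let row_sq t i : R :=
  \sum_(maxn (t - l2) 1 <= t2 < (t - l1).+1) vnorm2 (rowv (A t t2) i) ^+ 2.

Let row_sq_ge0 t i : 0 <= row_sq t i.
Proof. by apply: sumr_ge0 => *; exact: sqr_ge0. Qed.

Let row_sq_sum t : \sum_i row_sq t i <= d%:R * sqn t.
Proof.
by rewrite exchange_big /= /sqn mulr_sumr; apply: ler_sum => t2 _.
Qed.

Lemma lagfield_bnd t i : bnd mu M (lagfield t i) (KC * Num.sqrt (row_sq t i)).
Proof. exact: lin_sum_bnd. Qed.

(** The rows of A contribute their squared norms, which add up to the squared
    Frobenius norm. *)
Lemma lagfield_norm_bnd t :
  bnd mu M (fun h => Num.sqrt (\sum_i lagfield t i h ^+ 2))
    (KC * Num.sqrt (d%:R * sqn t)).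
Proof.
apply: (@bnd_le _ _ _ _ _ _
    (Num.sqrt (\sum_i (KC * Num.sqrt (row_sq t i)) ^+ 2))); first exact: ltW.
  under eq_bigr do rewrite exprMn sqr_sqrtr//.
  rewrite -mulr_sumr sqrtrM ?sqr_ge0// sqrtr_sqr ger0_norm// ler_wpM2l//.
  by rewrite ler_wsqrtr.
by apply: bnd_norm2 => [|i _]; [exact: ltW|exact: lagfield_bnd].
Qed.

Lemma lagfield_measurable t i : measurable_fun setT (lagfield t i).
Proof. by case: (lagfield_bnd t i). Qed.

Lemma lagsumE t h : lagsum t h = \sum_i G t%:Z i h * lagfield t i h.
Proof.
rewrite /lagsum /bil exchange_big /=; apply: eq_bigr => i _.
by rewrite -mulr_sumr.
Qed.

(** The part of lag q of the conditional expectation of G t i given its last l1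
    innovations. *)
Definition proj_comp (q t : nat) (i : 'I_d) : traj H -> R :=
  projD mu (fwindow t%:Z l1 q) (t%:Z - q%:Z) (G t%:Z i).

Lemma proj_comp_measurable q t i : measurable_fun setT (proj_comp q t i).
Proof.
by apply: measurable_funB; apply: measurable_condE => //; exact: G_int.
Qed.

(** The telescoping sum ends at the empty set of times, where the conditional
    expectation is the mean, zero. *)
Lemma condE_fwindow_telescope t i h :
  condE mu (window t%:Z l1) (G t%:Z i) h = \sum_(0 <= q < l1) proj_comp q t i h.
Proof.
rewrite -[LHS]subr0 -[in X in _ - X](G_mean t%:Z i).
rewrite -(condE_set0 mu (G t%:Z i) h) -(fwindow_end t%:Z l1) -fwindow0.
rewrite -opprB -(telescope_sumr (fun q => condE mu (fwindow t%:Z l1 q) (G t%:Z i) h))//.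
by rewrite -sumrN; apply: eq_bigr => q _; rewrite opprB /proj_comp /projD fwindowS.
Qed.

Lemma proj_comp_dot_bnd q t (v : 'cV[R]_d) : (q < l1)%N ->
  bnd mu M (fun h => \sum_i v i 0 * proj_comp q t i h) (dlt q * vnorm2 v).
Proof.
move=> ql; set J := fwindow t%:Z l1 q.
have b := bnd_projD swap_mu M1 (fwindow_last t%:Z ql) (lin_bnd t%:Z v)
  (lin_diff t%:Z v q).
rewrite mulrC; apply: bnd_ae b.
  by apply: measurable_sum => i; apply: measurable_funM => //;
    exact: proj_comp_measurable.
have lE J' := condE_linear swap_mu (s := index_enum 'I_d) J' (fun i => v i 0)
  (f := fun i => G t%:Z i) (fun i _ => G_int t%:Z i).
apply: (ae_imply2 (lE J) (lE (J `\ (t%:Z - q%:Z)))) => h e1 e2.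
rewrite /projD e1 e2 -sumrB; apply: eq_bigr => i _.
by rewrite -mulrBr.
Qed.

Lemma lagfield_dep (t : nat) i (J : set int) : (l1 <= t)%N ->
  (forall (t2 : nat) j, (t2 <= t - l1)%N -> j <= t2%:Z -> J j) ->
  depends_on J (lagfield t i).
Proof.
move=> l1t hJ h h' hh; apply: eq_big_seq => t2 /lag_range[_ t2t _].
by apply: lin_dep => j /= jt2; apply: hh; exact: hJ t2t jt2.
Qed.

(** Here M itself, not M / 2, is the exponent on both sides: independence avoids
    Hoelder's inequality. *)
Lemma proj_lagfield_bnd q t : (q < l1)%N -> (l1 <= t)%N ->
  bnd mu M (fun h => \sum_i lagfield t i h * proj_comp q t i h)
    (dlt q * (KC * Num.sqrt (d%:R * sqn t))).
Proof.
move=> ql lt; apply: (bnd_independent_dot swap_mu (J := fwindow t%:Z l1 q) M0) => //.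
- by move=> i; exact: projD_depends.
- by move=> i; apply: lagfield_dep => // t2 j; exact: past_fwindow.
- by move=> i; exact: proj_comp_measurable.
- by move=> i; exact: lagfield_measurable.
- by move=> v; exact: proj_comp_dot_bnd.
- exact: lagfield_norm_bnd.
Qed.

(** Time t - q enters neither u nor [lagfield], whose times are at most t - l1. *)
Lemma proj_lagfield_orth q t i (u : traj H -> R) (K : R) : (q < l1)%N -> (l1 <= t)%N ->
  bnd mu (M / 2) u K -> depends_on [set~ t%:Z - q%:Z] u ->
  \int[mu]_h (spow (M / 2 - 1) (u h) * lagfield t i h * proj_comp q t i h) = 0 /\
  mu.-integrable setT (EFin \o (fun h =>
    spow (M / 2 - 1) (u h) * lagfield t i h * proj_comp q t i h)).
Proof.
move=> ql lt bu du.
have [mu_ _ _] := bu.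
have hM21 : 1 < M / 2 by move: M_gt; lra.
have bw := bnd_mul M0 (bnd_prod_fst mu (lagfield_bnd t i))
   (bnd_merge swap_mu (fwindow t%:Z l1 q) (G_bnd t%:Z i)).
have ji := bnd_spow_mul_integrable hM21 (bnd_prod_fst mu bu) bw.
apply: (Rintegral_mul_projD swap_mu (fwindow_last t%:Z ql) (G_int t%:Z i)
  (u := fun h => spow (M / 2 - 1) (u h) * lagfield t i h)).
- apply: measurable_funM; last exact: lagfield_measurable.
  by apply: measurableT_comp => //; exact: measurable_spow.
- move=> h h' hh; rewrite (du _ _ hh); congr (_ * _).
  apply: (@lagfield_dep t i [set~ t%:Z - q%:Z]) hh => // t2 j.
  exact: past_neq (leqnn t) lt ql.
- by move: ji; congr integrable; apply/funext => z /=; rewrite mulrA.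
Qed.

Let range := index_iota (1 + l1) N.+1.

Let range_l1 t : t \in range -> (l1 <= t)%N.
Proof. by rewrite mem_index_iota => /andP[+ _]; apply: leq_trans; exact: leq_addl. Qed.

(** Burkholder's inequality in increasing t, hence along the reversed list of
    times. *)
Lemma proj_lagfield_sum_bnd q : (q < l1)%N ->
  bnd mu (M / 2)
    (fun h => \sum_(t <- range) \sum_i lagfield t i h * proj_comp q t i h)
    (burkholder_cst (M / 2) *
     Num.sqrt (\sum_(t <- range) (dlt q * (KC * Num.sqrt (d%:R * sqn t))) ^+ 2)).
Proof.
move=> ql; pose X t h := \sum_i lagfield t i h * proj_comp q t i h.
have hM0' : 0 < M / 2 by move: M_gt; lra.
have hMM : M / 2 <= M by move: M_gt; lra.
have bX t : t \in range ->
    bnd mu (M / 2) (X t) (dlt q * (KC * Num.sqrt (d%:R * sqn t))).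
  by move=> /range_l1 l1t; apply: (bnd_mono hM0' hMM); exact: proj_lagfield_bnd.
(* [burkholder] adds terms from the right, so the times are listed in decreasing
   order. *)
under eq_fun do rewrite -(perm_big _ (permEl (perm_rev range))).
rewrite -(perm_big _ (permEl (perm_rev range))).
apply: (burkholder (D := X)) => //.
  by move=> t; rewrite mem_rev; exact: bX.
move=> s1 t s2 /[dup] rE /rev_iota_split[t_in s2P].
have l1t : (l1 <= t)%N by apply: range_l1; rewrite mem_index_iota.
pose u h := \sum_(t' <- s2) X t' h.
have bu : bnd mu (M / 2) u
    (\sum_(t' <- s2) dlt q * (KC * Num.sqrt (d%:R * sqn t'))).
  apply: bnd_sum => // t' ts2; apply: bX.
  have : t' \in rev range by rewrite rE mem_cat inE ts2 !orbT.
  by rewrite mem_rev.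
have du : depends_on [set~ t%:Z - q%:Z] u.
  move=> h h' hh; apply: eq_big_seq => t' /s2P[at' tt']; apply: eq_bigr => i _.
  have l1t' : (l1 <= t')%N by rewrite (leq_trans _ at')// leq_addl.
  congr (_ * _).
    apply: (@lagfield_dep t' i [set~ t%:Z - q%:Z]) hh => // t2 j.
    exact: past_neq (ltnW tt') l1t' ql.
  by apply: projD_depends => j jw; apply: hh; exact: fwindow_neq tt' jw.
have [e _] := Rintegral_sum0 (index_enum 'I_d)
  (fun i => proj_lagfield_orth i ql l1t bu du).
rewrite -[RHS]e; apply: eq_Rintegral => h _.
by rewrite mulr_sumr; apply: eq_bigr => i _; rewrite mulrA.
Qed.

(** Sum over the lags q < l1; the coefficients delta_q add up to at most C1. *)
Lemma main_term_bnd :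
  bnd mu (M / 2) (fun h => \sum_(t <- range)
      \sum_i lagfield t i h * condE mu (window t%:Z l1) (G t%:Z i) h)
    (burkholder_cst (M / 2) * C1 * (KC * Num.sqrt (d%:R * \sum_(t <- range) sqn t))).
Proof.
have -> : (fun h => \sum_(t <- range)
      \sum_i lagfield t i h * condE mu (window t%:Z l1) (G t%:Z i) h) =
    (fun h => \sum_(q <- index_iota 0 l1)
       \sum_(t <- range) \sum_i lagfield t i h * proj_comp q t i h).
  apply/funext => h; rewrite [RHS]exchange_big /=; apply: eq_bigr => t _.
  rewrite [RHS]exchange_big /=; apply: eq_bigr => i _.
  by rewrite condE_fwindow_telescope mulr_sumr.
apply: (@bnd_le _ _ _ _ _ _ (\sum_(q <- index_iota 0 l1) burkholder_cst (M / 2) *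
     Num.sqrt (\sum_(t <- range) (dlt q * (KC * Num.sqrt (d%:R * sqn t))) ^+ 2))) => //.
  rewrite -mulr_sumr -mulrA ler_wpM2l ?burkholder_cst_ge0//.
  apply: (@le_trans _ _ (\sum_(q <- index_iota 0 l1) dlt q *
      (KC * Num.sqrt (d%:R * \sum_(t <- range) sqn t)))).
    apply: ler_sum => q _.
    have ds0 t : 0 <= d%:R * sqn t by rewrite mulr_ge0 ?ler0n.
    under eq_bigr => t _ do rewrite !exprMn (sqr_sqrtr (ds0 t)).
    rewrite -!mulr_sumr sqrtrM ?sqr_ge0// sqrtr_sqr ger0_norm// ler_wpM2l//.
    by rewrite -exprMn sqrtrM ?sqr_ge0// sqrtr_sqr (ger0_norm KC_ge0).
  rewrite -mulr_suml ler_wpM2r ?mulr_ge0 ?sqrtr_ge0//.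
  by have := dlt_sum 0 l1; rewrite addr0 powR1 divr1.
apply: bnd_sum => // q; rewrite mem_index_iota => /andP[_].
exact: proj_lagfield_sum_bnd.
Qed.

Let Krem := burkholder_cst M * (C1 / (1 + l1%:R) `^ alpha).

Let Krem_ge0 : 0 <= Krem.
Proof. by rewrite mulr_ge0 ?burkholder_cst_ge0// divr_ge0 ?powR_ge0. Qed.

(** The bound for linear forms with a single term and a basis vector. *)
Lemma window_rem_bnd (t : nat) i :
  bnd mu M (fun h => G t%:Z i h - condE mu (window t%:Z l1) (G t%:Z i) h) Krem.
Proof.
have := lin_window_bnd t t.+1 l1 (fun=> delta_mx i 0).
rewrite big_nat1 vnorm2_delta expr1n sqrtr1 mulr1 -/Krem.
by under eq_fun do rewrite big_nat1 lin_delta.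
Qed.

Let KK_ge0 : 0 <= Krem * KC. Proof. exact: mulr_ge0 Krem_ge0 KC_ge0. Qed.

Let resid t h := \sum_i (G t%:Z i h - condE mu (window t%:Z l1) (G t%:Z i) h) *
  lagfield t i h.

(** No cancellation is used: Hoelder's inequality coordinate by coordinate, then
    Cauchy's inequality over the d coordinates. *)
Lemma resid_bnd t : bnd mu (M / 2) (resid t) (Krem * KC * (d%:R * Num.sqrt (sqn t))).
Proof.
apply: (@bnd_le _ _ _ _ _ _ (\sum_i Krem * (KC * Num.sqrt (row_sq t i)))) => //.
  rewrite -!mulr_sumr mulrA (ler_wpM2l KK_ge0)//.
  have := sqrt_sum_cauchy (index_enum 'I_d) (fun i => Num.sqrt (row_sq t i)).
  have -> : size (index_enum 'I_d) = d.
    by rewrite [index_enum _]unlock -enumT size_enum_ord.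
  under [X in _ * Num.sqrt X]eq_bigr do rewrite sqr_sqrtr//.
  move=> /le_trans; apply.
  apply: (@le_trans _ _ (Num.sqrt d%:R * Num.sqrt (d%:R * sqn t))).
    by rewrite ler_wpM2l ?sqrtr_ge0// ler_wsqrtr.
  by rewrite sqrtrM ?ler0n// mulrA -expr2 sqr_sqrtr ?ler0n.
apply: bnd_sum => // i _; apply: bnd_mul => //; first exact: window_rem_bnd.
exact: lagfield_bnd.
Qed.

(** The main term is centered, so the mean of [lagsum] is that of the residual. *)
Lemma main_term_mean t : (l1 <= t)%N ->
  \int[mu]_h (\sum_i lagfield t i h * condE mu (window t%:Z l1) (G t%:Z i) h) = 0 /\
  mu.-integrable setT (EFin \o (fun h =>
    \sum_i lagfield t i h * condE mu (window t%:Z l1) (G t%:Z i) h)).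
Proof.
move=> l1t; apply: Rintegral_sum0 => i.
have -> : (fun h => lagfield t i h * condE mu (window t%:Z l1) (G t%:Z i) h) =
    (fun h => \sum_(q < l1) lagfield t i h * proj_comp q t i h).
  by apply/funext => h; rewrite condE_fwindow_telescope big_mkord mulr_sumr.
apply: Rintegral_sum0 => q.
apply: (Rintegral_mul_projD swap_mu (fwindow_last t%:Z (ltn_ord q)) (G_int t%:Z i)).
- exact: lagfield_measurable.
- by apply: lagfield_dep => // t2 j; exact: past_neq (leqnn t) l1t (ltn_ord q).
- apply: (bnd_integrable hM1 (bnd_mul M0 (bnd_prod_fst mu (lagfield_bnd t i))
    (bnd_merge swap_mu (fwindow t%:Z l1 q) (G_bnd t%:Z i)))).
Qed.

(** The main term by Burkholder's inequality, the centered residual by the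
    triangle inequality; the factor 2 is the cost of centering. *)
Lemma lagsum_centered_bnd :
  bnd mu (M / 2)
    (fun h => \sum_(t <- range) (lagsum t h - \int[mu]_h lagsum t h))
    (burkholder_cst (M / 2) * C1 * (KC * Num.sqrt (d%:R * \sum_(t <- range) sqn t)) +
     2 * (Krem * KC * (d%:R * (Num.sqrt N%:R * Num.sqrt (\sum_(t <- range) sqn t))))).
Proof.
have hM1' : 1 < M / 2 by move: M_gt; lra.
have lE t h : lagsum t h =
    \sum_i lagfield t i h * condE mu (window t%:Z l1) (G t%:Z i) h + resid t h.
  rewrite lagsumE /resid -big_split; apply: eq_bigr => i _ /=; ring.
have mE t : t \in range -> \int[mu]_h lagsum t h = \int[mu]_h resid t h.
  move=> /range_l1 /main_term_mean[e ji].
  under eq_Rintegral do rewrite lE.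
  rewrite RintegralD// ?e ?add0r//.
  exact: bnd_integrable hM1 (resid_bnd t).
have -> : (fun h => \sum_(t <- range) (lagsum t h - \int[mu]_h lagsum t h)) =
    (fun h => \sum_(t <- range)
        \sum_i lagfield t i h * condE mu (window t%:Z l1) (G t%:Z i) h +
      \sum_(t <- range) (resid t h - \int[mu]_h resid t h)).
  apply/funext => h; rewrite -big_split; apply: eq_big_seq => t tr /=.
  by rewrite (mE t tr) lE addrA.
apply: bnd_add => //; first exact: main_term_bnd.
apply: (@bnd_le _ _ _ _ _ _ (\sum_(t <- range)
   (Krem * KC * (d%:R * Num.sqrt (sqn t)) + Krem * KC * (d%:R * Num.sqrt (sqn t))))) => //.
  rewrite big_split /= -mulr2n -[leLHS]mulr_natl ler_wpM2l// -!mulr_sumr.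
  rewrite (ler_wpM2l KK_ge0)// ler_wpM2l ?ler0n//.
  apply: (le_trans (sqrt_sum_cauchy _ _)).
  under [X in _ * Num.sqrt X]eq_bigr do rewrite sqr_sqrtr//.
  rewrite ler_wpM2r ?sqrtr_ge0// ler_wsqrtr// ler_nat size_iota.
  by rewrite add1n subSS leq_subr.
by apply: bnd_sum => // t _; apply: bnd_center => //; exact: resid_bnd.
Qed.

End quadratic.

End process.

(** * Frobenius norm and largest singular value *)

Section spectrum.
Import complex spectral sesquilinear.

(** By complexification: over the complex numbers B is hermitian, hence unitarily
    diagonalizable with a real spectrum. *)
Lemma symmetric_spectrum (R : realType) (d : nat) (B : 'M[R]_d) : B^T = B ->
  exists lam : 'I_d -> R,
    [/\ forall i, eigenvalue B (lam i), \tr B = \sum_i lam i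
      & forall a, eigenvalue B a -> exists i, a = lam i].
Proof.
move=> Bsym; pose f : {rmorphism R -> R[i]} := real_complex R.
pose BC := map_mx f B.
have BCsym : BC \is symmetricmx.
  by apply/is_hermitianmxP; rewrite /= expr0 scale1r map_mx_id// /BC map_trmx Bsym.
have BCreal : BC \is a mxOver Num.real.
  by apply/mxOverP => i j; rewrite mxE; apply/complex_realP; exists (B i j).
have BCherm := realsym_hermsym BCsym BCreal.
have /orthomx_spectralP BE := hermitian_normalmx BCherm.
have spR := hermitian_spectral_diag_real BCherm.
have Pu := spectral_unit BC.
set P := spectralmx BC in BE Pu; set sp := spectral_diag BC in BE spR.
have lamP i : exists k, sp 0 i = f k.
  by have /mxOverP/(_ 0 i)/complex_realP[k ->] := spR; exists k.
have [lam lamE] := choice lamP.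
have PB : P *m BC = diag_mx sp *m P by rewrite [X in _ *m X]BE -mulmxA mulKVmx.
exists lam; split.
- move=> i; rewrite eigenvalue_root_char -(fmorph_root f) map_char_poly -/BC.
  rewrite -eigenvalue_root_char; apply/eigenvalueP; exists (row i P).
    by rewrite -row_mul PB mul_diag_mx; apply/rowP => j; rewrite !mxE lamE.
  apply/eqP => /(congr1 (mulmx^~ (invmx P))).
  rewrite -row_mul mulmxV// mul0mx row1 => /rowP/(_ i)/eqP.
  by rewrite !mxE !eqxx oner_eq0.
- apply: (fmorph_inj f); rewrite -trace_map_mx -/BC BE mxtrace_mulC mulmxA mulmxV//.
  by rewrite mul1mx mxtrace_diag rmorph_sum; apply: eq_bigr => i _; rewrite lamE.
- move=> a /eigenvalueP[v vB v0].
  pose w := map_mx f v *m invmx P.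
  have wD : w *m diag_mx sp = f a *: w.
    have -> : diag_mx sp = P *m BC *m invmx P by rewrite PB mulmxK.
    rewrite !mulmxA mulmxKV// -map_mxM vB map_mxZ -scalemxAl//.
  have w0 : w != 0.
    apply: contraNneq v0 => /(congr1 (mulmx^~ P)); rewrite mulmxKV// mul0mx.
    by move=> /eqP; rewrite map_mx_eq0.
  have [i wi] := rV0Pn _ w0.
  exists i; have /rowP/(_ i) := wD; rewrite mul_mx_diag mxE [in RHS]mxE lamE mulrC.
  by move=> /(mulIf wi) /(fmorph_inj f) ->.
Qed.

End spectrum.

Section frobenius.
Context (R : realType) (d : nat).
Implicit Types (A : 'M[R]_d).

Lemma gram_trace A : \tr (A^T *m A) = \sum_i vnorm2 (rowv A i) ^+ 2.
Proof.
rewrite /mxtrace; under eq_bigr do rewrite mxE.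
rewrite exchange_big; apply: eq_bigr => i _ /=; rewrite vnorm2_sqr.
by apply: eq_bigr => j _; rewrite rowvE mxE expr2.
Qed.

(** If v A' A = a v then the squared norm of v A' is a times that of v. *)
Lemma gram_eigenvalue_ge0 A a : eigenvalue (A^T *m A) a -> 0 <= a.
Proof.
move=> /eigenvalueP[v vB v0].
have sq (u : 'rV[R]_d) : (u *m u^T) 0 0 = \sum_i u 0 i ^+ 2.
  by rewrite mxE; apply: eq_bigr => i _; rewrite mxE expr2.
have v_gt0 : 0 < (v *m v^T) 0 0.
  rewrite sq lt_neqAle; apply/andP; split; last first.
    by apply: sumr_ge0 => i _; exact: sqr_ge0.
  apply: contraNneq v0 => /esym/psumr_eq0P h.
  apply/eqP/rowP => i; apply/eqP; rewrite mxE -sqrf_eq0 h// => j _; exact: sqr_ge0.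
have : 0 <= ((v *m A^T) *m (v *m A^T)^T) 0 0.
  by rewrite sq; apply: sumr_ge0 => i _; exact: sqr_ge0.
rewrite trmx_mul trmxK mulmxA -(mulmxA v) vB -scalemxAl mxE.
by rewrite pmulr_lge0.
Qed.

(** The squared Frobenius norm is the trace of A' A, the sum of d eigenvalues,
    and the root of each is a singular value.  For d = 0 there is none, and the
    supremum of the empty set is 0. *)
Lemma mnorm2_frobenius A :
  0 <= mnorm2 A /\ \sum_i vnorm2 (rowv A i) ^+ 2 <= d%:R * mnorm2 A ^+ 2.
Proof.
have [lam [lamE trE lamA]] : exists lam : 'I_d -> R, [/\
    forall i, eigenvalue (A^T *m A) (lam i), \tr (A^T *m A) = \sum_i lam i
      & forall a, eigenvalue (A^T *m A) a -> exists i, a = lam i].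
  by apply: symmetric_spectrum; rewrite trmx_mul trmxK.
have lam0 i : 0 <= lam i by apply: gram_eigenvalue_ge0.
have sv i : singular_value A (Num.sqrt (lam i)).
  by split; rewrite ?sqrtr_ge0// sqr_sqrtr.
have ub : has_ubound [set s | singular_value A s].
  (* s <= 1 + s^2 bounds a singular value by the trace. *)
  exists (1 + \sum_i lam i) => s [s0 /lamA[i e]].
  have : s ^+ 2 <= \sum_i lam i.
    by rewrite e (bigD1 i)//= lerDl sumr_ge0.
  by have := sqr_ge0 (s - 1); nra.
have m0 : 0 <= mnorm2 A.
  have [[s sA]|none] := pselect ([set s | singular_value A s] !=set0).
    by apply: le_trans (ub_le_sup ub sA); case: sA.
  rewrite /mnorm2 sup_out// => -[[s sA] _]; apply: none; exists s; exact: sA.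
split=> //; rewrite -gram_trace trE.
apply: (@le_trans _ _ (\sum_(i < d) mnorm2 A ^+ 2)).
  apply: ler_sum => i _; rewrite -[lam i]sqr_sqrtr//.
  by rewrite lerXn2r ?nnegrE ?sqrtr_ge0//; exact: (ub_le_sup ub (sv i)).
by rewrite sumr_const card_ord -[leLHS]mulr_natl.
Qed.

End frobenius.

(** * Law of the path of innovations *)

Section cylinders.
Context (dH : measure_display) (H : measurableType dH) (R : realType).

(** A rectangle in the product of two path spaces.  One finite set of times serves
    both paths, which loses nothing since B and B' may be full. *)
Definition cylinder (J : {fset int}) (B B' : int -> set H) : set (traj H * traj H) :=
  [set z | forall j, j \in J -> B j (z.1 j) /\ B' j (z.2 j)].

Definition box (J : {fset int}) (B : int -> set H) : set (traj H) :=
  [set h | forall j, j \in J -> B j (h j)].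

Let cylinders : set (set (traj H * traj H)) :=
  [set A | exists J B B', [/\ forall j, measurable (B j),
     forall j, measurable (B' j) & A = cylinder J B B']].

Lemma boxE J B : box J B = \bigcap_(j in [set` J]) ((fun h : traj H => h j) @^-1` B j).
Proof. by apply/seteqP; split=> h /= hJ j; exact: hJ. Qed.

Lemma measurable_box J B : (forall j, measurable (B j)) -> measurable (box J B).
Proof.
move=> mB; rewrite boxE; apply: fin_bigcap_measurable; first exact: finite_fset.
move=> j _; rewrite -[X in measurable X]setTI; exact: measurable_coord.
Qed.

Lemma cylinderE J B B' : cylinder J B B' = box J B `*` box J B'.
Proof.
by apply/seteqP; split=> z /=; [move=> h; split=> j /h[]|move=> [h h'] j jJ; split;
  [exact: h|exact: h']].
Qed.

Lemma measurable_cylinder J B B' : (forall j, measurable (B j)) ->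
  (forall j, measurable (B' j)) -> measurable (cylinder J B B').
Proof. by move=> mB mB'; rewrite cylinderE; apply: measurableX; exact: measurable_box. Qed.

Let cylinders_setI : setI_closed cylinders.
Proof.
move=> _ _ [J1 [B1 [B1' [mB1 mB1' ->]]]] [J2 [B2 [B2' [mB2 mB2' ->]]]].
pose mix (B1 B2 : int -> set H) j :=
  (if j \in J1 then B1 j else setT) `&` (if j \in J2 then B2 j else setT).
have mmix (C1 C2 : int -> set H) j : (forall j, measurable (C1 j)) ->
    (forall j, measurable (C2 j)) -> measurable (mix C1 C2 j).
  by move=> m1 m2; apply: measurableI; case: ifP.
exists (J1 `|` J2)%fset, (mix B1 B2), (mix B1' B2'); split.
- by move=> j; exact: mmix.
- by move=> j; exact: mmix.
apply/seteqP; split=> z /=.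
  move=> [h1 h2] j _; rewrite /mix; split; split.
  - by case: ifP => // /h1[].
  - by case: ifP => // /h2[].
  - by case: ifP => // /h1[].
  - by case: ifP => // /h2[].
move=> h; split=> j jJ.
  have [] := h j; first by rewrite in_fsetU jJ.
  by rewrite /mix jJ => -[? _] [? _].
have [] := h j; first by rewrite in_fsetU jJ orbT.
by rewrite /mix jJ => -[_ ?] [_ ?].
Qed.

(** Cylinders are stable under intersection and generate the product
    sigma-algebra. *)
Lemma measure_cylinder_unique (m1 m2 : {measure set (traj H * traj H) -> \bar R}) :
  (m1 setT < +oo)%E ->
  (forall J B B', (forall j, measurable (B j)) -> (forall j, measurable (B' j)) ->
    m1 (cylinder J B B') = m2 (cylinder J B B')) ->
  forall A, measurable A -> m1 A = m2 A.
Proof.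
move=> m1T m12.
have cT : cylinders setT.
  exists fset0, (fun=> setT), (fun=> setT); split=> //.
  by apply/seteqP; split.
apply: (measure_unique cylinders (fun=> setT)) => //.
- apply/seteqP; split; last first.
    apply: smallest_sub; first exact: sigma_algebra_measurable.
    by move=> _ [J [B [B' [mB mB' ->]]]]; exact: measurable_cylinder.
  have mid : measurable_fun [set: g_sigma_algebraType cylinders]
      (fun z => (z.1, z.2) : traj H * traj H).
    apply: measurable_fun_pair; apply: measurable_traj => k _ B mB; rewrite setTI;
      apply: sub_sigma_algebra.
      exists [fset k]%fset, (fun=> B), (fun=> setT); split=> //.
      apply/seteqP; split=> z /= h; last by have [] := h k; rewrite ?inE.
      by move=> j; rewrite inE => /eqP ->.
    exists [fset k]%fset, (fun=> setT), (fun=> B); split=> //.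
    apply/seteqP; split=> z /= h; last by have [] := h k; rewrite ?inE.
    by move=> j; rewrite inE => /eqP ->.
  move=> A mA; have := mid measurableT A mA; rewrite setTI.
  by congr (<<s cylinders >> _); apply/seteqP; split=> -[].
- by rewrite bigcup_const//; exists 0%N.
- by move=> _ [J [B [B' [mB mB' ->]]]]; exact: m12.
Qed.

End cylinders.

Section law.
Context (dO dH : measure_display) (Omega : measurableType dO)
  (H : measurableType dH) (R : realType) (P : probability Omega R).
Implicit Types e edag : int -> {RV P >-> H}.

Definition path e (w : Omega) : traj H := fun j => e j w.

Lemma measurable_path e : measurable_fun setT (path e).
Proof. by apply: measurable_traj => k; exact: measurable_funP. Qed.

HB.instance Definition _ e :=
  isMeasurableFun.Build _ _ Omega (traj H) (path e) (measurable_path e).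

Definition path_law e : probability (traj H) R := distribution P (path e).

Lemma path_law_box e J B : mutually_independent e -> (forall j, measurable (B j)) ->
  path_law e (box J B) = (\prod_(j <- J) P (e j @^-1` B j))%E.
Proof.
by move=> ie mB; rewrite -ie//; congr (P _).
Qed.

Lemma path_law_cylinder e J B B' : mutually_independent e ->
  (forall j, measurable (B j)) -> (forall j, measurable (B' j)) ->
  (path_law e \x path_law e)%E (cylinder J B B') =
  (\prod_(j <- J) (P (e j @^-1` B j) * P (e j @^-1` B' j)))%E.
Proof.
move=> ie mB mB'; rewrite cylinderE product_measure1E; [|exact: measurable_box..].
rewrite big_split; congr (_ * _)%E; exact: path_law_box.
Qed.

(** On cylinders, exchanging coordinates permutes the factors of a product, since
    both paths have the same independent marginals. *)
Lemma path_law_swap e : mutually_independent e ->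
  forall K (A : set (traj H * traj H)), measurable A ->
  (path_law e \x path_law e)%E (swap K @^-1` A) = (path_law e \x path_law e)%E A.
Proof.
move=> ie K A mA.
pose m : {measure set (traj H * traj H) -> \bar R} := (path_law e \x path_law e)%E.
pose m' : {measure set (traj H * traj H) -> \bar R} := pushforward m (swap K).
apply/esym; apply: (@measure_cylinder_unique _ H R m (m' (measurable_swap K))) => //.
  by rewrite (le_lt_trans (probability_le1 (path_law e \x path_law e)%E measurableT)) ?ltry.
move=> J B B' mB mB'.
pose C j := if `[< K j >] then B j else B' j.
pose C' j := if `[< K j >] then B' j else B j.
have mC j : measurable (C j) by rewrite /C; case: ifP.
have mC' j : measurable (C' j) by rewrite /C'; case: ifP.
have E : swap K @^-1` cylinder J B B' = cylinder J C C'.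
  apply/seteqP; split=> z /= h j /h; rewrite /C /C' /swap /merge /=;
    by case: ifP => _ [].
transitivity (m (cylinder J C C')); last by rewrite -E.
rewrite /m /= !path_law_cylinder//; apply: eq_bigr => j _.
by rewrite /C /C'; case: ifP => // _; rewrite muleC.
Qed.

(** The pair formed by the innovations and their independent copy has law
    [mu \x mu]; on cylinders this is a product formula. *)
Lemma joint_law e edag : mutually_independent e -> independent_copy e edag ->
  forall A : set (traj H * traj H), measurable A ->
  P ((fun w => (path e w, path edag w)) @^-1` A) = (path_law e \x path_law e)%E A.
Proof.
move=> ie [id de ind] A mA.
have mp : measurable_fun setT (fun w => (path e w, path edag w)).
  by apply: measurable_fun_pair; exact: measurable_path.
pose m : {measure set (traj H * traj H) -> \bar R} := (path_law e \x path_law e)%E.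
pose m' : {measure set (traj H * traj H) -> \bar R} :=
  pushforward P (fun w => (path e w, path edag w)).
apply/esym; apply: (@measure_cylinder_unique _ H R m (m' mp)) => //.
  by rewrite (le_lt_trans (probability_le1 (path_law e \x path_law e)%E measurableT)) ?ltry.
move=> J B B' mB mB'.
transitivity (\prod_(j <- J) (P (e j @^-1` B j) * P (e j @^-1` B' j)))%E.
  exact: path_law_cylinder.
have sf e' : measurable_fun [set: g_sigma_algebraType
    (\bigcup_(t in setT) preimage_set_system [set: Omega] (e' t) measurable)]
    (path e' : _ -> traj H).
  apply: measurable_traj => k _ C mC; apply: sub_sigma_algebra; exists k => //.
  by exists C.
transitivity (P ((path e @^-1` box J B) `&` (path edag @^-1` box J B'))); last first.
  by rewrite cylinderE.
rewrite ind.
- rewrite big_split; congr (_ * _)%E; first exact: esym (path_law_box _ ie mB).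
  rewrite -[RHS]/(path_law edag (box J B')) path_law_box//.
  by apply: eq_bigr => j _; rewrite -[LHS]/(distribution P (e j) (B' j)) -de.
- by have := sf e measurableT _ (measurable_box J mB); rewrite setTI.
- by have := sf edag measurableT _ (measurable_box J mB'); rewrite setTI.
Qed.

Lemma bnd_path e p (F : traj H -> R) K : measurable_fun setT F ->
  bnd (path_law e) p F K <-> bnd P p (fun w => F (path e w)) K.
Proof.
move=> mF.
have mFp : measurable_fun setT (fun h => (`|F h| `^ p)%:E).
  by apply/measurable_EFinP; exact: measurable_normpow.
have E : (\int[path_law e]_h (`|F h| `^ p)%:E =
    \int[P]_w (`|F (path e w)| `^ p)%:E)%E.
  by rewrite ge0_integral_distribution.
split=> -[_ K0 h]; split=> //.
- by apply: (measurableT_comp mF); exact: measurable_path.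
- by rewrite -E.
- by rewrite E.
Qed.

Lemma bnd_joint e edag p (F : traj H * traj H -> R) K :
  mutually_independent e -> independent_copy e edag -> measurable_fun setT F ->
  bnd P p (fun w => F (path e w, path edag w)) K ->
  bnd (path_law e \x path_law e)%E p F K.
Proof.
move=> ie ied mF [_ K0 h]; split=> //; apply: le_trans h.
have mp : measurable_fun setT (fun w => (path e w, path edag w)).
  by apply: measurable_fun_pair; exact: measurable_path.
have mFp : measurable_fun setT (fun h => (`|F h| `^ p)%:E).
  by apply/measurable_EFinP; exact: measurable_normpow.
have := @ge0_integral_pushforward _ _ _ _ R _ mp P setT _ measurableT mFp.
rewrite preimage_setT => <-//.
rewrite le_eqVlt; apply/orP; left; apply/eqP.
by apply: eq_measure_integral => A mA _; apply/esym; exact: joint_law.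
Qed.

End law.

(** * Versions of conditional expectations *)

Section conditional_versions.
Context (dO dH : measure_display) (Omega : measurableType dO)
  (H : measurableType dH) (R : realType) (P : probability Omega R).
Variable e : int -> {RV P >-> H}.
Hypothesis e_indep : mutually_independent e.
Let mu := path_law e.
Let swap_mu := path_law_swap e_indep.
Implicit Types (J : set int) (f : traj H -> R).

Lemma sigma_field_measurable J A : sigma_field e J A -> measurable A.
Proof.
apply: smallest_sub; first exact: sigma_algebra_measurable.
move=> _ [t _ [B mB <-]]; exact: measurable_funP.
Qed.

(** An event that depends on the coordinates in J is unchanged when the others are
    set to a constant, and the path modified in this way is measurable for the
    sigma-field of J. *)
Lemma sigma_field_path J (B : set (traj H)) : measurable B ->
  depends_on J (B : (int -> H) -> Prop) -> sigma_field e J (path e @^-1` B).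
Proof.
move=> mB JB; pose h0 : traj H := fun=> point.
pose F (w : g_sigma_algebraType (\bigcup_(t in J)
    preimage_set_system [set: Omega] (e t) measurable)) : traj H :=
  merge J (path e w) h0.
have mF : measurable_fun setT F.
  apply: measurable_traj => k; rewrite /F /merge; case: asboolP => // Jk _ C mC.
  by apply: sub_sigma_algebra; exists k => //; exists C.
have -> : path e @^-1` B = F @^-1` B.
  by apply/funext => w; rewrite /preimage /mkset /F (depends_on_merge _ _ JB).
by have := mF measurableT B mB; rewrite setTI.
Qed.

(** Sets of this form are a sigma-algebra that contains the generators. *)
Lemma sigma_field_pathE J A : sigma_field e J A ->
  exists B : set (traj H), [/\ measurable B, depends_on J (B : (int -> H) -> Prop)
    & A = path e @^-1` B].
Proof.
move: A; apply: smallest_sub.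
  split.
  - exists set0; split=> //; by rewrite preimage_set0.
  - move=> A [B [mB JB ->]]; exists (~` B); split; first exact: measurableC.
      by move=> h h' hh; rewrite /setC /mkset (JB _ _ hh).
    by rewrite setTD preimage_setC.
  - move=> A hA; have [B hB] := choice hA.
    exists (\bigcup_n B n); split.
    + by apply: bigcup_measurable => n _; have [] := hB n.
    + move=> h h' hh; have E n : B n h = B n h' by have [_ JB _] := hB n; exact: JB.
      by apply/propext; split=> -[n _]; [rewrite E|rewrite -E] => Bn; exists n.
    + by rewrite preimage_bigcup; apply: eq_bigcupr => n _; have [] := hB n.
move=> _ [t Jt [B mB <-]].
exists [set h : traj H | B (h t)]; split.
- by rewrite -[X in measurable X]setTI; exact: measurable_coord.
- by move=> h h' hh; rewrite /mkset (hh t Jt).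
- by rewrite setTI.
Qed.

Lemma integrable_condE J f : mu.-integrable setT (EFin \o f) ->
  mu.-integrable setT (EFin \o condE mu J f).
Proof.
move=> jf; have [|_ ] := Rintegral_mul_condE swap_mu (J := J) jf (measurable_cst (1 : R)).
  by under eq_fun do rewrite mul1r; exact: (integrable_merge swap_mu).
by under eq_fun do rewrite mul1r.
Qed.

Lemma integrable_path f : mu.-integrable setT (EFin \o f) ->
  P.-integrable setT (fun w => (f (path e w))%:E).
Proof.
move=> /integrableP[mf jf]; apply/integrableP; split.
  exact: (measurableT_comp mf (measurable_path e)).
have := @ge0_integral_distribution _ _ _ _ _ P (path e) (fun h => `|(f h)%:E|%E).
by move=> <- //; exact: measurableT_comp.
Qed.

(** The indicator of an event of J is unaffected by resampling outside J, so that
    both integrals agree by Fubini's theorem and invariance under exchange. *)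
Lemma integral_condE_path J f A : mu.-integrable setT (EFin \o f) ->
  sigma_field e J A ->
  (\int[P]_(w in A) (condE mu J f (path e w))%:E = \int[P]_(w in A) (f (path e w))%:E)%E.
Proof.
move=> jf /sigma_field_pathE[B [mB JB ->]].
have mf : measurable_fun setT f by apply/measurable_EFinP; exact: measurable_int jf.
have toB (g : traj H -> R) : mu.-integrable setT (EFin \o g) ->
    (\int[P]_(w in path e @^-1` B) (g (path e w))%:E =
     \int[mu]_h (\1_B h * g h)%:E)%E.
  move=> jg; have mg : measurable_fun setT g.
    by apply/measurable_EFinP; exact: measurable_int jg.
  have jBg : mu.-integrable setT (EFin \o (fun h => \1_B h * g h)).
    apply: (integrable_le_real (g := fun h => `|g h|)).
    - by apply: measurable_funM => //; exact: measurable_indic.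
    - move=> h; rewrite normrM ler_piMl// indicE.
      by case: (_ \in _); rewrite ?normr1 ?normr0.
    - exact: integrable_norm.
  have jP := integrable_path jBg.
  have mBg := measurable_int _ jBg.
  rewrite (@integral_distribution _ _ _ _ _ P (path e)
    (fun h => (\1_B h * g h)%:E))//.
  rewrite integral_mkcond; apply: eq_integral => w _.
  rewrite /patch /= indicE -[w \in _]/(path e w \in B).
  by case: (_ \in _); rewrite ?mul1r ?mul0r.
have mI : measurable_fun setT (\1_B : traj H -> R) by exact: measurable_indic.
have jBm : (mu \x mu)%E.-integrable setT
    (EFin \o (fun z : traj H * traj H => \1_B z.1 * f (merge J z.1 z.2))).
  apply: (integrable_le_real (P := (mu \x mu)%E)
    (g := fun z : traj H * traj H => `|f (merge J z.1 z.2)|)).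
  - apply: measurable_funM.
      by apply: (measurableT_comp mI); exact: measurable_fst.
    by apply: (measurableT_comp mf); exact: measurable_merge.
  - move=> z; rewrite normrM ler_piMl// indicE.
    by case: (_ \in _); rewrite ?normr1 ?normr0.
  - by apply: integrable_norm => //; exact: (integrable_merge swap_mu).
have [E jE] := Rintegral_mul_condE swap_mu jf mI jBm.
have jc := integrable_condE J jf.
rewrite !toB//.
have jBf : mu.-integrable setT (EFin \o (fun h => \1_B h * f h)).
  apply: (integrable_le_real (g := fun h => `|f h|)).
  - exact: measurable_funM.
  - move=> h; rewrite normrM ler_piMl// indicE.
    by case: (_ \in _); rewrite ?normr1 ?normr0.
  - exact: integrable_norm.
have E2 : \int[mu]_h (\1_B h * condE mu J f h) = \int[mu]_h (\1_B h * f h).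
  rewrite E -(Rintegral_prod_fst mu jBf).
  rewrite -(Rintegral_swap swap_mu J (integrable_prod_fst mu jBf)).
  apply: eq_Rintegral => z _ /=; congr (_ * _).
  have IB : depends_on J (\1_B : traj H -> R).
    move=> h h' hh; rewrite !indicE; congr (_%:R); congr nat_of_bool.
    have eB : B h = B h' by exact: JB.
    by apply/idP/idP => /set_mem x; apply/mem_set; [rewrite -eB|rewrite eB].
  by rewrite (depends_on_merge _ _ IB).
have f1 := integrable_fin_num measurableT jE.
have f2 := integrable_fin_num measurableT jBf.
by rewrite -(fineK f1) -(fineK f2); congr EFin; exact: E2.
Qed.

(** Both functions are measurable for the sigma-field of J and have the same
    integral over each of its sets; uniqueness is applied to the restriction of P to
    that sigma-field. *)
Lemma cond_exp_version_condE J f Y : mu.-integrable setT (EFin \o f) ->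
  cond_exp_version P (sigma_field e J) (fun w => f (path e w)) Y ->
  \forall w \ae P, condE mu J f (path e w) = Y w.
Proof.
move=> jf [GY iY eY].
have mf : measurable_fun setT f by apply/measurable_EFinP; exact: measurable_int jf.
(* OG is Omega with the sigma-field of J, and PG the restriction of P to it. *)
pose OG : measurableType _ := g_sigma_algebraType (\bigcup_(t in J)
    preimage_set_system [set: Omega] (e t) measurable).
pose i : Omega -> OG := id.
have mi : measurable_fun setT i.
  by move=> _ A GA; rewrite setTI; exact: sigma_field_measurable GA.
have mYG : measurable_fun [set: OG] Y by move=> _ B mB; rewrite setTI; exact: GY.
have mZG : measurable_fun [set: OG] (fun w => condE mu J f (path e w)).
  move=> _ B mB; rewrite setTI.
  apply: (@sigma_field_path J (condE mu J f @^-1` B)).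
    by rewrite -[X in measurable X]setTI; exact: (measurable_condE swap_mu J jf).
  by move=> h h' hh; rewrite /preimage /mkset (@condE_depends _ _ _ mu J f h h' hh).
pose PG : {measure set OG -> \bar R} := pushforward P i.
have PGint (X : Omega -> R) : measurable_fun [set: OG] X ->
    P.-integrable setT (EFin \o X) -> (PG mi).-integrable setT (EFin \o X).
  move=> mX jX; apply: integrable_pushforward => //; exact/measurable_EFinP.
have jZ := integrable_path (integrable_condE J jf).
have ae := @integral_ae_eq _ OG R (PG mi) setT measurableT (EFin \o Y)
  (EFin \o (fun w => condE mu J f (path e w))) (PGint _ mZG jZ).
have [||N [mN N0 hN]] := ae.
- exact/measurable_EFinP.
- move=> A _ GA.
  have mA : @measurable _ Omega A by exact: sigma_field_measurable GA.
  have PGA (X : Omega -> R) : measurable_fun [set: OG] X ->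
      P.-integrable setT (EFin \o X) ->
      (\int[PG mi]_(w in A) (EFin \o X) w = \int[P]_(w in A) (EFin \o X) w)%E.
    move=> mX jX; rewrite integral_pushforward//.
    - exact/measurable_EFinP.
    - by apply: integrableS jX.
  rewrite (PGA _ mZG jZ) (PGA _ mYG iY).
  by rewrite /= integral_condE_path// eY.
exists N; split => //; first by have := mi measurableT N mN; rewrite setTI.
by move=> w /= hw; apply: hN => /= h; apply: hw; have [] := h I.
Qed.

End conditional_versions.

(** * The process at a fixed sample size *)

Lemma past_shift (t : int) (k : nat) : t - k%:Z <= t.
Proof. by lia. Qed.

Lemma coupled_index (t : int) (k q : nat) : (k == q) = (t - k%:Z == t - q%:Z).
Proof. by apply/idP/idP => /eqP h; apply/eqP; lia. Qed.

Lemma F_window (dO dH : measure_display) (Omega : measurableType dO)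
  (H : measurableType dH) (R : realType) (P : probability Omega R)
  (e : int -> {RV P >-> H}) t s : F_ e t s = sigma_field e (window t s.+1).
Proof.
congr sigma_field; apply/funext => u; rewrite /window /=; apply/propext; split; lia.
Qed.

Lemma vnorm2_scale (R : realType) (d : nat) c (a : 'cV[R]_d) :
  vnorm2 (c *: a) = `|c| * vnorm2 a.
Proof.
rewrite /vnorm2 -sqrtr_sqr -sqrtrM ?sqr_ge0// mulr_sumr; congr Num.sqrt.
by apply: eq_bigr => i _; rewrite mxE exprMn.
Qed.

Lemma vnorm2_eq0 (R : realType) (d : nat) (a : 'cV[R]_d) :
  vnorm2 a = 0 -> forall i, a i 0 = 0.
Proof.
move=> a0 i; have := vnorm2_sqr a; rewrite a0 expr0n /= => /esym/psumr_eq0P h.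
by apply/eqP; rewrite -sqrf_eq0 h// => j _; exact: sqr_ge0.
Qed.

Section fixed_sample.
Context (dO dH : measure_display) (Omega : measurableType dO)
  (H : measurableType dH) (R : realType) (P : probability Omega R).
Variables e edag : int -> {RV P >-> H}.
Hypothesis e_indep : mutually_independent e.
Hypothesis e_copy : independent_copy e edag.
Let mu := path_law e.
Let swap_mu := path_law_swap e_indep.
Variables (d : nat) (g : int -> (nat -> H) -> 'cV[R]_d).
Hypothesis g_measurable : forall t, seq_measurable (g t).

Definition coord t i (h : traj H) : R := g t (fun k => h (t - k%:Z)) i 0.

Lemma measurable_coord_process t i : measurable_fun setT (coord t i).
Proof.
pose C := \bigcup_(k in [set: nat])
  preimage_set_system [set: nat -> H] (fun h => h k) measurable.
pose F : traj H -> g_sigma_algebraType C := fun h k => h (t - k%:Z).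
suff mF : measurable_fun setT F by exact: (measurableT_comp (g_measurable t i) mF).
apply: (@measurability _ _ (traj H) (g_sigma_algebraType C) setT F C) => //.
move=> _ [_ [k _ [B mB <-]] <-]; rewrite setTI.
by have := measurable_coord (t - k%:Z) measurableT mB; rewrite !setTI.
Qed.

Lemma coord_depends t i : depends_on [set j | j <= t] (coord t i).
Proof.
move=> h h' hh; rewrite /coord; congr (g _ _ _ _); apply/funext => k.
by apply: hh; exact: past_shift.
Qed.

Lemma measurable_lin t a : measurable_fun setT (lin coord t a).
Proof.
rewrite /lin; apply: measurable_sum_in => i _.
by apply: measurable_funM => //; exact: measurable_coord_process.
Qed.

Lemma dotp_process a t w : dotp a (process g e t w) = lin coord t a (path e w).
Proof. by rewrite /dotp mxE; apply: eq_bigr => i _; rewrite mxE. Qed.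

Lemma dotp_coupled a t q w :
  dotp a (process g e t w - coupled_process g e edag t q w) =
  lin coord t a (path e w) -
  lin coord t a (merge [set~ t - q%:Z] (path e w) (path edag w)).
Proof.
rewrite /dotp mxE /lin -sumrB; apply: eq_bigr => i _.
rewrite !mxE -mulrBr; congr (_ * (_ - _)).
rewrite /coupled_process /coord; congr (g _ _ _ _); apply/funext => k.
rewrite /merge (coupled_index t); case: eqP => [->|kq]; first by rewrite asboolF//; exact.
by rewrite asboolT.
Qed.

Lemma bilin_process A t1 t2 w :
  bilin (process g e t1 w) A (process g e t2 w) = bil coord t1 t2 A (path e w).
Proof.
rewrite /bilin -mulmxA mxE; apply: eq_bigr => i _; rewrite mxE; congr (_ * _).
by rewrite mxE; apply: eq_bigr => j _; rewrite rowvE.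
Qed.

Variables (M alpha C : R).
Hypothesis M_gt : 8 < M.
Hypothesis C_ge0 : 0 <= C.
Hypothesis z_mean : forall t (i : 'I_d),
  ('E_P[fun w => process g e t w i 0%R] = 0)%E.
Hypothesis z_bnd : (ereal_sup
  [set rvnorm P M (fun w => dotp ta.2 (process g e ta.1 w))
    | ta in [set ta : int * 'cV[R]_d | vnorm2 ta.2 = 1%R]] <= C%:E)%E.
Hypothesis delta_bnd : (ereal_sup
  [set (((1 + s%:R) `^ alpha)%:E * \sum_(s <= q <oo) delta g e edag M q)%E
    | s in [set: nat]] <= C%:E)%E.

Let M0 : 0 < M. Proof. by move: M_gt; lra. Qed.
Let half_gt0 : 0 < M / 2. Proof. by move: M_gt; lra. Qed.
Let M1 : 1 <= M. Proof. by move: M_gt; lra. Qed.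

(** The suprema of the dependence condition range over unit vectors; bounds for
    other vectors follow by homogeneity.  In dimension 0 there is no unit vector,
    but then every F a vanishes. *)
Lemma bnd_unit_scale d' (T : measurableType d') (m : measure T R) (F : 'cV[R]_d -> T -> R) K a :
  (forall a c x, F (c *: a) x = c * F a x) ->
  ((exists b : 'cV[R]_d, vnorm2 b = 1) -> 0 <= K) ->
  (forall b : 'cV[R]_d, vnorm2 b = 1 -> bnd m M (F b) K) -> bnd m M (F a) (vnorm2 a * K).
Proof.
move=> FZ K0 FK; have [a0|a0] := eqVneq (vnorm2 a) 0.
  have -> : F a = fun=> 0.
    apply/funext => x; rewrite (_ : a = 0 *: a) ?FZ ?mul0r//.
    by apply/matrixP => i j; rewrite !mxE ord1 vnorm2_eq0// mulr0.
  by rewrite a0 mul0r; exact: bnd_cst0.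
have e1 : vnorm2 ((vnorm2 a)^-1 *: a) = 1.
  by rewrite vnorm2_scale ger0_norm ?invr_ge0 ?vnorm2_ge0// mulVf.
have := bnd_scale (vnorm2 a) M0 (FK _ e1); rewrite (ger0_norm (vnorm2_ge0 a)).
by congr bnd; apply/funext => x; rewrite -FZ scalerA divff// scale1r.
Qed.

Lemma linZ t a c h : lin coord t (c *: a) h = c * lin coord t a h.
Proof. by rewrite /lin mulr_sumr; apply: eq_bigr => i _; rewrite mxE mulrA. Qed.

Lemma coord_lin_bnd t a : bnd mu M (lin coord t a) (C * vnorm2 a).
Proof.
rewrite mulrC; apply: (@bnd_unit_scale _ _ mu (lin coord t)) => // [b c h|b b1].
  exact: linZ.
apply/bnd_path; first exact: measurable_lin.
apply/bnd_Lnorm => //.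
  by apply: (measurableT_comp (measurable_lin t b)); exact: measurable_path.
apply: le_trans z_bnd; apply: ereal_sup_ubound; exists (t, b) => //=.
by congr rvnorm; apply/funext => w; rewrite dotp_process.
Qed.

(** The coefficient as a real number: it is finite when unit vectors exist, and the
    supremum of the empty set is -oo, with real part 0, when there is none. *)
Definition fine_delta q : R := fine (delta g e edag M q).

(** A norm of a difference along b is nonnegative and below the supremum; the case
    s = 0 of the summability condition bounds each coefficient. *)
Lemma delta_unit (b : 'cV[R]_d) : vnorm2 b = 1 ->
  forall q, (0 <= delta g e edag M q)%E /\ delta g e edag M q = (fine_delta q)%:E.
Proof.
move=> b1.
have dge0 q : (0 <= delta g e edag M q)%E.
  apply: (@le_trans _ _ (delta_ g e edag M 0 q)).
    apply: (@le_trans _ _ (rvnorm P M (fun w =>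
        dotp b (process g e 0 w - coupled_process g e edag 0 q w)))).
      exact: Lnorm_ge0.
    by apply: ereal_sup_ubound; exists b.
  by apply: ereal_sup_ubound; exists 0.
move=> q; split=> //; rewrite /fine_delta fineK// ge0_fin_numE//.
apply: (@le_lt_trans _ _ C%:E); last exact: ltry.
apply: le_trans delta_bnd.
apply: (@le_trans _ _ (((1 + 0%:R) `^ alpha)%:E * \sum_(0 <= q <oo) delta g e edag M q)%E).
  rewrite addr0 powR1 mul1e.
  apply: (@le_trans _ _ (\sum_(0 <= q < q.+1) delta g e edag M q)%E).
    by rewrite big_nat_recr//= leeDr// sume_ge0.
  exact: nneseries_lim_ge.
by apply: ereal_sup_ubound; exists 0%N.
Qed.

Lemma delta_no_unit : ~ (exists b : 'cV[R]_d, vnorm2 b = 1) -> forall q, fine_delta q = 0.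
Proof.
move=> nb q; rewrite /fine_delta.
suff -> : delta g e edag M q = -oo%E by [].
apply/eqP; rewrite -leeNy_eq; apply: ge_ereal_sup => _ [t _ <-].
by apply: ge_ereal_sup => y [b b1 _]; case: nb; exists b.
Qed.

Lemma fine_delta_ge0 q : 0 <= fine_delta q.
Proof.
have [[b /delta_unit/(_ q)[h e1]]|nb] := pselect (exists b : 'cV[R]_d, vnorm2 b = 1).
  by rewrite -lee_fin -e1.
by rewrite delta_no_unit.
Qed.

Lemma fine_delta_sum s n : \sum_(s <= q < n) fine_delta q <= C / (1 + s%:R) `^ alpha.
Proof.
have a0 : 0 < (1 + s%:R : R) `^ alpha by rewrite powR_gt0// ltr_wpDr.
have [[b b1]|nb] := pselect (exists b : 'cV[R]_d, vnorm2 b = 1); last first.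
  by rewrite big1 ?divr_ge0// ?ltW// => q _; exact: delta_no_unit.
have dE := delta_unit b1.
rewrite ler_pdivlMr// mulrC -lee_fin; apply: le_trans delta_bnd.
apply: (@le_trans _ _ (((1 + s%:R) `^ alpha)%:E * \sum_(s <= q <oo) delta g e edag M q)%E).
  rewrite EFinM lee_wpmul2l ?lee_fin ?(ltW a0)// -sumEFin.
  under eq_bigr do rewrite -(dE _).2.
  by apply: nneseries_lim_ge => q _ _; exact: (dE q).1.
by apply: ereal_sup_ubound; exists s.
Qed.

(** [delta_] compares the process along the innovations with the process along the
    innovations and their copy; the joint law transfers this to [mu \x mu]. *)
Lemma coord_lin_diff t a q : bnd (mu \x mu)%E M
  (fun z => lin coord t a z.1 - lin coord t a (merge [set~ t - q%:Z] z.1 z.2))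
  (vnorm2 a * fine_delta q).
Proof.
apply: (@bnd_unit_scale _ _ (mu \x mu)%E (fun a (z : traj H * traj H) =>
  lin coord t a z.1 - lin coord t a (merge [set~ t - q%:Z] z.1 z.2))).
- by move=> b c z; rewrite !linZ mulrBr.
- by move=> _; exact: fine_delta_ge0.
move=> b b1; apply: (bnd_joint (edag := edag) e_indep e_copy).
  apply: measurable_funB.
    by apply: (measurableT_comp (measurable_lin t b)); exact: measurable_fst.
  by apply: (measurableT_comp (measurable_lin t b)); exact: measurable_merge.
apply/bnd_Lnorm; rewrite ?fine_delta_ge0//.
  apply: measurable_funB; apply: (measurableT_comp (measurable_lin t b)).
    exact: measurable_path.
  apply: measurable_traj => k; rewrite /merge; case: asboolP => _; exact: measurable_funP.
rewrite -(delta_unit b1 q).2.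
apply: (@le_trans _ _ (delta_ g e edag M t q)); last first.
  by apply: ereal_sup_ubound; exists t.
apply: ereal_sup_ubound; exists b => //=.
by congr rvnorm; apply/funext => w; rewrite dotp_coupled.
Qed.

Lemma coord_mean t i : \int[mu]_h coord t i h = 0.
Proof.
have jc : mu.-integrable setT (EFin \o coord t i).
  by apply: (bnd_integrable M1); rewrite -lin_delta; exact: coord_lin_bnd.
rewrite /Rintegral; have := z_mean t i; rewrite unlock => h.
suff -> : (\int[mu]_h (coord t i h)%:E = 0)%E by [].
rewrite -h (@integral_distribution _ _ _ _ _ P (path e) (EFin \o coord t i))//.
- exact: measurable_int jc.
- exact: integrable_path.
Qed.

Lemma ae_path (A : traj H -> Prop) : (\forall h \ae mu, A h) ->
  \forall w \ae P, A (path e w).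
Proof.
move=> [N [mN N0 AN]]; exists (path e @^-1` N); split=> //.
  by rewrite -[X in measurable X]setTI; exact: measurable_path.
by move=> w /= h; exact: AN.
Qed.

Lemma cond_exp_version_measurable J X Y :
  cond_exp_version P (sigma_field e J) X Y -> measurable_fun setT Y.
Proof.
by move=> [GY _ _] _ B mB; rewrite setTI; apply: sigma_field_measurable; exact: GY.
Qed.

(** Versions are given coordinate by coordinate and are recombined by linearity. *)
Lemma lin_condE_version J t a (Y : Omega -> 'cV[R]_d) :
  cond_exp_version_vec P (sigma_field e J) (process g e t) Y ->
  \forall w \ae P, condE mu J (lin coord t a) (path e w) = \sum_i a i 0 * Y w i 0.
Proof.
move=> hY.
have jc i : mu.-integrable setT (EFin \o coord t i).
  by apply: (bnd_integrable M1); rewrite -lin_delta; exact: coord_lin_bnd.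
have l := ae_path (condE_linear swap_mu (s := index_enum 'I_d) J (fun i => a i 0)
  (f := coord t) (fun i _ => jc i)).
have hc := ae_all_seq (s := index_enum 'I_d) (fun i _ =>
  cond_exp_version_condE e_indep (jc i) (hY i)).
apply: (ae_imply2 l hc) => w -> hw; apply: eq_bigr => i _.
by rewrite hw// mem_index_enum.
Qed.

Lemma process_sum_bnd T (a : nat -> 'cV[R]_d) :
  (rvnorm P M (fun w => \sum_(1 <= t < T.+1) dotp (a t) (process g e t%:Z w))%R <=
   (burkholder_cst M * C * Num.sqrt (\sum_(1 <= t < T.+1) vnorm2 (a t) ^+ 2))%:E)%E.
Proof.
have b := lin_sum_bnd swap_mu M_gt fine_delta_ge0 coord_depends coord_lin_bnd coord_lin_diff
  coord_mean fine_delta_sum 1 T.+1 a.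
have [mb Kb _] := b; have bP := (bnd_path e M _ mb).1 b.
have -> : (fun w => \sum_(1 <= t < T.+1) dotp (a t) (process g e t%:Z w)) =
    (fun w => \sum_(1 <= t < T.+1) lin coord t%:Z (a t) (path e w)).
  by apply/funext => w; apply: eq_bigr => t _; exact: dotp_process.
have [mP _ _] := bP; exact: ((bnd_Lnorm P M0 mP Kb).1 bP).
Qed.

Lemma process_window_bnd T (a : nat -> 'cV[R]_d) s (Y : nat -> Omega -> 'cV[R]_d) :
  (forall t : nat, (1 <= t <= T)%N ->
    cond_exp_version_vec P (F_ e t%:Z s) (process g e t%:Z) (Y t)) ->
  (rvnorm P M (fun w =>
     \sum_(1 <= t < T.+1) dotp (a t) (process g e t%:Z w - Y t w))%R <=
   (burkholder_cst M * (C / (1 + s.+1%:R) `^ alpha *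
      Num.sqrt (\sum_(1 <= t < T.+1) vnorm2 (a t) ^+ 2)))%:E)%E.
Proof.
move=> hY.
have b := lin_window_bnd swap_mu M_gt fine_delta_ge0 coord_depends coord_lin_bnd
  coord_lin_diff fine_delta_sum 1 T.+1 s.+1 a.
have [mb Kb _] := b; have bP := (bnd_path e M _ mb).1 b.
have tT t : t \in index_iota 1 T.+1 -> (1 <= t <= T)%N by rewrite mem_index_iota.
have mS : measurable_fun setT (fun w =>
    \sum_(1 <= t < T.+1) dotp (a t) (process g e t%:Z w - Y t w)).
  apply: measurable_sum_in => t /tT/hY hYt.
  rewrite (_ : (fun w => _) = fun w => \sum_i a t i 0 * (coord t%:Z i (path e w) - Y t w i 0)).
    apply: measurable_sum_in => i _; apply: measurable_funM => //.
    apply: measurable_funB.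
      apply: (measurableT_comp (measurable_coord_process _ _)); exact: measurable_path.
    by have := hYt i; rewrite F_window => /cond_exp_version_measurable.
  by apply/funext => w; rewrite /dotp mxE; apply: eq_bigr => i _; rewrite !mxE.
apply: (bnd_Lnorm P M0 mS Kb).1.
apply: (bnd_ae mS _ bP).
have ae : \forall w \ae P, forall t, t \in index_iota 1 T.+1 ->
    condE mu (window t%:Z s.+1) (lin coord t%:Z (a t)) (path e w) =
    \sum_i a t i 0 * Y t w i 0.
  apply: ae_all_seq => t /tT/hY; rewrite F_window; exact: lin_condE_version.
apply: (ae_imply ae) => w hw; rewrite [LHS]big_seq [RHS]big_seq.
apply: eq_bigr => t ts; rewrite hw// -sumrB /dotp mxE; apply: eq_bigr => i _.
by rewrite !mxE mulrBr.
Qed.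

Section bilinear.
Variables (A : nat -> nat -> 'M[R]_d) (l1 l2 T : nat).
Let nA t1 t2 := mnorm2 (A t1 t2).
Let nA0 t1 t2 : 0 <= nA t1 t2. Proof. exact: (mnorm2_frobenius _).1. Qed.
Let nAF t1 t2 : \sum_i vnorm2 (rowv (A t1 t2) i) ^+ 2 <= d%:R * nA t1 t2 ^+ 2.
Proof. exact: (mnorm2_frobenius _).2. Qed.

Let bil_int t1 t2 (B : 'M[R]_d) : mu.-integrable setT (EFin \o bil coord t1 t2 B).
Proof.
have [B0 BF] := mnorm2_frobenius B.
apply: (bnd_integrable _ (bil_bnd M_gt coord_lin_bnd t1 t2 B0 BF)).
by move: M_gt; lra.
Qed.

Lemma bilinear_centered_bnd :
  (rvnorm P (M / 2) (fun w =>
     \sum_(1 + l1 <= t1 < T.+1) \sum_(maxn (t1 - l2) 1 <= t2 < (t1 - l1).+1)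
       (bilin (process g e t1%:Z w) (A t1 t2) (process g e t2%:Z w) -
        fine ('E_P[fun w' =>
          bilin (process g e t1%:Z w') (A t1 t2) (process g e t2%:Z w')])%E))%R <=
   (burkholder_cst (M / 2) * C * (burkholder_cst M * C * Num.sqrt (d%:R *
      \sum_(1 + l1 <= t < T.+1) \sum_(maxn (t - l2) 1 <= t2 < (t - l1).+1) nA t t2 ^+ 2)) +
    2 * (burkholder_cst M * (C / (1 + l1%:R) `^ alpha) * (burkholder_cst M * C) *
      (d%:R * (Num.sqrt T%:R * Num.sqrt (\sum_(1 + l1 <= t < T.+1)
         \sum_(maxn (t - l2) 1 <= t2 < (t - l1).+1) nA t t2 ^+ 2)))))%:E)%E.
Proof.
have b := lagsum_centered_bnd swap_mu M_gt C_ge0 fine_delta_ge0 coord_depends coord_lin_bnd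
  coord_lin_diff coord_mean fine_delta_sum l1 l2 T nAF.
have [mb Kb _] := b; have bP := (bnd_path e (M / 2) _ mb).1 b.
set F := (fun w => _); set F' := (fun w => _) in bP.
suff -> : F = F'.
  by have [mP _ _] := bP; exact: ((bnd_Lnorm P half_gt0 mP Kb).1 bP).
apply/funext => w; apply: eq_bigr => t1 _.
have mean t2 : fine ('E_P[fun w' => bilin (process g e t1%:Z w') (A t1 t2)
    (process g e t2%:Z w')])%E = \int[mu]_h bil coord t1%:Z t2%:Z (A t1 t2) h.
  rewrite /Rintegral unlock; congr fine.
  have j := bil_int t1%:Z t2%:Z (A t1 t2).
  rewrite (@integral_distribution _ _ _ _ _ P (path e)
    (EFin \o bil coord t1%:Z t2%:Z (A t1 t2)))//.
  - by apply: eq_integral => v _; rewrite /= bilin_process.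
  - exact: measurable_int j.
  - exact: integrable_path.
rewrite sumrB; congr (_ - _).
  by apply: eq_bigr => t2 _; rewrite bilin_process.
under eq_bigr do rewrite mean; rewrite /lagsum.
elim: (index_iota _ _) => [|t2 s IH].
  by rewrite big_nil; under eq_Rintegral do rewrite big_nil; rewrite Rintegral_cst_prob.
rewrite big_cons IH; under [RHS]eq_Rintegral do rewrite big_cons.
rewrite RintegralD//.
rewrite (_ : _ \o _ = fun h => (\sum_(j <- s) (bil coord t1%:Z j%:Z (A t1 j) h)%:E)%E).
  by apply: integrable_sum => // j _; exact: bil_int.
by apply/funext => h /=; rewrite sumEFin.
Qed.

Lemma bilinear_window_bnd S (Y : nat -> nat -> Omega -> R) amax : 0 <= alpha ->
  (l2 < S)%N -> 0 <= amax ->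
  (forall t1 t2, (1 + l1 <= t1 < T.+1)%N ->
    (maxn (t1 - l2) 1 <= t2 < (t1 - l1).+1)%N -> nA t1 t2 <= amax) ->
  (forall t1 t2 : nat, (1 + l1 <= t1 <= T)%N ->
    (maxn (t1 - l2) 1 <= t2 <= t1 - l1)%N ->
    cond_exp_version P (F_ e t1%:Z S)
      (fun w => bilin (process g e t1%:Z w) (A t1 t2) (process g e t2%:Z w))
      (Y t1 t2)) ->
  (rvnorm P (M / 2) (fun w =>
     \sum_(1 + l1 <= t1 < T.+1) \sum_(maxn (t1 - l2) 1 <= t2 < (t1 - l1).+1)
       (bilin (process g e t1%:Z w) (A t1 t2) (process g e t2%:Z w) - Y t1 t2 w))%R <=
   (burkholder_cst (M / 2) * (l2.+1%:R * (2 * C / (S - l2)%:R `^ alpha) *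
      Num.sqrt (\sum_(1 + l1 <= t < T.+1) (C * (d%:R * amax)) ^+ 2)))%:E)%E.
Proof.
move=> al0 lS am0 hA hY.
have b := lagsum_window_bnd swap_mu M_gt C_ge0 C_ge0 al0 fine_delta_ge0 coord_depends
  coord_lin_bnd coord_lin_diff fine_delta_sum nA0 nAF lS hA am0.
have [mb Kb _] := b; have bP := (bnd_path e (M / 2) _ mb).1 b.
have hY' t1 t2 : t1 \in index_iota (1 + l1) T.+1 ->
    t2 \in index_iota (maxn (t1 - l2) 1) (t1 - l1).+1 ->
    cond_exp_version P (sigma_field e (window t1%:Z S.+1))
      (fun w => bil coord t1%:Z t2%:Z (A t1 t2) (path e w)) (Y t1 t2).
  rewrite !mem_index_iota => h1 h2; have := hY t1 t2 h1 h2; rewrite F_window.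
  by congr cond_exp_version; apply/funext => w; exact: bilin_process.
have mS : measurable_fun setT (fun w => \sum_(1 + l1 <= t1 < T.+1)
    \sum_(maxn (t1 - l2) 1 <= t2 < (t1 - l1).+1)
    (bilin (process g e t1%:Z w) (A t1 t2) (process g e t2%:Z w) - Y t1 t2 w)).
  apply: measurable_sum_in => t1 h1; apply: measurable_sum_in => t2 h2.
  apply: measurable_funB; last exact: cond_exp_version_measurable (hY' _ _ h1 h2).
  rewrite (_ : (fun w => _) = bil coord t1%:Z t2%:Z (A t1 t2) \o path e).
    apply: measurableT_comp; last exact: measurable_path.
    by apply/measurable_EFinP; exact: measurable_int (bil_int _ _ _).
  by apply/funext => w; exact: bilin_process.
apply: (bnd_Lnorm P half_gt0 mS Kb).1.
apply: (bnd_ae mS _ bP).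
have ae : \forall w \ae P, forall t1, t1 \in index_iota (1 + l1) T.+1 ->
    forall t2, t2 \in index_iota (maxn (t1 - l2) 1) (t1 - l1).+1 ->
    condE mu (window t1%:Z S.+1) (bil coord t1%:Z t2%:Z (A t1 t2)) (path e w) = Y t1 t2 w.
  apply: ae_all_seq => t1 h1; apply: ae_all_seq => t2 h2.
  exact: (cond_exp_version_condE e_indep (bil_int _ _ _) (hY' _ _ h1 h2)).
apply: (ae_imply ae) => w hw; rewrite [LHS]big_seq [RHS]big_seq.
apply: eq_bigr => t1 h1; rewrite [LHS]big_seq [RHS]big_seq.
by apply: eq_bigr => t2 h2; rewrite hw// bilin_process.
Qed.

End bilinear.
End fixed_sample.

(** * Uniform constants *)

(** T = (T^kappa)^(1 / kappa) <= (T^kappa)^alpha as kappa alpha >= 1 and T >= 1. *)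
Lemma lag_growth (R : realType) (T l : nat) (kappa alpha c : R) : (0 < T)%N ->
  0 <= c -> 0 <= alpha -> 1 <= kappa * alpha -> T%:R `^ kappa <= c * l%:R ->
  T%:R / (1 + l%:R) `^ alpha <= c `^ alpha.
Proof.
move=> T0 c0 al0 ka h.
have l0 : 0 <= l%:R :> R := ler0n _ _.
rewrite ler_pdivrMr ?powR_gt0 ?(ltr_wpDr _ _ l0)//.
apply: (@le_trans _ _ ((T%:R `^ kappa) `^ alpha)).
  rewrite -powRrM -[leLHS]powRr1 ?ler0n//.
  by apply: ler_powR => //; rewrite ler1n.
apply: (@le_trans _ _ ((c * l%:R) `^ alpha)).
  by apply: ge0_ler_powR; rewrite ?nnegrE ?powR_ge0 ?mulr_ge0.
rewrite powRM// ler_wpM2l ?powR_ge0//.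
by apply: ge0_ler_powR; rewrite ?nnegrE ?addr_ge0 ?lerDr.
Qed.

Lemma kappa_alpha_ge1 (R : realType) (kappa alpha : R) : 8 < alpha ->
  5 / (2 * (alpha - 2)) < kappa -> 1 <= kappa * alpha.
Proof.
move=> al; rewrite ltr_pdivrMr => [h|]; last by lra.
by nra.
Qed.

(** The residual term is d sqrt(T) sqrt(W) / q = sqrt(d W) sqrt(d T) / q, where
    sqrt(d T) <= sqrt(Cd) T and T / q <= g. *)
Lemma centered_constant_le (R : realType) (d T : nat) (B B' C Cd g W q : R) :
  0 <= B' -> 0 <= C -> 0 <= Cd -> 0 < q -> 0 <= W ->
  d%:R <= Cd * T%:R -> T%:R / q <= g ->
  B * C * (B' * C * Num.sqrt (d%:R * W)) +
    2 * (B' * (C / q) * (B' * C) * (d%:R * (Num.sqrt T%:R * Num.sqrt W))) <=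
  (B * C * (B' * C) + 2 * ((B' * C) ^+ 2 * (Num.sqrt Cd * g))) * Num.sqrt (d%:R * W).
Proof.
move=> B0 C0 Cd0 q0 W0 dT Tg.
have d0 : 0 <= d%:R :> R := ler0n _ _.
have T0 : 0 <= T%:R :> R := ler0n _ _.
have hd : d%:R * (Num.sqrt T%:R * Num.sqrt W) <=
    Num.sqrt Cd * T%:R * Num.sqrt (d%:R * W).
  have -> : d%:R * (Num.sqrt T%:R * Num.sqrt W) =
      Num.sqrt (d%:R * T%:R) * Num.sqrt (d%:R * W).
    by rewrite !sqrtrM// -[X in X * _ = _](sqr_sqrtr d0); ring.
  rewrite ler_wpM2r ?sqrtr_ge0//.
  apply: (@le_trans _ _ (Num.sqrt (Cd * T%:R * T%:R))).
    by rewrite ler_wsqrtr// ler_wpM2r.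
  by rewrite -mulrA sqrtrM// -expr2 sqrtr_sqr ger0_norm.
rewrite [leRHS]mulrDl lerD//; first by rewrite -!mulrA.
rewrite -[leRHS]mulrA ler_wpM2l//.
have -> : B' * (C / q) * (B' * C) * (d%:R * (Num.sqrt T%:R * Num.sqrt W)) =
    (B' * C) ^+ 2 * ((d%:R * (Num.sqrt T%:R * Num.sqrt W)) / q).
  by field; exact: lt0r_neq0.
rewrite -[leRHS]mulrA ler_wpM2l ?sqr_ge0//.
apply: (@le_trans _ _ (Num.sqrt Cd * T%:R * Num.sqrt (d%:R * W) / q)).
  by rewrite ler_wpM2r// invr_ge0 ltW.
have -> : Num.sqrt Cd * T%:R * Num.sqrt (d%:R * W) / q =
   Num.sqrt Cd * (T%:R / q) * Num.sqrt (d%:R * W) by ring.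
by rewrite ler_wpM2r ?sqrtr_ge0// ler_wpM2l ?sqrtr_ge0.
Qed.

Lemma lag_square (l S : nat) : (2 * l < S)%N -> (l.+1 <= (S - l) ^ 2)%N.
Proof.
move=> lS; have h : (l.+1 <= S - l)%N by lia.
by apply: (leq_trans h); rewrite -{1}[(S - l)%N]expn1 leq_pexp2l//; lia.
Qed.

(** As S > 2 l2, the factor l2 + 1 is absorbed by (S - l2)^2, at the cost of two
    powers of the rate. *)
Lemma window_constant_le (R : realType) (d T l1 l2 S : nat) (B C Cd a alpha : R) :
  0 <= B -> 0 <= C -> 0 <= Cd -> 0 <= a -> d%:R <= Cd * T%:R -> (2 * l2 < S)%N ->
  B * (l2.+1%:R * (2 * C / (S - l2)%:R `^ alpha) *
    Num.sqrt (\sum_(1 + l1 <= t < T.+1) (C * (d%:R * a)) ^+ 2)) <=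
  (B * 2 * C * C * Cd + 1) * T%:R * Num.sqrt T%:R * a / (S - l2)%:R `^ (alpha - 2).
Proof.
move=> B0 C0 Cd0 a0 dT lS.
have T0 : 0 <= T%:R :> R := ler0n _ _.
have Sl : (0 : R) < (S - l2)%:R by rewrite ltr0n subn_gt0; lia.
have p0 : (0 : R) < (S - l2)%:R `^ (alpha - 2) by exact: powR_gt0.
have pE : ((S - l2)%:R : R) `^ alpha = (S - l2)%:R `^ (alpha - 2) * (S - l2)%:R ^+ 2.
  by rewrite -powR_mulrn ?ler0n// -powRD ?subrK// pnatr_eq0 -lt0n -(ltr0n R) Sl implybT.
have h1 : Num.sqrt (\sum_(1 + l1 <= t < T.+1) (C * (d%:R * a)) ^+ 2) <=
    Num.sqrt T%:R * (C * (Cd * T%:R * a)).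
  rewrite sumr_const_nat -[_ *+ _]mulr_natl.
  rewrite sqrtrM ?ler0n// sqrtr_sqr ger0_norm ?mulr_ge0 ?ler0n//.
  apply: ler_pM; rewrite ?sqrtr_ge0 ?mulr_ge0 ?ler0n//.
    by rewrite ler_wsqrtr// ler_nat; lia.
  by rewrite ler_wpM2l// ler_wpM2r.
have h2 : l2.+1%:R * (2 * C / (S - l2)%:R `^ alpha) <= 2 * C / (S - l2)%:R `^ (alpha - 2).
  rewrite mulrCA ler_wpM2l ?mulr_ge0// pE invfM mulrCA.
  rewrite ler_piMr// ?invr_ge0 ?powR_ge0//.
  by rewrite ler_pdivrMr ?exprn_gt0// mul1r -natrX ler_nat lag_square.
apply: (@le_trans _ _ (B * (2 * C / (S - l2)%:R `^ (alpha - 2) *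
   (Num.sqrt T%:R * (C * (Cd * T%:R * a)))))).
  rewrite ler_wpM2l//; apply: ler_pM => //; rewrite ?sqrtr_ge0//.
  by rewrite !mulr_ge0 ?ler0n ?invr_ge0 ?powR_ge0.
rewrite -subr_ge0.
have -> : (B * 2 * C * C * Cd + 1) * T%:R * Num.sqrt T%:R * a / (S - l2)%:R `^ (alpha - 2) -
  B * (2 * C / (S - l2)%:R `^ (alpha - 2) * (Num.sqrt T%:R * (C * (Cd * T%:R * a)))) =
  T%:R * Num.sqrt T%:R * a / (S - l2)%:R `^ (alpha - 2) by ring.
by rewrite !mulr_ge0 ?sqrtr_ge0 ?invr_ge0 ?powR_ge0 ?ler0n.
Qed.

Theorem theorem3p1
  (R : realType) (dO dH : measure_display)
  (Omega : measurableType dO) (H : measurableType dH)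
  (P : probability Omega R)
  (e edag : int -> {RV P >-> H})
  (T0 : nat) (d1 d2 : nat -> nat)
  (g : forall T : nat, int -> (nat -> H) -> 'cV[R]_(d1 T + d2 T))
  (M alpha : R)
  (hT0 : (0 < T0)%N)
  (hcopy : independent_copy e edag)
  (hM : 8 < M) (halpha : 8 < alpha)
  (hsrd : short_range_dependent T0 g e edag M alpha)
  (hd : unif_bigO T0 (fun T => ((d1 T + d2 T)%N%:R)%:E) (fun T => T%:R : R)) :
  let z := fun T : nat => process (g T) e in
  (exists C : R, forall T : nat, (T0 <= T)%N ->
    forall a : nat -> 'cV[R]_(d1 T + d2 T),
      (rvnorm P M (fun w =>
          (\sum_(1 <= t < T.+1) dotp (a t) (z T t%:Z w)))%R
        <= (C * Num.sqrt (\sum_(1 <= t < T.+1) vnorm2 (a t) ^+ 2))%:E)%E /\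
      forall (s : nat) (Y : nat -> Omega -> 'cV[R]_(d1 T + d2 T)),
        (forall t : nat, (1 <= t <= T)%N ->
          cond_exp_version_vec P (F_ e t%:Z s) (z T t%:Z) (Y t)) ->
        (rvnorm P M (fun w =>
            (\sum_(1 <= t < T.+1) dotp (a t) (z T t%:Z w - Y t w)))%R
          <= (C / (1 + s%:R) `^ alpha *
              Num.sqrt (\sum_(1 <= t < T.+1) vnorm2 (a t) ^+ 2))%:E)%E) /\
  (forall (lam1 lam2 : nat -> nat) (kappa1 kappa2 : R),
    (forall T : nat, (T0 <= T)%N ->
      [/\ 1 < lam1 T, lam1 T < lam2 T & lam2 T < T]%N) ->
    unif_asymp T0 (fun T => (lam1 T)%:R) (fun T => T%:R `^ kappa1) ->
    unif_asymp T0 (fun T => (lam2 T)%:R) (fun T => T%:R `^ kappa2) ->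
    kappa2 < 1 -> kappa1 < kappa2 -> 5 / (2 * (alpha - 2)) < kappa1 ->
    (exists C : R, forall T : nat, (T0 <= T)%N ->
      forall A : nat -> nat -> 'M[R]_(d1 T + d2 T),
        (forall t1 t2, (A t1 t2)^T = A t1 t2) ->
        (rvnorm P (M / 2) (fun w =>
            (\sum_(1 + lam1 T <= t1 < T.+1)
             \sum_(maxn (t1 - lam2 T) 1 <= t2 < (t1 - lam1 T).+1)
               (bilin (z T t1%:Z w) (A t1 t2) (z T t2%:Z w) -
                fine ('E_P[fun w' =>
                  bilin (z T t1%:Z w') (A t1 t2) (z T t2%:Z w')]))))%R
          <= (C * Num.sqrt ((d1 T + d2 T)%N%:R *
               \sum_(1 + lam1 T <= t1 < T.+1)
               \sum_(maxn (t1 - lam2 T) 1 <= t2 < (t1 - lam1 T).+1)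
                 mnorm2 (A t1 t2) ^+ 2))%:E)%E) /\
    (exists2 C : R, 0 < C & forall T : nat, (T0 <= T)%N ->
      forall A : nat -> nat -> 'M[R]_(d1 T + d2 T),
        (forall t1 t2, (A t1 t2)^T = A t1 t2) ->
      forall S : nat, (2 * lam2 T < S)%N ->
      forall Y : nat -> nat -> Omega -> R,
        (forall t1 t2 : nat, (1 + lam1 T <= t1 <= T)%N ->
          (maxn (t1 - lam2 T) 1 <= t2 <= t1 - lam1 T)%N ->
          cond_exp_version P (F_ e t1%:Z S)
            (fun w => bilin (z T t1%:Z w) (A t1 t2) (z T t2%:Z w))
            (Y t1 t2)) ->
        let adag := \big[Num.max/0]_(1 + lam1 T <= t1 < T.+1)
                    \big[Num.max/0]_(maxn (t1 - lam2 T) 1 <= t2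
                                       < (t1 - lam1 T).+1)
                      mnorm2 (A t1 t2) in
        (rvnorm P (M / 2) (fun w =>
            (\sum_(1 + lam1 T <= t1 < T.+1)
             \sum_(maxn (t1 - lam2 T) 1 <= t2 < (t1 - lam1 T).+1)
               (bilin (z T t1%:Z w) (A t1 t2) (z T t2%:Z w) - Y t1 t2 w)))%R
          <= (C * T%:R * Num.sqrt T%:R * adag /
              (S - lam2 T)%N%:R `^ (alpha - 2))%:E)%E)).
Proof.
have M0 : 0 < M by move: hM; lra.
have al0 : 0 <= alpha by move: halpha; lra.
have [e_indep g_meas z_mean [Cz hz] [Cdlt hdlt]] := hsrd.
have [Cd0 hd0] := hd.
(* A constant that bounds a supremum may be negative when the supremum is -oo, as in
   dimension 0. *)
pose C := Num.max 0 (Num.max Cz Cdlt); pose Cd := Num.max 0 Cd0.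
have C0 : 0 <= C by rewrite le_max lexx.
have Cd_ge0 : 0 <= Cd by rewrite le_max lexx.
have dT T : (T0 <= T)%N -> (d1 T + d2 T)%N%:R <= Cd * T%:R :> R.
  move=> /hd0; rewrite lee_fin => /le_trans; apply.
  by rewrite ler_wpM2r// le_max lexx orbT.
have zC T : (T0 <= T)%N -> (ereal_sup
    [set rvnorm P M (fun w => dotp ta.2 (process (g T) e ta.1 w))
      | ta in [set ta : int * 'cV[R]_(d1 T + d2 T) | vnorm2 ta.2 = 1%R]] <= C%:E)%E.
  by move=> /hz /le_trans; apply; rewrite lee_fin mulr1 !le_max lexx orbT.
have dC T : (T0 <= T)%N -> (ereal_sup
    [set (((1 + s%:R) `^ alpha)%:E * \sum_(s <= q <oo) delta (g T) e edag M q)%E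
      | s in [set: nat]] <= C%:E)%E.
  by move=> /hdlt /le_trans; apply; rewrite lee_fin mulr1 !le_max lexx !orbT.
have gT T : (T0 <= T)%N -> forall t, seq_measurable (g T t).
  by move=> hT t; exact: g_meas.
have mT T : (T0 <= T)%N -> forall t (i : 'I_(d1 T + d2 T)),
    ('E_P[fun w => process (g T) e t w i 0%R] = 0)%E.
  by move=> hT t i; exact: z_mean.
move=> z; split.
  exists (burkholder_cst M * C) => T hT a; split.
    exact: (process_sum_bnd e_indep hcopy (gT T hT) hM C0 (mT T hT) (zC T hT) (dC T hT)).
  move=> s Y hY.
  apply: (le_trans (process_window_bnd e_indep hcopy (gT T hT) hM C0 (zC T hT) (dC T hT)
    a hY)).
  rewrite lee_fin mulrA ler_wpM2r ?sqrtr_ge0// -mulrA ler_wpM2l ?burkholder_cst_ge0//.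
  rewrite ler_wpM2l// lef_pV2 ?posrE ?powR_gt0 ?ltr_wpDr//.
  by apply: ge0_ler_powR; rewrite ?nnegrE ?addr_ge0// lerD2l ler_nat.
move=> lam1 lam2 kappa1 kappa2 lamP [_ [c1 hc1]] _ _ _ hkappa; split.
  pose c := Num.max 0 c1; have c0 : 0 <= c by rewrite le_max lexx.
  exists (burkholder_cst (M / 2) * C * (burkholder_cst M * C) +
    2 * ((burkholder_cst M * C) ^+ 2 * (Num.sqrt Cd * c `^ alpha))) => T hT A _.
  apply: (le_trans (bilinear_centered_bnd e_indep hcopy (gT T hT) hM C0 (mT T hT)
    (zC T hT) (dC T hT) A (lam1 T) (lam2 T) T)).
  rewrite lee_fin; apply: centered_constant_le => //.
  - exact: burkholder_cst_ge0.
  - by rewrite sumr_ge0// => t1 _; rewrite sumr_ge0// => t2 _; exact: sqr_ge0.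
  - exact: dT.
  apply: (lag_growth (kappa := kappa1)) => //; first exact: leq_trans hT.
    exact: kappa_alpha_ge1.
  have := hc1 T hT; rewrite /= lee_fin => /le_trans; apply.
  by rewrite ler_wpM2r// le_max lexx orbT.
have KB0 : 0 <= burkholder_cst (M / 2) by apply: burkholder_cst_ge0; move: hM; lra.
exists (burkholder_cst (M / 2) * 2 * C * C * Cd + 1).
  by rewrite ltr_wpDl// !mulr_ge0.
move=> T hT A _ S hS Y hY; cbv zeta.
set adag := \big[Num.max/0]_(1 + lam1 T <= t1 < T.+1)
  \big[Num.max/0]_(maxn (t1 - lam2 T) 1 <= t2 < (t1 - lam1 T).+1) mnorm2 (A t1 t2).
have hA t1 t2 : (1 + lam1 T <= t1 < T.+1)%N ->
    (maxn (t1 - lam2 T) 1 <= t2 < (t1 - lam1 T).+1)%N -> mnorm2 (A t1 t2) <= adag.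
  move=> h1 h2; rewrite /adag.
  apply: (@bigmax_sup_seq _ _ _ _ _ t1) => //; first by rewrite mem_index_iota.
  by apply: (@le_bigmax_seq _ _ _ _ _ t2) => //; rewrite mem_index_iota.
have ad0 : 0 <= adag by exact: bigmax_ge_id.
have lS : (lam2 T < S)%N by apply: leq_ltn_trans hS; rewrite leq_pmull.
apply: (le_trans (bilinear_window_bnd e_indep hcopy (gT T hT) hM C0 (zC T hT) (dC T hT)
  al0 lS ad0 hA hY)).
rewrite lee_fin; apply: window_constant_le => //; exact: dT.
Qed.
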